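(* Let $m\ge1$ and $1\le k<n-1$, and consider the system $$z'=F(z,\varepsilon)=\sum_{i=0}^m\varepsilon^iF_i(z),\qquad z\in\mathbb{R}^n,\quad 0<\varepsilon\ll1,$$ with $F$ sufficiently smooth in both arguments. Suppose that the unperturbed system $z'=F_0(z)$ possesses a $k$-dimensional family of periodic orbits forming an embedded $(k+1)$-dimensional normally hyperbolic manifold $M_0$ parametrised by the embedding $\Gamma_0:U\times\mathbb{S}^1\to\mathbb{R}^n$, let $M_\varepsilon$ be the persistent invariant manifold near $M_0$, let $S_0=\Gamma_0(U\times\{0\})$ be the section of $M_0$, and for $y=\Gamma_0(x,0)\in S_0$ let $\tilde\gamma_y=\{\Gamma_0(x,\phi)\mid\phi\in\mathbb{S}^1\}$ be the unperturbed periodic orbit through $y$ (all as made precise in the context). Then there exists a vector field $\overline F$ on the section $S_0$ (i.e. $\overline F$ is tangent to $S_0$) of the form $$\overline F(y,\varepsilon)=\sum_{j=1}^m\varepsilon^j\overline F_j(y)+\mathcal{O}(\varepsilon^{m+1})$$ with the following property: if $z(t)$ is a trajectory of the full system on $M_\varepsilon$ and $y(t)$ is an integral curve of the averaged system $y'=\overline F(y,\varepsilon)$ with $\|z(0)-y(0)\|=\mathcal{O}(\varepsilon)$, then $$\mathrm{dist}\big(z(t),\tilde\gamma_{y(t)}\big)=\mathcal{O}(\varepsilon)\qquad\text{for}\quad |t|\le\frac{C}{\varepsilon},$$ where $C$ is a constant.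
   Context: Notation: $\mathbb{S}^1=\mathbb{R}/2\pi\mathbb{Z}$, and $'$ denotes $d/dt$. Manifold of periodic orbits. $U\subset\mathbb{R}^k$ is an open set parametrising the periodic orbits. For each $x\in U$, $t\mapsto\gamma_0(x,t)$ is a periodic orbit of $z'=F_0(z)$ with period $\tau(x)>0$ and frequency $\omega(x)=2\pi/\tau(x)$. The period map $x\mapsto\tau(x)$ is smooth and uniformly bounded from below and above, and the same is then true for $\omega$. The map $\Gamma_0:U\times\mathbb{S}^1\to\mathbb{R}^n$, $\Gamma_0(x,\phi):=\gamma_0(x,\omega(x)^{-1}\phi)$, is an embedding with image $M_0$; in particular $D\Gamma_0(x,\phi)$ has full rank $k+1$, and $\partial_\phi\Gamma_0(x,\phi)\,\omega(x)=F_0(\Gamma_0(x,\phi))$. The section $S_0=\{\Gamma_0(x,0)\mid x\in U\}\subset M_0$ is a $k$-dimensional submanifold of $\mathbb{R}^n$ meeting each periodic orbit of the family exactly once. Normal hyperbolicity. For $x\in U$ let $\Phi(x,t,t_0)$ be the transition matrix of the variational equation $\dot\zeta=DF_0(\gamma_0(x,t))\zeta$, i.e. $\partial_t\Phi(x,t,t_0)=DF_0(\gamma_0(x,t))\Phi(x,t,t_0)$ and $\Phi(x,t_0,t_0)=\mathbb{I}_n$. $M_0$ is normally hyperbolic if along each periodic orbit there is a splitting $\mathbb{R}^n=T_zM_0\oplus\mathcal{N}^s_z\oplus\mathcal{N}^u_z$, $z=\gamma_0(x,t)\in M_0$, invariant under $\Phi$ (that is, $\Phi(x,t,t_0)$ maps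 each summand at $\gamma_0(x,t_0)$ to the corresponding summand at $\gamma_0(x,t)$), with constants $K\ge1$, $\lambda_s,\lambda_u>0$, where $\min\{\lambda_s,\lambda_u\}$ is bounded away from zero, such that for $v^s\in\mathcal{N}^s_z$, $v^u\in\mathcal{N}^u_z$ with $z=\gamma_0(x,t_0)$, $$\|\Phi(x,t,t_0)v^s\|\le Ke^{-\lambda_s(t-t_0)}\|v^s\|\ (t\ge t_0),\qquad \|\Phi(x,t,t_0)v^u\|\le Ke^{\lambda_u(t-t_0)}\|v^u\|\ (t\le t_0),$$ while solutions starting in $T_zM_0$ stay tangent to $M_0$ and do not exhibit exponential growth or decay relative to each other. In terms of Floquet theory: for every periodic orbit exactly $k+1$ Floquet exponents are $0$ (Floquet multiplier $1$), with $T_zM_0$ as the associated generalised eigenspace, and the remaining $n-k-1$ have nonzero real part. Persistent manifold. By Fenichel's theorem, for sufficiently small $\varepsilon>0$ there is an invariant manifold $M_\varepsilon$ of $z'=F(z,\varepsilon)$ that is $C^r$-diffeomorphic to $M_0$ and lies at distance $\mathcal{O}(\varepsilon)$ from $M_0$, and the dynamics on $M_\varepsilon$ are an $\mathcal{O}(\varepsilon)$ perturbation of the dynamics on $M_0$. This is the $M_\varepsilon$ of the claim. *)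

(* Defs.v *)
From HB Require Import structures.
From mathcomp Require Import all_boot all_order all_algebra.
From mathcomp Require Import all_classical all_reals all_analysis.

Set Implicit Arguments.
Unset Strict Implicit.
Unset Printing Implicit Defensive.

Import Order.TTheory GRing.Theory Num.Theory.
Import numFieldNormedType.Exports.

Local Open Scope classical_set_scope.
Local Open Scope ring_scope.

(* R^n is 'rV[R]_n with the library (supremum) norm; passing to the Euclidean
   norm only changes constants.  The circle R/2piZ is represented by its
   universal cover: functions on U x S^1 are functions on 'rV_k * R that are
   2pi-periodic in the second argument. *)

(* C^r on an open subset of a finite-dimensional space. *)
Fixpoint Cr (R : realType) (V W : normedModType R) (r : nat)
    (A : set V) (f : V -> W) : Prop :=
  match r with
  | 0 => forall x, A x -> {for x, continuous f}
  | r'.+1 => (forall x, A x -> differentiable f x) /\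
             (forall v, Cr r' A ('D_v f))
  end.

Definition dist_set (R : realType) (n : nat) (z : 'rV[R]_n)
    (A : set 'rV[R]_n) : R :=
  inf [set `|z - w| | w in A].

Definition integral_curve (R : realType) (n : nat) (f : 'rV[R]_n -> 'rV[R]_n)
    (S : set 'rV[R]_n) (J : set R) (z : R -> 'rV[R]_n) : Prop :=
  forall t, J t -> S (z t) /\ is_derive t (1 : R) z (f (z t)).

Definition perturbed_field (R : realType) (n m : nat)
    (Fi : nat -> 'rV[R]_n -> 'rV[R]_n) (z : 'rV[R]_n) (eps : R) : 'rV[R]_n :=
  \sum_(0 <= i < m.+1) eps ^+ i *: Fi i z.

(* C^r embedding of U x S^1 in R^n: an injective immersion that is a
   homeomorphism onto its image. *)
Record embedding (R : realType) (k n : nat) (r : nat) (U : set 'rV[R]_k)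
    (G : 'rV[R]_k * R -> 'rV[R]_n) : Prop := Embedding {
  embedding_smooth : Cr r (U `*` setT) G ;
  embedding_periodic : forall x phi, U x ->
    G (x, phi + 2 * pi) = G (x, phi) ;
  embedding_inj : forall x phi x' phi', U x -> U x' ->
    G (x, phi) = G (x', phi') ->
    x = x' /\ exists j : int, phi' = phi + j%:~R * (2 * pi) ;
  embedding_immersion : forall p, U p.1 -> injective ('d G p) ;
  embedding_inverse_continuous : forall x phi, U x ->
    forall d : R, 0 < d -> exists2 e : R, 0 < e &
    forall x' phi', U x' -> `|G (x', phi') - G (x, phi)| < e ->
      `|x' - x| < d /\
      exists j : int, `|phi' + j%:~R * (2 * pi) - phi| < d }.

Definition omega (R : realType) (k : nat) (tau : 'rV[R]_k -> R)
    (x : 'rV[R]_k) : R := 2 * pi / tau x.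

Definition Gamma0 (R : realType) (k n : nat)
    (gamma0 : 'rV[R]_k -> R -> 'rV[R]_n) (tau : 'rV[R]_k -> R)
    (p : 'rV[R]_k * R) : 'rV[R]_n :=
  gamma0 p.1 ((omega tau p.1)^-1 * p.2).

Record periodic_family (R : realType) (k n : nat) (r : nat)
    (F0 : 'rV[R]_n -> 'rV[R]_n) (U : set 'rV[R]_k)
    (gamma0 : 'rV[R]_k -> R -> 'rV[R]_n) (tau : 'rV[R]_k -> R) : Prop :=
  PeriodicFamily {
  family_solution : forall x t, U x ->
    is_derive t (1 : R) (gamma0 x) (F0 (gamma0 x t)) ;
  family_period : forall x t, U x -> gamma0 x (t + tau x) = gamma0 x t ;
  period_smooth : Cr r U tau ;
  period_bounded : exists tmin tmax : R, 0 < tmin /\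
    forall x, U x -> tmin <= tau x <= tmax }.

(* The variational equation zeta' = DF_0(gamma_0(x,t)) zeta in the row-vector
   convention of jacobian ('D_v f a = v *m 'J f a): the solution with value v
   at t0 is v *m Phi x t t0. *)
Definition transition_matrix (R : realType) (k n : nat)
    (F0 : 'rV[R]_n -> 'rV[R]_n) (U : set 'rV[R]_k)
    (gamma0 : 'rV[R]_k -> R -> 'rV[R]_n)
    (Phi : 'rV[R]_k -> R -> R -> 'M[R]_n) : Prop :=
  forall x, U x -> forall t0,
    Phi x t0 t0 = 1%:M /\
    forall t, is_derive t (1 : R) (fun s => Phi x s t0)
      (Phi x t t0 *m 'J F0 (gamma0 x t)).

Definition tangent_space (R : realType) (k n : nat)
    (G : 'rV[R]_k * R -> 'rV[R]_n) (p : 'rV[R]_k * R) : {vspace 'rV[R]_n} :=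
  limg (linfun ('d G p)).

(* The rates may depend on the orbit but are bounded away from zero.  The last
   clause says that tangential solutions grow or decay subexponentially (t and
   t0 are unordered, so it bounds them from below as well). *)
Definition normally_hyperbolic (R : realType) (k n : nat) (U : set 'rV[R]_k)
    (gamma0 : 'rV[R]_k -> R -> 'rV[R]_n) (tau : 'rV[R]_k -> R)
    (Phi : 'rV[R]_k -> R -> R -> 'M[R]_n) : Prop :=
  let T x t := tangent_space (Gamma0 gamma0 tau) (x, omega tau x * t) in
  exists (Ns Nu : 'rV[R]_n -> {vspace 'rV[R]_n}) (K lam0 : R)
         (lams lamu : 'rV[R]_k -> R),
    [/\ 1 <= K, 0 < lam0,
        forall x, U x -> lam0 <= Num.min (lams x) (lamu x) &
        forall x, U x ->
    [/\ forall t, let z := gamma0 x t in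
          (T x t + Ns z + Nu z = fullv)%VS /\
          directv (T x t + Ns z + Nu z)%VS,
        forall t t0 v,
          [/\ v \in T x t0 -> v *m Phi x t t0 \in T x t,
              v \in Ns (gamma0 x t0) -> v *m Phi x t t0 \in Ns (gamma0 x t) &
              v \in Nu (gamma0 x t0) -> v *m Phi x t t0 \in Nu (gamma0 x t)],
        forall t t0 v, v \in Ns (gamma0 x t0) -> t0 <= t ->
          `|v *m Phi x t t0| <= K * expR (- lams x * (t - t0)) * `|v|,
        forall t t0 v, v \in Nu (gamma0 x t0) -> t <= t0 ->
          `|v *m Phi x t t0| <= K * expR (lamu x * (t - t0)) * `|v| &
        forall d : R, 0 < d -> exists Kd : R, forall t t0 v, v \in T x t0 ->
          `|v *m Phi x t t0| <= Kd * expR (d * `|t - t0|) * `|v|]].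

(* For small eps, M eps is the image of a C^r embedding Ge eps that displaces
   the points of M_0 by O(eps), uniformly.  Ge eps intertwines a vector field
   X eps on U x S^1 with F(., eps), which expresses the (local) invariance of
   M eps, and X eps is O(eps)-close to the unperturbed field (0, omega), with
   constants that are uniform on compact sets of orbits. *)
Definition persistent_manifold (R : realType) (k n : nat) (r : nat)
    (F : 'rV[R]_n -> R -> 'rV[R]_n) (U : set 'rV[R]_k)
    (G0 : 'rV[R]_k * R -> 'rV[R]_n) (tau : 'rV[R]_k -> R)
    (M : R -> set 'rV[R]_n) : Prop :=
  exists (eps0 c : R) (Ge : R -> 'rV[R]_k * R -> 'rV[R]_n)
         (X : R -> 'rV[R]_k * R -> 'rV[R]_k * R),
    [/\ 0 < eps0,
        forall eps, 0 < eps < eps0 ->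
          embedding r U (Ge eps) /\ M eps = Ge eps @` (U `*` setT),
        forall eps p, 0 < eps < eps0 -> U p.1 ->
          `|Ge eps p - G0 p| <= c * eps,
        forall eps p, 0 < eps < eps0 -> U p.1 ->
          F (Ge eps p) eps = 'd (Ge eps) p (X eps p) &
        forall K : set 'rV[R]_k, compact K -> K `<=` U ->
          exists cK epsK : R, 0 < epsK /\
          forall eps p, 0 < eps < epsK -> K p.1 ->
            `|X eps p - (0, omega tau p.1)| <= cK * eps].

Definition section (R : realType) (k n : nat)
    (G0 : 'rV[R]_k * R -> 'rV[R]_n) (A : set 'rV[R]_k) : set 'rV[R]_n :=
  [set G0 (x, 0) | x in A].

Definition orbit_through (R : realType) (k n : nat) (U : set 'rV[R]_k)
    (G0 : 'rV[R]_k * R -> 'rV[R]_n) (y : 'rV[R]_n) : set 'rV[R]_n :=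
  [set w | exists x phi, [/\ U x, y = G0 (x, 0) & w = G0 (x, phi)]].

(* C^1 vector field on the section with an expansion in powers of eps that
   starts at order 1; ('d G0 (x, 0) (v, 0)), v in R^k, is the tangent space of
   the section at G0 (x, 0). *)
Definition averaged_field (R : realType) (k n m : nat) (U : set 'rV[R]_k)
    (G0 : 'rV[R]_k * R -> 'rV[R]_n)
    (Fbar : 'rV[R]_n -> R -> 'rV[R]_n) : Prop :=
  exists (Fbarj : nat -> 'rV[R]_n -> 'rV[R]_n) (c eps0 : R), 0 < eps0 /\
    [/\ forall eps x, 0 < eps < eps0 -> U x ->
          exists v : 'rV[R]_k, Fbar (G0 (x, 0)) eps = 'd G0 (x, 0) (v, 0),
        forall eps, 0 < eps < eps0 -> Cr 1 U (fun x => Fbar (G0 (x, 0)) eps),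
        forall j, (0 < j <= m)%N -> Cr 1 U (fun x => Fbarj j (G0 (x, 0))) &
        forall eps y, 0 < eps < eps0 -> section G0 U y ->
          `|Fbar y eps - \sum_(1 <= j < m.+1) eps ^+ j *: Fbarj j y|
            <= c * eps ^+ m.+1].

(* "O(eps)" is uniform over the pairs (z, y): C1 and eps1 depend only on C, C0
   and adm.  The trajectories live on an arbitrary open time interval J
   containing 0, since they may leave M eps or the section in finite time. *)
Definition tracks (R : realType) (k n : nat)
    (F : 'rV[R]_n -> R -> 'rV[R]_n) (U : set 'rV[R]_k)
    (G0 : 'rV[R]_k * R -> 'rV[R]_n) (M : R -> set 'rV[R]_n)
    (Fbar : 'rV[R]_n -> R -> 'rV[R]_n) (C : R)
    (adm : R -> set R -> (R -> 'rV[R]_n) -> Prop) : Prop :=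
  forall C0 : R, 0 < C0 ->
  exists C1 eps1 : R, 0 < eps1 /\
  forall (eps : R) (J : set R) (z y : R -> 'rV[R]_n),
    0 < eps < eps1 ->
    open J -> is_interval J -> J 0 ->
    integral_curve (F^~ eps) (M eps) J z ->
    integral_curve (Fbar^~ eps) (section G0 U) J y ->
    adm eps J y ->
    `|z 0 - y 0| <= C0 * eps ->
    forall t, J t -> `|t| <= C / eps ->
      dist_set (z t) (orbit_through U G0 (y t)) <= C1 * eps.

(* Main.v *)
(** Floquet theory gives, along the periodic orbits, a matrix-valued function
    pi(x, phi) that kills the hyperbolic directions and the phase direction and
    sends dGamma0 (v, _) to v; it satisfies the adjoint equation
    omega d_phi pi = - DF0 pi and is 2pi-periodic because it comes from a
    functional fixed by the monodromy matrix.  The periodic forcing F1 pi is the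
    sum of its mean f1(x) and of omega d_phi h with h periodic.  For a trajectory
    z = Gamma_eps(x, phi) on M_eps put nu = z - Gamma0(x, phi) = O(eps); then
    u = x + nu pi - eps h satisfies u' = eps f1(x) + O(eps^2): the adjoint
    equation cancels the term that is linear in nu, and h cancels the
    oscillation.  Gronwall's inequality compares u with the solutions of
    xi' = eps f1(xi) on times O(1/eps).  Hence the averaged field may be taken
    with a first-order term only. *)
Require Import Defs.
From HB Require Import structures.
From mathcomp Require Import all_boot all_order all_algebra.
From mathcomp Require Import all_classical all_reals all_analysis.
From mathcomp Require Import ring lra.
Set Implicit Arguments.
Unset Strict Implicit.
Unset Printing Implicit Defensive.
Import Order.TTheory GRing.Theory Num.Theory.
Import numFieldNormedType.Exports.
Local Open Scope classical_set_scope.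
Local Open Scope ring_scope.

(** * Directional derivatives and comparison of curves *)

Section Derivatives.
Variable R : realType.
Implicit Types V W : normedModType R.

(** The available regularity shapes the proof. [Ge eps] is close to [G0], and [X eps] to
    [(0, omega)], only uniformly and to order eps: there is no control of the derivatives of the
    differences and no expansion of [X eps]. Hence x' by itself is known only to be O(eps), which is
    too weak for times of order 1/eps. In u the derivative of x cancels against that of [G0 p]
    contracted with pi, so that the rate is read off from [F] alone. The bundles [Ns] and [Nu] come
    with no regularity in x, whereas f1 has to be C^1; pi is therefore characterised at phase 0 by
    linear equations with C^1 coefficients and then transported by the flow. Finally, curves are
    given in R^n, and their coordinates are chosen pointwise, the phase only modulo 2 pi; the
    immersion property and the continuity of the inverse embedding make these coordinates
    differentiable once a branch is chosen. The phases of z and of the averaged motion are never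
    compared, because the distance to a whole orbit is measured. *)

Lemma is_derive_cvgP V W (f : V -> W) (x v : V) (d : W) :
  is_derive x v f d <->
  h^-1 *: (f (h *: v + x) - f x) @[h --> 0^'] --> d.
Proof.
split=> [[fv <-]|hd]; first exact: fv.
by apply: DeriveDef; [exact: cvgP hd|exact: cvg_lim hd].
Qed.

(** Clearing the division by h makes the estimate meaningful at h = 0 too, so that derivatives can
    be computed by filtering inequalities. *)
Lemma is_derive_epsP V W (f : V -> W) (x v : V) (d : W) :
  is_derive x v f d <->
  forall e, 0 < e -> \forall h \near (0 : R),
    `|f (h *: v + x) - f x - h *: d| <= e * `|h|.
Proof.
split=> [/is_derive_cvgP/cvgrPdist_le fd e e0|H].
- have := fd e e0; rewrite near_withinE; apply: filterS => h hP.
  have [->|h0] := eqVneq h 0.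
    by rewrite !scale0r add0r subrr subr0 !normr0 mulr0.
  rewrite -[X in `|X - _|](scalerKV h0) -scalerBr normrZ mulrC ler_pM2r ?normr_gt0//.
  by rewrite distrC; exact: hP.
- apply/is_derive_cvgP/cvgrPdist_le => e e0; rewrite near_withinE.
  apply: filterS (H e e0) => h hP h0.
  rewrite distrC -[X in `|_ - X|](scalerK h0) -scalerBr normrZ normfV.
  by rewrite ler_pdivrMl ?normr_gt0// mulrC.
Qed.

Lemma is_diff_epsP V W (f : V -> W) (x : V) (L : {linear V -> W}) :
  continuous L ->
  (is_diff x f L <->
  forall e, 0 < e -> \forall h \near (0 : V),
    `|f (h + x) - f x - L h| <= e * `|h|).
Proof.
move=> cL; split=> [fd e e0|H].
- have /diff_locally/eqaddoP/(_ e e0) : differentiable f x by [].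
  by rewrite diff_val; apply: filterS => h /=; rewrite opprD addrA.
- have fL : f \o shift x = cst (f x) + L +o_ 0 id.
    apply/eqaddoP => e e0; apply: filterS (H e e0) => h /=.
    by rewrite opprD addrA.
  have dfE := diff_unique cL fL.
  by apply: DiffDef => //; apply/diff_locallyP; rewrite dfE.
Qed.

Lemma is_derive_diff1 V (p : R -> V) (t : R) (d : V) :
  is_derive t (1 : R) p d -> differentiable p t /\ 'd p t 1 = d.
Proof.
move=> [pd <-]; have /derivable1_diffP pt := pd.
by split=> //; rewrite deriveE.
Qed.

Lemma is_derive_comp V W (p : R -> V) (f : V -> W) (t : R) (d : V) :
  is_derive t (1 : R) p d -> differentiable f (p t) ->
  is_derive t (1 : R) (f \o p) ('d f (p t) d).
Proof.
move=> /is_derive_diff1[pd <-] fd.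
have fpd : differentiable (f \o p) t by exact: differentiable_comp.
apply: DeriveDef; first exact: diff_derivable.
by rewrite deriveE// diff_comp.
Qed.

Lemma is_derive_continuous V (p : R -> V) (t : R) (d : V) :
  is_derive t (1 : R) p d -> {for t, continuous p}.
Proof. by move=> /is_derive_diff1[/differentiable_continuous]. Qed.

Lemma diff_scale1 V (p : R -> V) (t a : R) : 'd p t a = a *: 'd p t 1.
Proof.
set L := 'd p _; have <- : L (a *: (1 : R)) = a *: L 1 by exact: linearZ.
by congr (L _); exact/esym/mulr1.
Qed.

Lemma is_derive_reparam V (p : R -> V) (a b t : R) (d : V) :
  is_derive (a * t + b) (1 : R) p d ->
  is_derive t (1 : R) (fun s => p (a * s + b)) (a *: d).
Proof.
move=> pd.
have ad : is_derive t (1 : R) (fun s : R => a * s + b) a.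
  apply/is_derive_epsP => e e0; near=> h.
  rewrite [X in `|X|](_ : _ = 0) ?normr0 ?mulr_ge0 ?(ltW e0)//.
  by rewrite -[h%:A]/(h * 1) -[h *: a]/(h * a); ring.
have [pdiff <-] := is_derive_diff1 pd.
apply: (is_derive_eq (is_derive_comp (p := fun s => a * s + b) ad pdiff)).
exact: diff_scale1.
Unshelve. all: by end_near. Qed.

Lemma is_derive_line V W (f : V -> W) (v q : V) (t : R) (d : W) :
  is_derive (t *: v + q) v f d -> is_derive t (1 : R) (fun s => f (s *: v + q)) d.
Proof.
move=> /is_derive_epsP fd; apply/is_derive_epsP => e e0; apply: filterS (fd e e0) => h.
by rewrite -[h *: 1]/(h * 1) mulr1 scalerDl addrA.
Qed.

Lemma is_derive_scale V W (f : V -> R) (g : V -> W) (x v : V) (df : R) (dg : W) :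
  is_derive x v f df -> is_derive x v g dg ->
  is_derive x v (fun y => f y *: g y) (df *: g x + f x *: dg).
Proof.
move=> fd gd; apply/is_derive_cvgP.
have gx : g (h *: v + x) @[h --> 0^'] --> g x.
  have /derivable1P/derivable1_diffP/differentiable_continuous : derivable g x v by [].
  move=> gc; have {}gc : g (h *: v + x) @[h --> 0] --> g (0 *: v + x) by exact: gc.
  rewrite scale0r add0r in gc; apply: cvg_trans gc.
  exact/cvg_app/cvg_within.
rewrite (_ : (fun h => _) = (fun h => (h^-1 *: (f (h *: v + x) - f x)) *: g (h *: v + x)
    + f x *: (h^-1 *: (g (h *: v + x) - g x)))).
  apply: cvgD; first by apply: cvgZ => //; exact/is_derive_cvgP.
  by apply: cvgZl_tmp; exact/is_derive_cvgP.
apply/funext => h; rewrite -[h^-1 *: (f _ - f x)]/(h^-1 * (f (h *: v + x) - f x)).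
by rewrite !scalerBr !scalerA mulrBr scalerBl [f x * h^-1]mulrC addrA subrK.
Qed.

Lemma near0_shift V (P : set V) (q : V) :
  nbhs q P -> \forall h \near (0 : V), P (h + q).
Proof.
move=> /nbhs_ballP[r/= r0 rP]; apply/nbhs_ballP; exists r => // h.
rewrite -ball_normE/= sub0r normrN => hr; apply: rP.
by rewrite -ball_normE/= opprD addrCA subrr addr0 normrN.
Qed.

(** The hitting time is the supremum of the times up to which f stays negative; continuity excludes
    both signs of f there. *)
Lemma first_hit (f : R -> R) (T : R) :
  0 <= T -> (forall t, 0 <= t <= T -> {for t, continuous f}) ->
  f 0 < 0 -> 0 <= f T ->
  exists t, [/\ 0 < t <= T, f t = 0 & forall s, 0 <= s < t -> f s < 0].
Proof.
move=> T0 cf f0 fT.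
pose S := [set s | 0 <= s <= T /\ forall u, 0 <= u <= s -> f u < 0].
have S0 : S 0.
  split; first by rewrite lexx.
  by move=> u /andP[u0 u0']; have -> : u = 0 by apply/eqP; rewrite eq_le u0 u0'.
have supS : has_sup S.
  by split; [exists 0|exists T => s [/andP[]]].
set t := sup S.
have t0 : 0 <= t by exact: ub_le_sup (proj2 supS) _ S0.
have tT : t <= T by apply: ge_sup; [exists 0|move=> s [/andP[]]].
have ltt s : 0 <= s < t -> f s < 0.
  move=> /andP[s0 st].
  have [s' [_ Ss'] ss'] := sup_adherent (eps := t - s) (ltac:(by rewrite subr_gt0)) supS.
  by apply: Ss'; rewrite s0/= ltW//; move: ss'; rewrite -/t subKr.
have ft : f t = 0.
  apply/eqP; rewrite eq_le !leNgt; apply/andP; split; apply/negP => ft.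
  - have t1 : 0 < t.
      rewrite lt0r t0 andbT; apply/eqP => t00.
      by move: ft; rewrite t00 ltNge ltW.
    have /cvgrPdist_lt/(_ _ ft) : f x @[x --> t] --> f t by apply: cf; rewrite t0.
    move=> /nbhs_ballP[e/= e0 eP].
    pose s := Num.max 0 (t - e / 2).
    have st : s < t by rewrite gt_max t1/=; lra.
    have s0 : 0 <= s by rewrite le_max lexx.
    have := eP s; rewrite /ball/= => /(_ _)/wrap[].
      rewrite ger0_norm; last by rewrite subr_ge0 ltW.
      have : t - e / 2 <= s by rewrite le_max lexx orbT.
      by lra.
    have := ltt s; rewrite s0 st => /(_ isT) fs.
    by rewrite ltr_norml => /andP[_]; lra.
  - have /cvgrPdist_lt/(_ (- f t)) : f x @[x --> t] --> f t by apply: cf; rewrite t0.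
    rewrite oppr_gt0 => /(_ ft) /nbhs_ballP[e/= e0 eP].
    have near_neg u : `|t - u| < e -> f u < 0.
      move=> /eP/=; rewrite ltr_norml => /andP[]; lra.
    have tltT : t < T.
      by rewrite lt_neqAle tT andbT; apply/eqP => tE; move: fT; rewrite -tE leNgt ft.
    pose s := Num.min T (t + e / 2).
    have ts : t < s by rewrite lt_min tltT/=; lra.
    have Ss : S s.
      split; first by rewrite (le_trans t0 (ltW ts))/= ge_min lexx.
      move=> u /andP[u0 us]; have [ut|tu] := ltP u t; first by apply: ltt; rewrite u0.
      apply: near_neg; rewrite distrC ger0_norm ?subr_ge0//.
      have : s <= t + e / 2 by rewrite ge_min lexx orbT.
      lra.
    have := ub_le_sup (proj2 supS) Ss.
    by rewrite -/t leNgt ts.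
exists t; split=> //.
rewrite tT andbT lt0r t0 andbT; apply/eqP => t00.
by have := f0; rewrite -[X in f X]t00 ft ltxx.
Qed.

(* The derivative hypothesis is needed only at the times where the barrier is
   touched, and there only if it was respected before: this is what makes
   continuation arguments go through without a separate bootstrap. *)
Lemma barrier V (D dD : R -> V) (b db : R -> R) (T : R) :
  (forall t, 0 <= t <= T -> is_derive t (1 : R) D (dD t)) ->
  (forall t, 0 <= t <= T -> is_derive t (1 : R) b (db t)) ->
  `|D 0| < b 0 ->
  (forall t, 0 < t <= T -> (forall s, 0 <= s <= t -> `|D s| <= b s) ->
    `|D t| = b t -> `|dD t| < db t) ->
  forall t, 0 <= t <= T -> `|D t| < b t.
Proof.
move=> dDP dbP D0 touch t /andP[t0 tT]; rewrite ltNge; apply/negP => bD.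
have cf s : 0 <= s <= t -> {for s, continuous (fun u => `|D u| - b u)}.
  move=> /andP[s0 st]; have sT : 0 <= s <= T by rewrite s0 (le_trans st).
  apply: continuousB; last exact: is_derive_continuous (dbP s sT).
  apply: continuous_comp (is_derive_continuous (dDP s sT)) _.
  exact: norm_continuous.
have [|s [/andP[s0 st] fs before]] := first_hit t0 cf _ (ltac:(by rewrite subr_ge0)).
  by rewrite subr_lt0.
have sT : 0 < s <= T by rewrite s0 (le_trans st).
have sT' : 0 <= s <= T by case/andP: sT => /ltW -> ->.
have Ds : `|D s| = b s by apply/eqP; rewrite -subr_eq0 fs.
have lt_db : `|dD s| < db s.
  apply: touch => // u /andP[u0]; rewrite le_eqVlt => /predU1P[->|us].
    by rewrite Ds.
  by rewrite -subr_le0 ltW// before// u0.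
(* Stepping back by h from the touching time s, the norm of D drops by at most [h * (|dD s| + e)]
   while b drops by at least [h * (db s - e)]. As [2 * e] is half the gap between the two slopes, D
   would already exceed the barrier at time [s - h]. *)
pose e := (db s - `|dD s|) / 4.
have e0 : 0 < e by rewrite divr_gt0// subr_gt0.
have De := (is_derive_epsP _ _ _ _).1 (dDP s sT') e e0.
have be := (is_derive_epsP _ _ _ _).1 (dbP s sT') e e0.
have /nbhs_ballP[r/= r0 rP] : \forall h \near (0 : R),
    `|D (h *: 1 + s) - D s - h *: dD s| <= e * `|h| /\
    `|b (h *: 1 + s) - b s - h *: db s| <= e * `|h| by exact: filterI De be.
pose h := Num.min s r / 2.
have m0 : 0 < Num.min s r by rewrite lt_min s0.
have h0 : 0 < h by rewrite divr_gt0.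
have hs : h < s.
  have : Num.min s r <= s by rewrite ge_min lexx.
  by rewrite /h; lra.
have hr : h < r.
  have : Num.min s r <= r by rewrite ge_min lexx orbT.
  by rewrite /h; lra.
have /rP/= [] : ball 0 r (- h) by rewrite /ball/= sub0r opprK gtr0_norm.
rewrite [(- h)%:A]mulr1 normrN gtr0_norm// => D1 b1.
have := before (- h + s) _; rewrite subr_lt0 => /(_ ltac:(lra)) D2.
have {}b1 : b (- h + s) <= b s - h * db s + e * h.
  move: b1; rewrite ler_norml => /andP[_].
  by rewrite -[(- h) *: _]/(- h * _); lra.
have {}D1 : `|D s| <= `|D (- h + s)| + h * `|dD s| + e * h.
  set X := D (- h + s) - D s - _ in D1.
  have zE (a c d : V) : a = c + (d - (c - a + d)).
    by rewrite [c - a + d]addrC opprD [d + _]addrA subrr add0r opprB addrC subrK.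
  have -> : D s = D (- h + s) + (h *: dD s - X).
    by rewrite /X scaleNr opprK; exact: zE.
  rewrite -addrA; apply: le_trans (ler_normD _ _) _; rewrite lerD2l.
  apply: le_trans (ler_normB _ _) _.
  by rewrite normrZ (gtr0_norm h0) lerD2l.
have : 0 < h * (`|dD s| - db s + 2 * e) by lra.
by rewrite pmulr_rgt0// /e; lra.
Qed.

(** The barrier is [(a + a + c) * expR ((L + mu) * t)]; it stays above c, so
    [L * b + mu * c < (L + mu) * b] on contact. The inhomogeneity is written [mu * c] so that L and
    mu can both be proportional to eps: the exponent then stays bounded on times of order 1/eps. *)
Lemma gronwall V (D dD : R -> V) (L mu c a T : R) :
  (forall t, 0 <= t <= T -> is_derive t (1 : R) D (dD t)) ->
  0 <= L -> 0 < mu -> 0 <= c -> 0 < a -> `|D 0| <= a ->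
  (forall t, 0 <= t <= T -> `|dD t| <= L * `|D t| + mu * c) ->
  forall t, 0 <= t <= T -> `|D t| <= (a + a + c) * expR ((L + mu) * t).
Proof.
move=> dDP L0 mu0 c0 a0 D0 dDle t tT; apply/ltW; move: t tT.
pose b t := (a + a + c) * expR ((L + mu) * t).
pose db t := (a + a + c) * (expR ((L + mu) * t) * (L + mu)).
have Lmu : 0 < L + mu by rewrite ltr_wpDl.
apply: (@barrier _ D dD b db T dDP).
- move=> t _; have lin : is_derive t (1 : R) (fun s : R => (L + mu) * s + 0) (L + mu).
    have := @is_derive_reparam R^o id (L + mu) 0 t 1 (is_derive_id _ _).
    by rewrite -[(L + mu) *: _]/((L + mu) * 1) mulr1.
  have /is_derive_diff1[ed e1] := is_derive_expR ((L + mu) * t + 0).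
  have := is_derive_comp (p := fun s => (L + mu) * s + 0) lin ed.
  have -> : 'd expR ((L + mu) * t + 0) (L + mu) = expR ((L + mu) * t) * (L + mu).
    by rewrite diff_scale1 e1 addr0; exact: mulrC.
  rewrite (_ : expR \o _ = fun s => expR ((L + mu) * s)); last first.
    by apply/funext => s /=; rewrite addr0.
  exact: is_deriveZ.
- by rewrite /b/= mulr0 expR0 mulr1 -addrA; apply: (le_lt_trans D0); rewrite ltrDl; lra.
- move=> t /andP[t0 tT] _ Dt.
  have bge : a + a + c <= b t.
    by rewrite ler_peMr ?addr_ge0 ?(ltW a0)// -expR0 ler_expR mulr_ge0// ltW.
  apply: (le_lt_trans (dDle t _)); first by rewrite (ltW t0).
  have -> : db t = (L + mu) * b t by rewrite /db /b; ring.
  by rewrite Dt mulrDl ltrD2l ltr_pM2l//; lra.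
Qed.

Lemma gronwall_sym V (D dD : R -> V) (L mu c a T : R) :
  (forall t, `|t| <= T -> is_derive t (1 : R) D (dD t)) ->
  0 <= L -> 0 < mu -> 0 <= c -> 0 < a -> `|D 0| <= a ->
  (forall t, `|t| <= T -> `|dD t| <= L * `|D t| + mu * c) ->
  forall t, `|t| <= T -> `|D t| <= (a + a + c) * expR ((L + mu) * `|t|).
Proof.
move=> dDP L0 mu0 c0 a0 D0 dDle t tT.
have normT s : 0 <= s <= T -> `|s| <= T by move=> /andP[s0 sT]; rewrite ger0_norm.
have [t0|/ltW t0] := leP 0 t.
  rewrite ger0_norm//; move: tT; rewrite ger0_norm// => tT.
  apply: (@gronwall V D dD L mu c a T) => //; last by rewrite t0.
  - by move=> s /normT; exact: dDP.
  - by move=> s /normT; exact: dDle.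
rewrite ler0_norm//; move: tT; rewrite ler0_norm// => tT.
have := @gronwall V (fun s => D (- 1 * s + 0)) (fun s => - 1 *: dD (- 1 * s + 0)) L mu c a T.
have E : - 1 * - t + 0 = t by rewrite mulN1r opprK addr0.
move=> /(_ _ L0 mu0 c0 a0 _ _ (- t)); rewrite E; apply.
- move=> s sT; apply: is_derive_reparam; apply: dDP.
  by rewrite addr0 mulN1r normrN normT.
- by rewrite mulr0 addr0.
- move=> s sT; rewrite normrZ normrN1 mul1r; apply: dDle.
  by rewrite addr0 mulN1r normrN normT.
- by rewrite oppr_ge0 t0.
Qed.

(** For vector values there is no intermediate point; the increment is compared with a barrier of
    slope [M + d], whose total excess [d * T + d] is the arbitrary e. *)
Lemma mean_value_fwd V (D dD : R -> V) (M T : R) :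
  (forall t, 0 <= t <= T -> is_derive t (1 : R) D (dD t)) ->
  (forall t, 0 <= t <= T -> `|dD t| <= M) -> 0 <= T ->
  `|D T - D 0| <= M * T.
Proof.
move=> dDP dDle T0; apply/ler_addgt0Pr => e e0.
pose d := e / (T + 1).
have d0 : 0 < d by rewrite divr_gt0// ltr_wpDl.
have bP t : 0 <= t <= T -> is_derive t (1 : R) (fun s : R => (M + d) * s + d) (M + d).
  move=> _; have := @is_derive_reparam R^o id (M + d) d t 1 (is_derive_id _ _).
  by rewrite -[(M + d) *: _]/((M + d) * 1) mulr1.
have DP t : 0 <= t <= T -> is_derive t (1 : R) (fun s => D s - D 0) (dD t).
  move=> /dDP Dt; apply: is_derive_eq; exact: subr0.
have := barrier DP bP; rewrite subrr normr0 mulr0 add0r => /(_ d0).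
have touch t : 0 < t <= T ->
    (forall s, 0 <= s <= t -> `|D s - D 0| <= (M + d) * s + d) ->
    `|D t - D 0| = (M + d) * t + d -> `|dD t| < M + d.
  move=> /andP[t0 tT] _ _; apply: (le_lt_trans (dDle t _)); last by rewrite ltrDl.
  by rewrite (ltW t0).
move=> /(_ touch T); rewrite lexx T0 => /(_ isT)/ltW/le_trans; apply.
rewrite mulrDl -addrA lerD2l -[X in _ + X]mulr1 -mulrDr /d divfK//.
by rewrite gt_eqF// ltr_wpDl.
Qed.

Lemma mean_value V (D dD : R -> V) (J : set R) (M : R) : is_interval J ->
  (forall t, J t -> is_derive t (1 : R) D (dD t)) ->
  (forall t, J t -> `|dD t| <= M) ->
  forall a b, J a -> J b -> `|D b - D a| <= M * `|b - a|.
Proof.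
move=> iJ dDP dDle a b.
wlog ab : a b / a <= b => [H Ja Jb|Ja Jb].
  have [ab|/ltW ba] := leP a b; first exact: H.
  by rewrite distrC [X in _ * X]distrC; exact: H.
have ba0 : 0 <= b - a by rewrite subr_ge0.
rewrite ger0_norm//.
have Jt t : 0 <= t <= b - a -> J (1 * t + a).
  by move=> /andP[t0 tb]; apply: (iJ a b) => //; apply/andP; split; lra.
have := @mean_value_fwd _ (fun t => D (1 * t + a)) (fun t => 1 *: dD (1 * t + a)) M (b - a).
rewrite mulr0 add0r mul1r subrK; apply=> //.
- by move=> t /Jt /dDP; exact: is_derive_reparam.
- by move=> t /Jt /dDle; rewrite scale1r.
Qed.

Lemma constant_of_derive0 V (D : R -> V) :
  (forall t, is_derive t (1 : R) D 0) -> forall t, D t = D 0.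
Proof.
move=> D0 t; apply/eqP; rewrite -subr_eq0 -normr_le0.
have := @mean_value _ D (cst 0) setT 0 _ _ _ 0 t; rewrite mul0r; apply=> //.
by move=> *; rewrite normr0.
Qed.

(** An integral from [- N] has derivative f only to the right of [- N]. Normalised to vanish at 0,
    two such integrals agree where both are differentiable, so they glue to an antiderivative on the
    whole line. *)
Lemma antiderivative_exists (f : R -> R) : continuous f ->
  exists F : R -> R, F 0 = 0 /\ forall t, is_derive t (1 : R) F (f t).
Proof.
move=> cf.
pose I (N : nat) (t : R) : R := (\int[lebesgue_measure]_(x in `[- N%:R, t]) f x)%R.
have IP N (t : R) : - N%:R < t -> is_derive t (1 : R) (I N) (f t).
  move=> Nt.
  have := @continuous_FTC1_closed R f (- N%:R) t (t + 1).
  rewrite ltrDl ltr01 => /(_ isT) H.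
  have [] := H _ Nt (cf t).
    apply: continuous_compact_integrable; first exact: segment_compact.
    exact: continuous_subspaceT.
  by rewrite derive1E /I => dI <-; exact: derivableP.
(* The extra unit lets the lower limit chosen for t serve every s at distance less than 1 from t. *)
pose N (t : R) := (Num.truncn `|t|).+2.
have NP (t : R) : - (N t)%:R < t - 1.
  have := truncnS_gt `|t|; have := ler_norm (- t); rewrite normrN /N.
  by rewrite -[(_.+2)%:R]natr1; lra.
have agree (M M' : nat) (t : R) : (0 < M)%N -> (0 < M')%N -> - M%:R < t ->
    - M'%:R < t -> I M t - I M 0 = I M' t - I M' 0.
  move=> M0 M'0 Mt M't; apply/eqP; rewrite -subr_eq0 -normr_le0.
  pose J := [set s : R | - M%:R < s /\ - M'%:R < s].
  have iJ : is_interval J.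
    move=> a b [a1 a2] [b1 b2] c /andP[ac cb].
    by split; [exact: lt_le_trans a1 ac|exact: lt_le_trans a2 ac].
  have dJ s : J s -> is_derive s (1 : R) (fun u => I M u - I M' u) 0.
    move=> [s1 s2]; have d1 := IP _ _ s1; have d2 := IP _ _ s2.
    by apply: is_derive_eq; rewrite subrr.
  have J0 : J 0 by split; rewrite oppr_lt0 ltr0n.
  have Jt : J t by [].
  have := mean_value iJ dJ (M := 0) _ J0 Jt; rewrite mul0r => /(_ _)/wrap[].
    by move=> *; rewrite normr0.
  by rewrite (_ : I M t - I M 0 - (I M' t - I M' 0) = I M t - I M' t - (I M 0 - I M' 0))//; ring.
exists (fun t => I (N t) t - I (N t) 0); split; first by rewrite subrr.
move=> t.
have dN : is_derive t (1 : R) (fun s => I (N t) s - I (N t) 0) (f t).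
  have tt : (t : R) - 1 < t by lra.
  have d1 := IP (N t) t (lt_trans (NP t) tt).
  by apply: is_derive_eq; rewrite subr0.
apply: near_eq_is_derive dN.
apply/nbhs_ballP; exists 1; first exact: ltr01.
move=> s ts; have {}ts : `|t - s| < 1 by exact: ts.
apply: agree => //; last by have := NP s; lra.
by have := NP t; move: ts; rewrite ltr_norml => /andP[]; lra.
Qed.

End Derivatives.

(** * Functions of class C^1 *)

(* A common interface for R^k and R^k * R: a basis with its coordinate
   functionals, both bounded by 1. *)
Record frame (R : realType) (V : normedModType R) (I : finType)
    (e : I -> V) (c : I -> V -> R) : Prop := Frame {
  frame_sum : forall v, v = \sum_i c i v *: e i ;
  frame_linear : forall i a u v, c i (a *: u + v) = a * c i u + c i v ;
  frame_coord : forall i v, `|c i v| <= `|v| ;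
  frame_vector : forall i, `|e i| <= 1 }.

Section Frames.
Variable R : realType.
Implicit Types V W : normedModType R.

Lemma mx_entry_le_norm m n (M : 'M[R]_(m, n)) i j : `|M i j| <= `|M|.
Proof.
by rewrite [leRHS]/Num.Def.normr/= mx_normrE; exact: (le_bigmax _ _ (i, j)).
Qed.

Lemma mx_norm_le m n (M : 'M[R]_(m, n)) (a : R) :
  0 <= a -> (forall i j, `|M i j| <= a) -> `|M| <= a.
Proof.
move=> a0 Ma; rewrite [leLHS]/Num.Def.normr/= mx_normrE.
by apply: bigmax_le => // -[i j] _; exact: Ma.
Qed.

Lemma mx_norm_mul m n p (M : 'M[R]_(m, n)) (N : 'M[R]_(n, p)) :
  `|M *m N| <= n%:R * (`|M| * `|N|).
Proof.
apply: mx_norm_le => [|i j]; first by rewrite mulr_ge0// mulr_ge0.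
rewrite mxE; apply: le_trans (ler_norm_sum _ _ _) _.
rewrite -[n in n%:R]card_ord mulr_natl -sumr_const.
by apply: ler_sum => l _; rewrite normrM ler_pM// mx_entry_le_norm.
Qed.

Lemma frame_rV n : frame (fun i : 'I_n => delta_mx 0 i : 'rV[R]_n) (fun i v => v 0 i).
Proof.
split=> [v|i a u v|i v|i].
- exact: row_sum_delta.
- by rewrite !mxE.
- exact: mx_entry_le_norm.
- apply: mx_norm_le => // j j'; rewrite mxE.
  by case: (_ && _); rewrite ?normr1 ?normr0.
Qed.

Lemma frame_prod k : frame
  (fun i : 'I_k + 'I_1 => if i is inl j then (delta_mx 0 j, 0) else (0, 1)
     : 'rV[R]_k * R)
  (fun i v => if i is inl j then v.1 0 j else v.2).
Proof.
have pnorm (v : 'rV[R]_k * R) : `|v| = Num.max `|v.1| `|v.2| by [].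
split=> [v|[j|j] a u v|[j|j] v|[j|j]].
- rewrite big_sumType/= big_ord1.
  have -> : \sum_i v.1 0 i *: (delta_mx 0 i : 'rV[R]_k, 0 : R) = (v.1, 0).
    rewrite [X in (X, _)](row_sum_delta v.1).
    apply: (big_ind2 (fun (x : 'rV[R]_k * R) y => x = (y, 0))) => //.
      by move=> _ u1 _ u2 -> ->; congr (_, _); rewrite addr0.
    by move=> i _; congr (_, _); rewrite scaler0.
  case: v => v1 v2 /=; congr (_, _); first by rewrite [X in _ + X]scaler0 addr0.
  by rewrite add0r [RHS]mulr1.
- by rewrite /= !mxE.
- by [].
- by rewrite pnorm le_max mx_entry_le_norm.
- by rewrite pnorm le_max lexx orbT.
- rewrite pnorm/= normr0 ge_max ler01 andbT.
  exact: (frame_vector (frame_rV k)).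
- by rewrite pnorm/= normr0 normr1 ge_max ler01 lexx.
Qed.

Section FrameTheory.
Variables (V : normedModType R) (I : finType) (e : I -> V) (c : I -> V -> R).
Hypothesis fr : frame e c.

Lemma frame_bound W (L : {linear V -> W}) v :
  `|L v| <= (\sum_i `|L (e i)|) * `|v|.
Proof.
rewrite {1}(frame_sum fr v) linear_sum mulr_suml.
apply: le_trans (ler_norm_sum _ _ _) _; apply: ler_sum => i _.
by rewrite linearZ normrZ mulrC ler_wpM2l// (frame_coord fr).
Qed.

Lemma frame_linear_continuous W (L : {linear V -> W}) : continuous L.
Proof.
set M := \sum_i `|L (e i)|.
have M0 : 0 <= M by rewrite sumr_ge0.
have M1 : 0 < M + 1 by rewrite ltr_wpDl.
move=> p; apply/cvgrPdist_le => d d0.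
apply/nbhs_ballP; exists (d / (M + 1)); first exact: divr_gt0.
move=> q; rewrite -ball_normE/= => pq.
rewrite -linearB; apply: le_trans (frame_bound _ _) _; rewrite -/M.
move: pq; rewrite ltr_pdivlMr// => /ltW; apply: le_trans.
by rewrite mulrC ler_wpM2l// lerDl.
Qed.

Lemma frame_coord_continuous i : continuous (c i).
Proof.
move=> p; apply/cvgrPdist_le => d d0.
apply/nbhs_ballP; exists d => // q; rewrite -ball_normE/= => pq.
have -> : c i p - c i q = c i (p - q).
  have := frame_linear fr i (- 1) q p.
  by rewrite scaleN1r mulN1r [- q + p]addrC [- c i q + _]addrC.
by apply: le_trans (ltW pq); exact: frame_coord fr _ _.
Qed.

Lemma diffE_frame W (f : V -> W) p v :
  'd f p v = \sum_i c i v *: 'd f p (e i).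
Proof.
by rewrite {1}(frame_sum fr v) linear_sum; apply: eq_bigr => i _; rewrite linearZ.
Qed.

Lemma frame_map_linear W (g : I -> W) :
  linear (fun v => \sum_i c i v *: g i).
Proof.
move=> a u v; rewrite scaler_sumr -big_split; apply: eq_bigr => i _ /=.
by rewrite (frame_linear fr) scalerDl scalerA.
Qed.

(** The increment is travelled one coordinate at a time; on each leg the mean value inequality
    applies, because the partial derivative there differs from its value at p by at most d.
    Telescoping costs a factor [#|I|], anticipated in the choice of d. *)
Lemma diff_of_partials W (f : V -> W) (g : I -> V -> W) p :
  (\forall q \near p, forall i, is_derive q (e i) f (g i q)) ->
  (forall i, {for p, continuous (g i)}) ->
  differentiable f p /\ forall v, 'd f p v = \sum_i c i v *: g i p.
Proof.
move=> dfg cg.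
pose L0 v := \sum_i c i v *: g i p.
pose L : {linear V -> W} := HB.pack L0 (GRing.isLinear.Build R V W _ L0 (frame_map_linear _)).
suff : is_diff p f L by move=> dL; split=> // v; rewrite diff_val.
apply/is_diff_epsP; first exact: frame_linear_continuous.
move=> eta eta0.
pose d := eta / (#|I|%:R + 1).
have d0 : 0 < d by rewrite divr_gt0// ltr_wpDl.
have : \forall q \near p, forall i, `|g i p - g i q| <= d.
  apply: filter_forall => i.
  by have /cvgrPdist_le/(_ _ d0) := cg i.
move=> /(filterI dfg)/nbhs_ballP[r/= r0 rP].
(* The corner of the broken line reached once the coordinates listed in s have been added. *)
pose S (v : V) (s : seq I) := \sum_(i <- s) c i v *: e i.
have Sle v s : `|S v s| <= (size s)%:R * `|v|.
  elim: s => [|i s IH]; first by rewrite /S big_nil normr0 mul0r.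
  rewrite /S big_cons -natr1 mulrDl mul1r addrC.
  apply: le_trans (ler_normD _ _) _; apply: lerD => //.
  rewrite normrZ -[leRHS]mulr1 ler_pM ?(frame_coord fr)// ?(frame_vector fr)//.
have telescope v s : (size s)%:R * `|v| < r ->
    `|f (S v s + p) - f p - \sum_(i <- s) c i v *: g i p| <= (size s)%:R * (d * `|v|).
  elim: s => [_|i s IH sr]; first by rewrite /S !big_nil add0r subrr subr0 normr0 mul0r.
  have sr' : (size s)%:R * `|v| < r.
    by apply: le_lt_trans sr; rewrite ler_wpM2r// ler_nat/=.
  have {IH} := IH sr'; rewrite /S !big_cons /= -[(size s).+1%:R]natr1 (mulrDl _ 1) mul1r -/(S v s) => IH.
  pose q0 := S v s + p.
  pose D (t : R) := f (t *: e i + q0) - t *: g i p.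
  pose J := [set t : R | `|t| <= `|c i v|].
  have iJ : is_interval J.
    move=> a b; rewrite /J/= !ler_norml => /andP[a1 a2] /andP[b1 b2] t /andP[at_ tb].
    by rewrite /J/= ler_norml (le_trans a1)// (le_trans tb).
  have inr t : J t -> ball p r (t *: e i + q0).
    move=> Jt; rewrite -ball_normE/= distrC addrA addrK; apply: le_lt_trans sr.
    rewrite /= -natr1 mulrDl mul1r addrC; apply: le_trans (ler_normD _ _) _.
    apply: lerD => //; rewrite normrZ -[leRHS]mulr1.
    by rewrite ler_pM ?(frame_vector fr)// (le_trans Jt)// (frame_coord fr).
  have dD t : J t -> is_derive t (1 : R) D (g i (t *: e i + q0) - g i p).
    move=> /inr/rP[df _]; have d1 := is_derive_line (df i).
    apply: is_deriveB; apply/is_derive_epsP => eps eps0; near=> h.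
    rewrite -[h *: 1]/(h * 1) mulr1 scalerDl addrK subrr normr0.
    by rewrite mulr_ge0// ltW.
  have dDle t : J t -> `|g i (t *: e i + q0) - g i p| <= d.
    by move=> /inr/rP[_ gd]; rewrite distrC.
  have J0 : J 0 by rewrite /J/= normr0.
  have Jc : J (c i v) by rewrite /J/=.
  have := mean_value iJ dD dDle J0 Jc; rewrite /D !scale0r add0r !subr0 => step.
  have -> : f (c i v *: e i + S v s + p) - f p -
      (c i v *: g i p + \sum_(j <- s) c j v *: g j p) =
      (f (c i v *: e i + q0) - c i v *: g i p - f q0) +
      (f q0 - f p - \sum_(j <- s) c j v *: g j p).
    rewrite /q0 addrA opprD !addrA; congr (_ - _).
    by rewrite subrK [RHS]addrAC.
  rewrite addrC; apply: le_trans (ler_normD _ _) _; apply: lerD => //.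
  by apply: (le_trans step); rewrite ler_wpM2l// ?(ltW d0)// (frame_coord fr).
have : \forall h \near (0 : V), #|I|%:R * `|h| < r.
  apply/nbhs_ballP; exists (r / (#|I|%:R + 1)).
    by rewrite /= divr_gt0// ltr_wpDl.
  move=> h; rewrite -ball_normE/= sub0r normrN ltr_pdivlMr ?ltr_wpDl//.
  by rewrite mulrC; apply: le_lt_trans; rewrite ler_wpM2r// lerDl.
apply: filterS => h hr.
have sizeI : size (index_enum I) = #|I|.
  by rewrite -sum1_size -sum1_card; apply: eq_bigl.
have := telescope h (index_enum I).
rewrite /S -(frame_sum fr h) /L/= /L0 sizeI => /(_ hr)/le_trans.
apply; rewrite mulrA ler_wpM2r// /d mulrA ler_pdivrMr ?ltr_wpDl//.
by rewrite mulrC ler_wpM2l ?(ltW eta0)// lerDl.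
Unshelve. all: by end_near. Qed.

Lemma Cr1_continuous W (A : set V) (f : V -> W) : Cr 1 A f -> Cr 0 A f.
Proof. by move=> [df _] p /df /differentiable_continuous. Qed.

Lemma Cr2_Cr1 W (A : set V) (f : V -> W) : Cr 2 A f -> Cr 1 A f.
Proof. by move=> [df ddf]; split=> // v; exact: Cr1_continuous (ddf v). Qed.

Lemma diff_is_derive W (f : V -> W) p v :
  differentiable f p -> is_derive p v f ('d f p v).
Proof.
by move=> fp; apply: DeriveDef; [exact: diff_derivable|exact: deriveE].
Qed.

Lemma Cr0_eq W (A : set V) (f g : V -> W) : open A ->
  (forall q, A q -> f q = g q) -> Cr 0 A f -> Cr 0 A g.
Proof.
move=> oA fg cf p Ap; rewrite (_ : {for p, continuous g} = (g x @[x --> p] --> f p)); last by rewrite fg.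
apply: cvg_trans (cf p Ap); apply: near_eq_cvg.
by apply: filterS (open_nbhs_nbhs (conj oA Ap)) => q Aq; exact: fg.
Qed.

Lemma Cr1_intro W (A : set V) (f : V -> W) (G : V -> V -> W) : open A ->
  (forall q, A q -> differentiable f q) ->
  (forall v q, A q -> 'd f q v = G v q) -> (forall v, Cr 0 A (G v)) ->
  Cr 1 A f.
Proof.
move=> oA df dG cG; split=> // v; apply: Cr0_eq oA _ (cG v) => q Aq.
by rewrite deriveE ?dG//; exact: df.
Qed.

Lemma Cr1_eq W (A : set V) (f g : V -> W) : open A ->
  (forall q, A q -> f q = g q) -> Cr 1 A f -> Cr 1 A g.
Proof.
move=> oA fg [df cdf].
have dg q : A q -> is_diff q g ('d f q).
  move=> Aq; have dfq : is_diff q f ('d f q) by apply: DiffDef => //; exact: df.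
  apply/is_diff_epsP; first exact: diff_continuous (df q Aq).
  move=> eps eps0; have nA := open_nbhs_nbhs (conj oA Aq).
  have : \forall h \near (0 : V), A (h + q) by exact: near0_shift.
  have := (is_diff_epsP _ _ (diff_continuous (df q Aq))).1 dfq eps eps0.
  by apply: filterS2 => h hf Ah; rewrite -!fg.
apply: (Cr1_intro (G := fun v q => 'D_v f q)) => //.
- by move=> q /dg[].
- move=> v q Aq; have [_ ->] := dg q Aq; have dfq := df q Aq.
  by rewrite deriveE.
Qed.

Lemma Cr0_sum W (J : Type) (r : seq J) (A : set V) (g : J -> V -> W) :
  (forall j, Cr 0 A (g j)) -> Cr 0 A (fun q => \sum_(j <- r) g j q).
Proof.
move=> cg q Aq; elim: r => [|j r IH].
  rewrite (_ : (fun q => _) = cst 0); first exact: cst_continuous.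
  by apply/funext => p; rewrite big_nil.
rewrite (_ : (fun q => _) = g j + (fun q => \sum_(i <- r) g i q)).
  by apply: continuousD => //; exact: cg.
by apply/funext => p; rewrite big_cons.
Qed.

Lemma Cr1_partials W (A : set V) (f : V -> W) (g : I -> V -> W) : open A ->
  (forall i q, A q -> is_derive q (e i) f (g i q)) ->
  (forall i, Cr 0 A (g i)) -> Cr 1 A f.
Proof.
move=> oA df cg.
have H q : A q -> differentiable f q /\ forall v, 'd f q v = \sum_i c i v *: g i q.
  move=> Aq; apply: diff_of_partials => [|i]; last exact: cg.
  by apply: filterS (open_nbhs_nbhs (conj oA Aq)) => p Ap i; exact: df.
apply: (Cr1_intro (G := fun v q => \sum_i c i v *: g i q)) => //.
- by move=> q /H[].
- by move=> v q /H[].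
move=> v; apply: Cr0_sum => i q Aq.
by apply: continuousZ; [exact: cst_continuous|exact: cg].
Qed.

Lemma Cr1_cst W (A : set V) (a : W) : open A -> Cr 1 A (cst a : V -> W).
Proof.
move=> oA; apply: (Cr1_intro (G := fun v q => 0)) => //.
- by move=> v q _; rewrite diff_cst.
- by move=> v q _; exact: cst_continuous.
Qed.

Lemma Cr1_add W (A : set V) (f g : V -> W) : open A ->
  Cr 1 A f -> Cr 1 A g -> Cr 1 A (f \+ g).
Proof.
move=> oA [df cf] [dg cg].
apply: (Cr1_intro (G := fun v q => 'D_v f q + 'D_v g q)) => //.
- by move=> q Aq; apply: differentiableD; [exact: df|exact: dg].
- move=> v q Aq; have fq := df q Aq; have gq := dg q Aq.
  by rewrite !deriveE// (diffD fq gq).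
- by move=> v q Aq; apply: continuousD; [exact: cf|exact: cg].
Qed.

Lemma Cr1_scale W (A : set V) (f : V -> R) (g : V -> W) : open A ->
  Cr 1 A f -> Cr 1 A g -> Cr 1 A (fun q => f q *: g q).
Proof.
move=> oA Cf Cg; have cf := Cr1_continuous Cf; have cg := Cr1_continuous Cg.
have [df ddf] := Cf; have [dg ddg] := Cg.
have dfg q v : A q -> is_derive q v (fun q => f q *: g q)
    ('D_v f q *: g q + f q *: 'D_v g q).
  by move=> Aq; apply: is_derive_scale; apply: derivableP; apply: diff_derivable;
    [exact: df|exact: dg].
apply: (Cr1_partials (g := fun i q => 'D_(e i) f q *: g q + f q *: 'D_(e i) g q)) => //.
move=> i q Aq; apply: continuousD; apply: continuousZ.
- exact: ddf.
- exact: cg.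
- exact: cf.
- exact: ddg.
Qed.

Lemma Cr1_sum W (J : Type) (r : seq J) (A : set V) (g : J -> V -> W) : open A ->
  (forall j, Cr 1 A (g j)) -> Cr 1 A (fun q => \sum_(j <- r) g j q).
Proof.
move=> oA Cg; elim: r => [|j r IH].
  apply: (@Cr1_eq _ A (cst 0)) => //; first by move=> q _; rewrite big_nil.
  exact: Cr1_cst.
apply: (@Cr1_eq _ A (g j \+ fun q => \sum_(i <- r) g i q)) => //.
  by move=> q _; rewrite big_cons.
exact: Cr1_add.
Qed.

Lemma Cr1_inv (A : set V) (f : V -> R) : open A -> (forall q, A q -> f q != 0) ->
  Cr 1 A f -> Cr 1 A (fun q => (f q)^-1).
Proof.
move=> oA f0 Cf; have cf := Cr1_continuous Cf; have [df ddf] := Cf.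
apply: (Cr1_partials (g := fun i q => (- (f q ^- 2) *: 'D_(e i) f q))) => //.
  move=> i q Aq; have fq0 := f0 q Aq; have dfq := diff_derivable (v := e i) (df q Aq).
  by apply: DeriveDef; [exact: derivableV|rewrite deriveV].
move=> i q Aq; apply: continuousZ; last exact: ddf.
apply: continuousN; apply: continuousV; first by rewrite expf_neq0// f0.
apply: (@continuous_comp _ _ _ f (fun x => x ^+ 2)); first exact: cf.
exact: exprn_continuous.
Qed.

Lemma Cr1_mxP m n (A : set V) (M : V -> 'M[R]_(m, n)) : open A ->
  Cr 1 A M <-> forall i j, Cr 1 A (fun q => M q i j).
Proof.
move=> oA; split=> [[dM cdM] i j|CM].
- have dMij q v : A q -> is_derive q v (fun q => M q i j) ('D_v M q i j).
    move=> Aq; have Mqv := diff_derivable (v := v) (dM q Aq).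
    rewrite derive_mx// mxE; apply: derivableP.
    exact: ((derivable_mxP _ _ _).1 Mqv).
  apply: (Cr1_partials (g := fun l q => 'D_(e l) M q i j)) => //.
  move=> l q Aq; apply: (@continuous_comp _ _ _ ('D_(e l) M) (fun N : 'M[R]_(m, n) => N i j)).
    exact: cdM.
  exact: coord_continuous.
- have E q : M q = \sum_(ij : 'I_m * 'I_n) M q ij.1 ij.2 *: delta_mx ij.1 ij.2.
    by rewrite {1}(matrix_sum_delta (M q)) pair_bigA.
  apply: (@Cr1_eq _ A (fun q => \sum_(ij : 'I_m * 'I_n) M q ij.1 ij.2 *: delta_mx ij.1 ij.2)) => //.
  apply: Cr1_sum => // ij; apply: Cr1_scale => //; exact: Cr1_cst.
Qed.

End FrameTheory.

(** In the chain rule the direction ['D_v f q] moves with q, while [Cr 1] controls derivatives of g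
    in fixed directions only; expanding the moving direction in the frame of W reconciles the
    two. *)
Lemma Cr1_comp V (I : finType) (e : I -> V) (c : I -> V -> R) (fr : frame e c)
    W (J : finType) (e' : J -> W) (c' : J -> W -> R) (fr' : frame e' c')
    (Z : normedModType R) (A : set V) (B : set W) (f : V -> W) (g : W -> Z) : open A -> 
  (forall q, A q -> B (f q)) -> Cr 1 A f -> Cr 1 B g -> Cr 1 A (g \o f).
Proof.
move=> oA AB Cf Cg; have cf := Cr1_continuous Cf; have [df ddf] := Cf.
have [dg ddg] := Cg.
apply: (Cr1_intro (G := fun v q => \sum_j c' j ('D_v f q) *: 'D_(e' j) g (f q))) => //.
- by move=> q Aq; apply: differentiable_comp; [exact: df|exact/dg/AB].
- move=> v q Aq; have dfq := df q Aq; have dgq := dg _ (AB q Aq).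
  rewrite diff_comp//= {1}(frame_sum fr' ('d f q v)) linear_sum.
  by apply: eq_bigr => j _; rewrite linearZ/= !deriveE.
- move=> v; apply: Cr0_sum => j q Aq; apply: continuousZ.
    apply: (@continuous_comp _ _ _ ('D_v f) (c' j)); first exact: ddf.
    exact: frame_coord_continuous fr' _ _.
  apply: (@continuous_comp _ _ _ f ('D_(e' j) g)); first exact: cf.
  by apply: ddg; exact: AB.
Qed.

End Frames.

(** * Uniform estimates over compact sets *)

Section Compactness.
Variable R : realType.
Implicit Types V W : normedModType R.

(** Compactness in its near-covering form, along the filter of constants tending to infinity:
    monotonicity in M makes the local constants compatible. *)
Lemma compact_uniform (X : topologicalType) (K : set X) (P : R -> X -> Prop) :
  compact K -> (forall M M' x, M <= M' -> P M x -> P M' x) ->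
  (forall x, K x -> exists M, \forall x' \near x, P M x') ->
  exists2 M, 0 < M & forall x, K x -> P M x.
Proof.
move=> /compact_near_coveringP cK monoP locP.
have /filter_ex : \forall M \near +oo, 0 < M /\ K `<=` P M.
  apply: filterI; first by exists 0; split.
  apply: (cK R +oo P) => x /locP[M PM].
  exists ([set x' | P M x'], [set M' | M < M']); first by split=> //=; apply: nbhs_pinfty_gt; exact: num_real.
  by move=> -[x' M'] [/= Px' /ltW MM']; exact: monoP Px'.
by move=> [M [M0 MK]]; exists M.
Qed.

Lemma compact_bound (X : topologicalType) W (K : set X) (f : X -> W) :
  compact K -> (forall x, K x -> {for x, continuous f}) ->
  exists2 M, 0 < M & forall x, K x -> `|f x| <= M.
Proof.
move=> cK cf.
apply: (@compact_uniform _ K (fun M x => `|f x| <= M)) => // [M M' x MM' /le_trans|x Kx].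
  exact.
exists (`|f x| + 1); have /cvgrPdist_lt/(_ 1 ltr01) := cf x Kx.
apply: filterS => x'; rewrite distrC => /ltW fx.
by rewrite -lerBlDl; apply: le_trans (lerB_dist _ _) fx.
Qed.

Definition thicken V (K : set V) (d : R) : set V :=
  [set x | exists2 xi, K xi & `|x - xi| <= d].

(** The radius is the inverse of a uniform constant M, admissible radii being locally bounded below.
    The thickened set is compact as the image of K times a closed ball under addition. *)
Lemma compact_thicken k (K U : set 'rV[R]_k) : compact K -> open U -> K `<=` U ->
  exists d, [/\ 0 < d, compact (thicken K d) & thicken K d `<=` U].
Proof.
move=> cK oU KU.
have [||M M0 MK] := @compact_uniform _ K
    (fun M x => 0 < M /\ forall y, `|y - x| * M <= 1 -> U y) cK.
- move=> M M' x MM' [M0 MU]; split; first exact: lt_le_trans MM'.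
  by move=> y yx; apply: MU; apply: le_trans yx; rewrite ler_wpM2l.
- move=> x /KU Ux; have /nbhs_ballP[r/= r0 rU] := open_nbhs_nbhs (conj oU Ux).
  have r20 : 0 < r / 2 by rewrite divr_gt0.
  (* With this constant, [|y - x'| * M <= 1] forces [|y - x'| < r / 2]; the other half of r pays for
     moving x to x'. *)
  exists (2 / r + 1); near=> x'; split; first by rewrite addr_gt0// divr_gt0.
  move=> y yx'; apply: rU; rewrite -ball_normE/= -(subrK x' x) -addrA.
  apply: le_lt_trans (ler_normD _ _) _.
  have xx' : `|x - x'| < r / 2.
    by near: x'; have := @nbhsx_ballx _ _ x _ r20; rewrite -ball_normE.
  have : `|x' - y| < r / 2.
    rewrite distrC ltNge; apply/negP => yr.
    have : r / 2 * (2 / r + 1) <= 1.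
      by apply: le_trans yx'; rewrite ler_wpM2r// addr_ge0// divr_ge0// ltW.
    have -> : r / 2 * (2 / r + 1) = 1 + r / 2 by field; rewrite gt_eqF.
    by lra.
  by lra.
exists M^-1; split; first by rewrite invr_gt0.
- pose B := [set v : 'rV[R]_k | `|v| <= M^-1].
  have cB : compact B.
    apply: bounded_closed_compact.
      by exists M^-1; split; [exact: num_real|move=> r Mr v Bv; exact: le_trans (ltW Mr)].
    apply: (@closed_comp _ _ (fun v : 'rV[R]_k => `|v|) [set r : R | r <= M^-1]).
      by move=> v _; exact: norm_continuous.
    exact: closed_le.
  have -> : thicken K M^-1 = (fun p : 'rV[R]_k * 'rV[R]_k => p.1 + p.2) @` (K `*` B).
    apply/seteqP; split=> [x [xi Kxi xxi]|_ [[xi v] /= [Kxi Bv] <-]].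
      by exists (xi, x - xi) => //=; rewrite addrC subrK.
    by exists xi => //; rewrite addrAC subrr add0r.
  apply: continuous_compact; last exact: compact_setX.
  by apply: continuous_subspaceT => p; exact: add_continuous.
- move=> x [xi Kxi xxi]; have [_] := MK xi Kxi; apply.
  by rewrite -ler_pdivlMr// mul1r.
Unshelve. all: by end_near. Qed.

Lemma periodic_int T (f : R -> T) (p : R) : (forall t, f (t + p) = f t) ->
  forall t (j : int), f (t + j%:~R * p) = f t.
Proof.
move=> fp; have nat_case t (m : nat) : f (t + m%:R * p) = f t.
  elim: m => [|m IH]; first by rewrite mul0r addr0.
  by rewrite -natr1 mulrDl mul1r addrA fp.
move=> t [m|m]; first exact: nat_case.
by rewrite NegzE mulrNz -[LHS](nat_case _ m.+1) mulNr subrK.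
Qed.

Lemma periodic_reduce (p : R) (t : R) : 0 < p ->
  exists j : int, 0 <= t + j%:~R * p <= p.
Proof.
move=> p0; exists (- Num.floor (t / p)).
have := ge_floor (t / p); have := lt_succ_floor (t / p).
rewrite rmorphN/= intrD ltr_pdivrMr// => h1; rewrite ler_pdivlMr// => h2.
by move: h1; rewrite mulrDl mul1r; lra.
Qed.

(** The phase runs over the noncompact universal cover; reduced modulo p it lies in [[0, p]], so
    that the bound is taken over a compact product. *)
Lemma periodic_bound k W (U K : set 'rV[R]_k) (f : 'rV[R]_k * R -> W) (p : R) :
  0 < p -> Cr 0 (U `*` setT) f ->
  (forall x t, U x -> f (x, t + p) = f (x, t)) ->
  compact K -> K `<=` U ->
  exists2 M, 0 < M & forall x t, K x -> `|f (x, t)| <= M.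
Proof.
move=> p0 cf fp cK KU.
have [|M M0 MK] := @compact_bound _ W (K `*` `[0, p]%classic) f
    (compact_setX cK (@segment_compact _ _ _)).
  by move=> [x t] [/= Kx _]; apply: cf; split=> //; exact: KU.
exists M => // x t Kx; have [j jp] := periodic_reduce t p0.
rewrite -(periodic_int (f := fun t => f (x, t)) (p := p) _ t j).
  by apply: MK; split=> //=; rewrite in_itv.
by move=> s; apply: fp; exact: KU.
Qed.

Lemma derive_periodic k W (U : set 'rV[R]_k) (f : 'rV[R]_k * R -> W) (p : R) v :
  open U -> (forall x t, U x -> f (x, t + p) = f (x, t)) ->
  forall x t, U x -> 'D_v f (x, t + p) = 'D_v f (x, t).
Proof.
move=> oU fp x t Ux.
have -> : 'D_v f (x, t + p) = 'D_v (fun q => f (q + (0, p))) (x, t).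
  suff E : (fun h : R => h^-1 *: (f (h *: v + (x, t + p)) - f (x, t + p))) =
      (fun h : R => h^-1 *: (f (h *: v + (x, t) + (0, p)) - f ((x, t) + (0, p)))).
    by rewrite /derive /= E.
  have E : (x, t + p) = (x, t) + (0, p) by congr (_, _); rewrite addr0.
  by apply/funext => h; rewrite E addrA.
apply: near_eq_derive; exists (U, setT).
  by split; [exact: open_nbhs_nbhs|exact: filterT].
move=> [y s] [/= Uy _]; have -> : (y, s) + (0, p) = (y, s + p).
  by congr (_, _); rewrite addr0.
exact: fp.
Qed.

(** * Mean value and Taylor estimates along segments *)

Section Segments.
Variables (V : normedModType R) (I : finType) (e : I -> V) (c : I -> V -> R).
Hypothesis fr : frame e c.

(** The mean value inequality for [s |-> f (s *: (y - x) + x) - s *: a]. Taking a = 0 gives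
    Lipschitz bounds, and [a = 'd f x (y - x)] the second-order remainder. *)
Lemma segment_taylor W (f : V -> W) (a : W) (x y : V) (M : R) :
  (forall s, 0 <= s <= 1 -> differentiable f (s *: (y - x) + x) /\
     `|'d f (s *: (y - x) + x) (y - x) - a| <= M) ->
  `|f y - f x - a| <= M.
Proof.
move=> H; pose J := [set s : R | 0 <= s <= 1].
have iJ : is_interval J.
  move=> b b' /andP[a0 a1] /andP[b0 b1] s /andP[as_ sb].
  by rewrite /J/= (le_trans a0)//= (le_trans sb).
have dJ s : J s -> is_derive s (1 : R) (fun s => f (s *: (y - x) + x) - s *: a)
    ('d f (s *: (y - x) + x) (y - x) - a).
  move=> /H[df _]; apply: is_deriveB.
    by apply: is_derive_line; exact: diff_is_derive.
  by have := is_derive_scale (is_derive_id s (1 : R)) (is_derive_cst a s 1);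
    rewrite scale1r scaler0 addr0.
have J0 : J 0 by rewrite /J/= lexx ler01.
have J1 : J 1 by rewrite /J/= lexx ler01.
have := mean_value iJ dJ (fun s Js => (H s Js).2) J0 J1.
by rewrite !scale0r add0r !scale1r subrK !subr0 normr1 mulr1 addrAC.
Qed.

Lemma segment_lipschitz W (f : V -> W) (x y : V) (M : R) :
  (forall s, 0 <= s <= 1 -> differentiable f (s *: (y - x) + x) /\
     `|'d f (s *: (y - x) + x) (y - x)| <= M) ->
  `|f y - f x| <= M.
Proof.
move=> H; have := @segment_taylor W f 0 x y M; rewrite subr0; apply=> s /H.
by rewrite subr0.
Qed.

Lemma diff_bound W (f : V -> W) p (M : R) : differentiable f p ->
  (forall i, `|'D_(e i) f p| <= M) -> forall v, `|'d f p v| <= #|I|%:R * M * `|v|.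
Proof.
move=> df DM v; apply: (le_trans (frame_bound fr _ _)); rewrite ler_wpM2r//.
rewrite mulr_natl -sumr_const; apply: ler_sum => i _.
by rewrite -deriveE// DM.
Qed.

Lemma Cr1_diff_near W (A : set V) (f : V -> W) p0 d : open A -> Cr 1 A f ->
  A p0 -> 0 < d ->
  \forall p \near p0, A p /\ forall v, `|'d f p v - 'd f p0 v| <= d * `|v|.
Proof.
move=> oA [df cdf] Ap0 d0; pose N := #|I|%:R + 1 : R.
have N0 : 0 < N by rewrite ltr_wpDl.
have dN0 : 0 < d / N by rewrite divr_gt0.
have : \forall p \near p0, forall i, `|'D_(e i) f p0 - 'D_(e i) f p| <= d / N.
  apply: filter_forall => i.
  by have /cvgrPdist_le/(_ _ dN0) := cdf (e i) p0 Ap0.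
apply: filterS2 (open_nbhs_nbhs (conj oA Ap0)) => p Ap pP; split=> // v.
have dfp := df p Ap; have dfp0 := df p0 Ap0.
rewrite (diffE_frame fr f p v) (diffE_frame fr f p0 v) -sumrB.
apply: le_trans (ler_norm_sum _ _ _) _.
apply: (@le_trans _ _ (\sum_(i : I) d / N * `|v|)).
  apply: ler_sum => i _; rewrite -scalerBr normrZ mulrC ler_pM//.
    by rewrite -!deriveE// distrC; exact: pP.
  exact: (frame_coord fr).
rewrite sumr_const -[X in X <= _]mulr_natl mulrA ler_wpM2r//.
by rewrite mulrCA ler_piMr ?(ltW d0)// ler_pdivrMr// mul1r lerDl.
Qed.

Lemma compact_diff_bound W (A K : set V) (f : V -> W) : Cr 1 A f ->
  compact K -> K `<=` A ->
  exists2 M, 0 < M & forall p v, K p -> `|'d f p v| <= M * `|v|.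
Proof.
move=> [df cdf] cK KA.
have /fin_all_exists2[M M0 MK] (i : I) :
    exists2 M, 0 < M & forall p, K p -> `|'D_(e i) f p| <= M.
  by apply: compact_bound => // p /KA; exact: cdf.
have S0 : 0 <= \sum_i M i by apply: sumr_ge0 => i _; exact/ltW.
exists (#|I|%:R * (\sum_i M i) + 1); first by rewrite ltr_wpDl// mulr_ge0.
move=> p v Kp; apply: (@le_trans _ _ (#|I|%:R * (\sum_i M i) * `|v|)); last first.
  by rewrite ler_wpM2r// lerDl.
apply: diff_bound; first exact/df/KA.
move=> i; apply: (le_trans (MK i p Kp)); rewrite (bigD1 i)//= lerDl.
by apply: sumr_ge0 => j _; exact/ltW.
Qed.

End Segments.

Lemma periodic_diff_bound k W (U K : set 'rV[R]_k) (f : 'rV[R]_k * R -> W) (p : R) :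
  0 < p -> open U -> Cr 1 (U `*` setT) f ->
  (forall x t, U x -> f (x, t + p) = f (x, t)) ->
  compact K -> K `<=` U ->
  exists2 M, 0 < M & forall x t v, K x -> `|'d f (x, t) v| <= M * `|v|.
Proof.
move=> p0 oU [df cdf] fp cK KU.
pose D (i : 'I_k + 'I_1) := 'D_(match i with inl j => (delta_mx 0 j, 0) | inr _ => (0, 1) end :
  'rV[R]_k * R) f.
have /fin_all_exists2[M M0 MK] (i : 'I_k + 'I_1) :
    exists2 M, 0 < M & forall x t, K x -> `|D i (x, t)| <= M.
  apply: (periodic_bound p0 _ _ cK KU); first exact: cdf.
  by move=> x t; exact: derive_periodic.
have S0 : 0 <= \sum_i M i by apply: sumr_ge0 => i _; exact/ltW.
exists (#|{: 'I_k + 'I_1}|%:R * (\sum_i M i) + 1); first by rewrite ltr_wpDl// mulr_ge0.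
move=> x t v Kx.
apply: (@le_trans _ _ (#|{: 'I_k + 'I_1}|%:R * (\sum_i M i) * `|v|)); last first.
  by rewrite ler_wpM2r// lerDl.
apply: (diff_bound (frame_prod R k)); first by apply: df; split=> //; exact: KU.
move=> i; apply: (le_trans (MK i x t Kx)); rewrite (bigD1 i)//= lerDl.
by apply: sumr_ge0 => j _; exact/ltW.
Qed.

End Compactness.

(** * Matrix-valued functions *)

(* [b : bool] coerces to the differentiability class: every [Crb_] lemma holds
   for C^0 and for C^1. *)
Section CrMatrix.
Variables (R : realType) (V : normedModType R) (I : finType).
Variables (e : I -> V) (c : I -> V -> R).
Hypothesis fr : frame e c.
Implicit Types (W : normedModType R) (A : set V) (b : bool).

Lemma Crb_eq b W A (f g : V -> W) : open A ->
  (forall q, A q -> f q = g q) -> Cr b A f -> Cr b A g.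
Proof. by case: b => oA; [exact: Cr1_eq|exact: Cr0_eq]. Qed.

Lemma Crb_cst b W A (a : W) : open A -> Cr b A (fun _ : V => a).
Proof.
by case: b => oA; [exact: Cr1_cst oA|move=> q _; exact: cst_continuous].
Qed.

Lemma Crb_add b W A (f g : V -> W) : open A ->
  Cr b A f -> Cr b A g -> Cr b A (fun q => f q + g q).
Proof.
case: b => oA; first exact: Cr1_add oA.
by move=> cf cg q Aq; apply: continuousD; [exact: cf|exact: cg].
Qed.

Lemma Crb_scale b W A (f : V -> R) (g : V -> W) : open A ->
  Cr b A f -> Cr b A g -> Cr b A (fun q => f q *: g q).
Proof.
case: b => oA; first exact: (Cr1_scale fr oA).
by move=> cf cg q Aq; apply: continuousZ; [exact: cf|exact: cg].
Qed.

Lemma Crb_mul b A (f g : V -> R) : open A ->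
  Cr b A f -> Cr b A g -> Cr b A (fun q => f q * g q).
Proof. exact: Crb_scale. Qed.

Lemma Crb_inv b A (f : V -> R) : open A -> (forall q, A q -> f q != 0) ->
  Cr b A f -> Cr b A (fun q => (f q)^-1).
Proof.
case: b => oA f0; first exact: (Cr1_inv fr oA f0).
by move=> cf q Aq; apply: continuousV; [exact: f0|exact: cf].
Qed.

Lemma Crb_sum b W (J : Type) (r : seq J) A (g : J -> V -> W) : open A ->
  (forall j, Cr b A (g j)) -> Cr b A (fun q => \sum_(j <- r) g j q).
Proof.
case: b => oA Cg; first exact: Cr1_sum.
exact: (Cr0_sum Cg).
Qed.

Lemma Crb_prod b (J : Type) (r : seq J) A (g : J -> V -> R) : open A ->
  (forall j, Cr b A (g j)) -> Cr b A (fun q => \prod_(j <- r) g j q).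
Proof.
move=> oA Cg; elim: r => [|j r IH].
  apply: Crb_eq oA _ (Crb_cst b (1 : R) oA) => q _; by rewrite big_nil.
apply: Crb_eq oA _ (Crb_mul oA (Cg j) IH) => q _; by rewrite big_cons.
Qed.

Lemma Crb_mxP b m n A (M : V -> 'M[R]_(m, n)) : open A ->
  Cr b A M <-> forall i j, Cr b A (fun q => M q i j).
Proof.
case: b => oA; first exact: (Cr1_mxP fr M oA).
split=> [cM i j q Aq|cM].
  apply: (@continuous_comp _ _ _ M (fun N : 'M[R]_(m, n) => N i j)); first exact: cM.
  exact: coord_continuous.
apply: (@Crb_eq false _ A (fun q => \sum_(ij : 'I_m * 'I_n) M q ij.1 ij.2 *: delta_mx ij.1 ij.2)) => //.
  by move=> q _; rewrite [RHS](matrix_sum_delta (M q)) pair_bigA.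
by apply: Crb_sum => // ij; apply: (Crb_scale oA (cM _ _) (Crb_cst false _ oA)).
Qed.

Lemma Crb_mulmx b m n p A (M : V -> 'M[R]_(m, n)) (N : V -> 'M[R]_(n, p)) :
  open A -> Cr b A M -> Cr b A N -> Cr b A (fun q => M q *m N q).
Proof.
move=> oA /Crb_mxP CM /Crb_mxP CN; apply/Crb_mxP => // i j.
apply: (@Crb_eq b _ A (fun q => \sum_l M q i l * N q l j)) => // [q _|].
  by rewrite mxE.
by apply: Crb_sum => // l; apply: Crb_mul => //; [exact: CM|exact: CN].
Qed.

Lemma Crb_trmx b m n A (M : V -> 'M[R]_(m, n)) :
  open A -> Cr b A M -> Cr b A (fun q => (M q)^T).
Proof.
move=> oA /Crb_mxP CM; apply/Crb_mxP => // i j.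
by apply: (@Crb_eq b _ A (fun q => M q j i)) => // [q _|]; [rewrite mxE|exact: CM].
Qed.

Lemma Crb_det b n A (M : V -> 'M[R]_n) :
  open A -> Cr b A M -> Cr b A (fun q => \det (M q)).
Proof.
move=> oA /Crb_mxP CM.
apply: Crb_sum => // s; apply: Crb_mul => //; first exact: Crb_cst.
by apply: Crb_prod => // i; exact: CM.
Qed.

Lemma Crb_inverse b n A (M N : V -> 'M[R]_n) : open A ->
  (forall q, A q -> M q *m N q = 1%:M) -> Cr b A M -> Cr b A N.
Proof.
move=> oA MN CM; apply/Crb_mxP => // i j.
have unitM q : A q -> M q \in unitmx by move=> /MN /mulmx1_unit[].
apply: (@Crb_eq b _ A (fun q => (\det (M q))^-1 * cofactor (M q) j i)) => // [q Aq|].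
  have -> : N q = invmx (M q).
    by rewrite -[N q]mul1mx -(mulVmx (unitM q Aq)) -mulmxA MN// mulmx1.
  by rewrite /invmx unitM// !mxE.
apply: Crb_mul => //.
  apply: Crb_inv => //; last exact: Crb_det.
  by move=> q /unitM; rewrite unitmxE unitfE.
apply: Crb_mul => //; first exact: Crb_cst.
apply: Crb_det => //; apply/Crb_mxP => // i' j'.
apply: (@Crb_eq b _ A (fun q => M q (lift j i') (lift i j'))) => // [q _|].
  by rewrite !mxE.
by move/Crb_mxP : CM; apply.
Qed.

End CrMatrix.

Section MatrixDerivatives.
Variables (R : realType) (V : normedModType R).

Lemma is_derive_mxP m n (M : V -> 'M[R]_(m, n)) (x v : V) (D : 'M[R]_(m, n)) :
  is_derive x v M D <-> forall i j, is_derive x v (fun y => M y i j) (D i j).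
Proof.
split=> [[Mxv <-] i j|H].
  by rewrite derive_mx// mxE; apply: derivableP; exact: ((derivable_mxP _ _ _).1 Mxv).
have dM : derivable M x v by apply/derivable_mxP => i j; have [] := H i j.
apply: DeriveDef => //; rewrite derive_mx//; apply/matrixP => i j; rewrite mxE.
by have [_] := H i j.
Qed.

Lemma is_derive_mulmx m n p (M : V -> 'M[R]_(m, n)) (N : V -> 'M[R]_(n, p))
    (x v : V) (dM : 'M[R]_(m, n)) (dN : 'M[R]_(n, p)) :
  is_derive x v M dM -> is_derive x v N dN ->
  is_derive x v (fun y => M y *m N y) (dM *m N x + M x *m dN).
Proof.
move=> /is_derive_mxP HM /is_derive_mxP HN; apply/is_derive_mxP => i j.
rewrite (_ : (fun y => _) = \sum_(l < n) (fun y => M y i l * N y l j)); last first.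
  by apply/funext => y; rewrite mxE fct_sumE.
rewrite !mxE -big_split/=.
apply: is_derive_sum => l.
have := is_derive_scale (HM i l) (HN l j); exact.
Qed.

End MatrixDerivatives.

(** * Dependence of linear differential equations on parameters *)

Definition primitive (R : realType) (f : R -> R) : R -> R :=
  xget (fun=> 0) [set F | F 0 = 0 /\ forall t, is_derive t (1 : R) F (f t)].

Lemma primitiveP (R : realType) (f : R -> R) : continuous f ->
  primitive f 0 = 0 /\ forall t, is_derive t (1 : R) (primitive f) (f t).
Proof.
move=> /antiderivative_exists[F FP].
exact: (xgetI (fun=> 0) (P := [set F | F 0 = 0 /\ forall t, is_derive t (1 : R) F (f t)]) FP).
Qed.

Section ParameterDependence.
Variables (R : realType) (k : nat) (U : set 'rV[R]_k).
Hypothesis oU : open U.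
Implicit Types W : normedModType R.
Local Notation O := (U `*` [set: R]).

Lemma open_cylinder : open O.
Proof.
rewrite (_ : O = fst @^-1` U); last first.
  by apply/seteqP; split=> [p []|p Up].
by apply: open_comp => // p _; exact: cvg_fst.
Qed.
Local Notation oO := open_cylinder.
Local Notation fr := (frame_prod R k).

Lemma segment_sym_compact (b : R) : compact [set s : R | `|s| <= b].
Proof.
rewrite (_ : [set s | _] = `[- b, b]%classic); first exact: segment_compact.
by apply/seteqP; split=> s; rewrite /= in_itv/= ler_norml.
Qed.

(** The tube lemma: continuity at the points of the compact segment over x0 becomes uniform along
    it. *)
Lemma tube W (f : 'rV[R]_k * R -> W) (x0 : 'rV[R]_k) (b eta : R) :
  Cr 0 O f -> U x0 -> 0 < eta ->
  \forall x \near x0, forall s, `|s| <= b -> `|f (x, s) - f (x0, s)| <= eta.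
Proof.
move=> cf Ux0 eta0.
have := (compact_near_coveringP _).1 (@segment_sym_compact b) _ (nbhs x0)
  (fun x s => `|f (x, s) - f (x0, s)| <= eta); apply.
move=> s sb; have e20 : 0 < eta / 2 by rewrite divr_gt0.
have /cvgrPdist_le/(_ _ e20) : f x @[x --> (x0, s)] --> f (x0, s).
  by apply: cf; split.
move=> [[A B] /= [nA nB] AB]; exists (B, A) => // -[s' x] [/= Bs' Ax].
rewrite -[f (x, s')](subrK (f (x0, s))) -addrA.
apply: le_trans (ler_normD _ _) _; rewrite [eta]splitr; apply: lerD.
  by rewrite distrC; exact: (AB (x, s')).
by apply: (AB (x0, s')); split=> //; exact: nbhs_singleton.
Qed.

(** A converse to [tube]. Gronwall and mean value estimates in s produce exactly such uniform
    closeness, and this turns it into joint continuity. *)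
Lemma tube_continuous W (f : 'rV[R]_k -> R -> W) :
  (forall x0 b eta, U x0 -> 0 < eta ->
    \forall x \near x0, forall s, `|s| <= b -> `|f x s - f x0 s| <= eta) ->
  (forall x0 s, U x0 -> {for s, continuous (f x0)}) ->
  Cr 0 O (fun p => f p.1 p.2).
Proof.
move=> tf cf [x0 s0] [/= Ux0 _]; apply/cvgrPdist_le => /= eta eta0.
have e20 : 0 < eta / 2 by rewrite divr_gt0.
have /cvgrPdist_le/(_ _ e20) nB := cf x0 s0 Ux0.
have nA := tf x0 (`|s0| + 1) _ Ux0 e20.
have nC : \forall s \near s0, `|s| <= `|s0| + 1.
  have /cvgrPdist_le/(_ 1 ltr01) : id s @[s --> s0] --> s0 by [].
  apply: filterS => s ss0; rewrite -lerBlDl; apply: le_trans (lerB_dist _ _) _.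
  by rewrite distrC.
exists ([set x | forall s, `|s| <= `|s0| + 1 -> `|f x s - f x0 s| <= eta / 2],
        [set s | `|f x0 s0 - f x0 s| <= eta / 2 /\ `|s| <= `|s0| + 1]).
  by split=> //=; exact: filterI.
move=> [x s] [/= Ax [Bs Cs]]; rewrite -(subrK (f x0 s) (f x0 s0)) -addrA.
apply: le_trans (ler_normD _ _) _; rewrite [eta]splitr; apply: lerD => //.
by rewrite distrC; exact: Ax.
Qed.

Lemma line_pair (v x0 : 'rV[R]_k) (s h : R) :
  h *: (v, 0 : R) + (x0, s) = (h *: v + x0, s).
Proof. by congr (_, _); rewrite [X in X + _]scaler0 add0r. Qed.

Lemma line_pair2 (x0 : 'rV[R]_k) (s h : R) :
  h *: (0 : 'rV[R]_k, 1 : R) + (x0, s) = (x0, h *: 1 + s).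
Proof. by congr (_, _); rewrite [X in X + _]scaler0 add0r. Qed.

Lemma near_line (P : set 'rV[R]_k) (v x0 : 'rV[R]_k) :
  nbhs x0 P -> \forall h \near (0 : R), forall h', `|h'| <= `|h| -> P (h' *: v + x0).
Proof.
move=> /nbhs_ballP[r/= r0 rP]; apply/nbhs_ballP; exists (r / (`|v| + 1)).
  by rewrite /= divr_gt0// ltr_wpDl.
move=> h; rewrite /ball/= sub0r normrN ltr_pdivlMr ?ltr_wpDl// => hr h' h'h.
apply: rP; rewrite -ball_normE/= opprD addrCA subrr addr0 normrN normrZ.
by apply: le_lt_trans hr; rewrite ler_pM// lerDl.
Qed.

(** The mean value inequality between x0 and [h *: v + x0], with the partial derivative controlled
    by [tube]. The expansion is uniform in s, so it can be integrated in s. *)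
Lemma tube_diff W (f : 'rV[R]_k * R -> W) (x0 v : 'rV[R]_k) (b eta : R) :
  Cr 1 O f -> U x0 -> 0 < eta ->
  \forall h \near (0 : R), forall s, `|s| <= b ->
    `|f (h *: v + x0, s) - f (x0, s) - h *: 'D_(v, 0) f (x0, s)| <= eta * `|h|.
Proof.
move=> [df cdf] Ux0 eta0; have := tube b (cdf (v, 0)) Ux0 eta0.
move=> /(filterI (open_nbhs_nbhs (conj oU Ux0)))/(near_line v).
apply: filterS => h hP s sb.
pose J := [set s : R | `|s| <= `|h|].
have iJ : is_interval J.
  move=> a a'; rewrite /J/= !ler_norml => /andP[a1 a2] /andP[b1 b2] t /andP[at_ tb].
  by rewrite /J/= ler_norml (le_trans a1)// (le_trans tb).
have dD t : J t -> is_derive t (1 : R)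
    (fun t => f (t *: v + x0, s) - t *: 'D_(v, 0) f (x0, s))
    ('D_(v, 0) f (t *: v + x0, s) - 'D_(v, 0) f (x0, s)).
  move=> /hP[Ut _]; apply: is_deriveB.
    have := @is_derive_line R _ _ f (v, 0) (x0, s) t ('D_(v, 0) f (t *: v + x0, s)).
    rewrite line_pair; rewrite (_ : (fun s0 => _) = fun t => f (t *: v + x0, s)).
      by apply; apply/derivableP/diff_derivable/df.
    by apply/funext => u; rewrite line_pair.
  by have := is_derive_scale (is_derive_id t (1 : R)) (is_derive_cst ('D_(v, 0) f (x0, s)) t 1);
    rewrite scale1r scaler0 addr0.
have dDle t : J t -> `|'D_(v, 0) f (t *: v + x0, s) - 'D_(v, 0) f (x0, s)| <= eta.
  by move=> /hP[_]; exact.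
have J0 : J 0 by rewrite /J/= normr0.
have Jh : J h by rewrite /J/=.
have := mean_value iJ dD dDle J0 Jh.
by rewrite !scale0r add0r !subr0 addrAC.
Qed.

Lemma primitive_continuous W (T : 'rV[R]_k -> R -> W) (d : 'rV[R]_k * R -> W) :
  Cr 0 O d -> (forall x, U x -> T x 0 = 0) ->
  (forall x t, U x -> is_derive t (1 : R) (T x) (d (x, t))) ->
  Cr 0 O (fun p => T p.1 p.2).
Proof.
move=> cd T0 dT; apply: tube_continuous => [x0 b eta Ux0 eta0|x0 s Ux0]; last first.
  exact: is_derive_continuous (dT _ _ Ux0).
have e0 : 0 < eta / (`|b| + 1) by rewrite divr_gt0// ltr_wpDl.
apply: filterS2 (tube b cd Ux0 e0) (open_nbhs_nbhs (conj oU Ux0)) => x xP Ux s sb.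
pose J := [set s : R | `|s| <= b].
have iJ : is_interval J.
  move=> a a'; rewrite /J/= !ler_norml => /andP[a1 a2] /andP[b1 b2] t /andP[at_ tb].
  by rewrite /J/= ler_norml (le_trans a1)// (le_trans tb).
have dD t : J t -> is_derive t (1 : R) (fun t => T x t - T x0 t) (d (x, t) - d (x0, t)).
  by move=> _; apply: is_deriveB; exact: dT.
have J0 : J 0 by rewrite /J/= normr0; apply: le_trans sb.
have := mean_value iJ dD xP J0 (sb : J s).
rewrite !T0// subrr !subr0 => /le_trans; apply.
rewrite -[leRHS](divfK (_ : `|b| + 1 != 0)) ?gt_eqF ?ltr_wpDl//.
rewrite ler_wpM2l ?(ltW e0)//; apply: le_trans sb _.
by apply: le_trans (ler_norm b) _; rewrite lerDl.
Qed.

Lemma line_continuous W (f : 'rV[R]_k * R -> W) x :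
  Cr 0 O f -> U x -> continuous (fun s => f (x, s)).
Proof.
move=> cf Ux s; apply: (@continuous_comp _ _ _ (fun s => (x, s)) f).
  move=> P [[B C] /= [nB nC] BC]; apply: filterS nC => s' Cs'; apply: BC.
  by split=> //=; exact: nbhs_singleton.
by apply: cf.
Qed.

(** * Differentiation under the integral sign *)

Section PrimitiveDerivative.
Variables (I : 'rV[R]_k -> R -> R) (f : 'rV[R]_k * R -> R).
Hypothesis Cf : Cr 1 O f.
Hypothesis I0 : forall x, U x -> I x 0 = 0.
Hypothesis dI : forall x t, U x -> is_derive t (1 : R) (I x) (f (x, t)).

Local Notation T v := (fun x => primitive (fun s => 'D_(v, 0) f (x, s))).

Lemma primitive_partialP v x : U x -> T v x 0 = 0 /\
  forall t, is_derive t (1 : R) (T v x) ('D_(v, 0) f (x, t)).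
Proof. by move=> Ux; apply: primitiveP; exact: (line_continuous (Cf.2 (v, 0)) Ux). Qed.

(** The remainder of the first-order expansion of [I], as a function of s, vanishes at 0 and has a
    derivative that is o(h) uniformly by [tube_diff]; the mean value inequality replaces any
    estimate of integrals. *)
Lemma primitive_derive v x0 s0 : U x0 ->
  is_derive (x0, s0) (v, 0 : R) (fun p => I p.1 p.2) (T v x0 s0).
Proof.
move=> Ux0; apply/is_derive_epsP => eta eta0.
have e0 : 0 < eta / (`|s0| + 1) by rewrite divr_gt0// ltr_wpDl.
have := near_line v (open_nbhs_nbhs (conj oU Ux0)).
apply: filterS2 (tube_diff v `|s0| Cf Ux0 e0) => h hP hU.
rewrite line_pair/=; have Uh : U (h *: v + x0) by exact: hU.
pose J := [set s : R | `|s| <= `|s0|].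
have iJ : is_interval J.
  move=> a a'; rewrite /J/= !ler_norml => /andP[a1 a2] /andP[b1 b2] t /andP[at_ tb].
  by rewrite /J/= ler_norml (le_trans a1)// (le_trans tb).
have dD t : J t -> is_derive t (1 : R)
    (fun t => I (h *: v + x0) t - I x0 t - h *: T v x0 t)
    (f (h *: v + x0, t) - f (x0, t) - h *: 'D_(v, 0) f (x0, t)).
  move=> _; apply: is_deriveB; first by apply: is_deriveB; exact: dI.
  by apply: is_deriveZ; exact: (primitive_partialP v Ux0).2.
have J0 : J 0 by rewrite /J/= normr0.
have Js : J s0 by rewrite /J/=.
have := mean_value iJ dD hP J0 Js.
have T0 : T v x0 0 = 0 by exact: (primitive_partialP v Ux0).1.
rewrite !I0// T0 subrr scaler0 !subr0 => /le_trans; apply.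
rewrite mulrAC ler_wpM2r// -[leRHS](divfK (_ : `|s0| + 1 != 0)) ?gt_eqF ?ltr_wpDl//.
by rewrite ler_wpM2l ?(ltW e0)// lerDl.
Qed.

Lemma primitive_Cr1 : Cr 1 O (fun p => I p.1 p.2).
Proof.
apply: (Cr1_partials fr oO (g := fun i p => match i with
  | inl j => T (delta_mx 0 j) p.1 p.2 | inr _ => f p end)).
- move=> [j|j] [x0 s0] [/= Ux0 _]; first exact: primitive_derive.
  apply/is_derive_epsP => eta eta0.
  have /is_derive_epsP/(_ eta eta0) := dI s0 Ux0.
  by apply: filterS => h; rewrite line_pair2.
- move=> [j|j]; last exact: Cr1_continuous.
  apply: (@primitive_continuous _ (T (delta_mx 0 j)) ('D_(delta_mx 0 j, 0) f)).
  + exact: Cf.2.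
  + by move=> x /(primitive_partialP (delta_mx 0 j))[].
  + by move=> x t /(primitive_partialP (delta_mx 0 j))[].
Qed.

End PrimitiveDerivative.

(** * Differentiability of a fundamental matrix in the parameter *)

Section FundamentalMatrix.
Variables (n : nat) (A : 'rV[R]_k * R -> 'M[R]_n) (Y Z : 'rV[R]_k -> R -> 'M[R]_n).
Hypothesis CA : Cr 1 O A.
Hypothesis Y0 : forall x, U x -> Y x 0 = 1%:M.
Hypothesis dY : forall x s, U x -> is_derive s (1 : R) (Y x) (Y x s *m A (x, s)).
Hypothesis YZ : forall x s, U x -> Y x s *m Z x s = 1%:M.

Lemma segment_bound W (f : R -> W) (b : R) : continuous f ->
  exists2 M, 0 < M & forall s, `|s| <= b -> `|f s| <= M.
Proof.
move=> cf; have [M M0 MP] := compact_bound (@segment_sym_compact b) (fun s _ => cf s).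
by exists M.
Qed.

(** The difference D of the two solutions satisfies [D' = D *m A x + Y x0 *m (A x - A x0)], whose
    last term is uniformly small by [tube]; Gronwall's inequality applies. *)
Lemma fundamental_tube x0 b eta : U x0 -> 0 < eta ->
  \forall x \near x0, forall s, `|s| <= b -> `|Y x s - Y x0 s| <= eta.
Proof.
move=> Ux0 eta0.
have cY : continuous (Y x0) by move=> s; exact: is_derive_continuous (dY s Ux0).
have cA := line_continuous (Cr1_continuous CA) Ux0.
have [a a0 aP] := segment_bound b cA.
have [y y0 yP] := segment_bound b cY.
pose L := n%:R * (a + 1).
have L0 : 0 <= L by rewrite mulr_ge0// addr_ge0// ltW.
pose C := (2 + n%:R * y) * expR ((L + 1) * `|b|).
have C0 : 0 < C.
  by rewrite mulr_gt0 ?expR_gt0// ltr_wpDr// mulr_ge0// ltW.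
(* The bound 1 keeps [A (x, s)] below [a + 1], on which L is built; C is the Gronwall factor, so the
   final error [d * C] is at most eta. *)
pose d := Num.min 1 (eta / C).
have d0 : 0 < d by rewrite lt_min ltr01 divr_gt0.
have d1 : d <= 1 by rewrite ge_min lexx.
apply: filterS2 (tube b (Cr1_continuous CA) Ux0 d0) (open_nbhs_nbhs (conj oU Ux0)).
move=> x Ax Ux s sb.
pose D s := Y x s - Y x0 s.
pose dD s := Y x s *m A (x, s) - Y x0 s *m A (x0, s).
have dDP t : `|t| <= b -> is_derive t (1 : R) D (dD t).
  by move=> _; apply: is_deriveB; exact: dY.
have D0 : `|D 0| <= d by rewrite /D !Y0// subrr normr0 ltW.
have c0 : 0 <= n%:R * (y * d) by rewrite !mulr_ge0// ltW.
have dDle t : `|t| <= b -> `|dD t| <= L * `|D t| + 1 * (n%:R * (y * d)).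
  move=> tb.
  have -> : dD t = D t *m A (x, t) + Y x0 t *m (A (x, t) - A (x0, t)).
    by rewrite /dD /D mulmxBl mulmxBr addrA subrK.
  rewrite mul1r; apply: le_trans (ler_normD _ _) _; apply: lerD.
    apply: (le_trans (mx_norm_mul _ _)); rewrite /L -mulrA ler_wpM2l//.
    rewrite mulrC ler_wpM2r//.
    rewrite -(subrK (A (x0, t)) (A (x, t))) addrC.
    apply: le_trans (ler_normD _ _) _; apply: lerD; first exact: aP.
    exact: le_trans (Ax _ tb) d1.
  apply: (le_trans (mx_norm_mul _ _)); rewrite ler_wpM2l// ler_pM//; first exact: yP.
  exact: Ax.
have := gronwall_sym dDP L0 ltr01 c0 d0 D0 dDle sb.
rewrite -/(D s) => /le_trans; apply.
apply: (@le_trans _ _ (d * C)).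
  have -> : d + d + n%:R * (y * d) = d * (2 + n%:R * y) by ring.
  rewrite -mulrA ler_wpM2l ?(ltW d0)// ler_wpM2l ?addr_ge0 ?mulr_ge0 ?(ltW y0)//.
  rewrite ler_expR ler_wpM2l ?addr_ge0//.
  by apply: le_trans sb _; exact: ler_norm.
by rewrite -ler_pdivlMr// ge_min lexx orbT.
Qed.

Lemma fundamental_continuous : Cr 0 O (fun p => Y p.1 p.2).
Proof.
apply: tube_continuous => [x0 b eta|x0 s Ux0]; first exact: fundamental_tube.
exact: is_derive_continuous (dY s Ux0).
Qed.

(* Duhamel's formula: the integrand involves only Y and its inverse, which are
   already known to be continuous. *)
Definition sensitivity (v x : 'rV[R]_k) (s : R) : 'M[R]_n :=
  (\matrix_(i, j) primitive (fun t => (Y x t *m 'D_(v, 0) A (x, t) *m Z x t) i j) s)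
    *m Y x s.

Lemma sensitivity_integrand_continuous v :
  Cr 0 O (fun p => Y p.1 p.2 *m 'D_(v, 0) A p *m Z p.1 p.2).
Proof.
have cY := fundamental_continuous.
have cZ : Cr 0 O (fun p => Z p.1 p.2).
  apply: (Crb_inverse fr (b := false) oO (M := fun p => Y p.1 p.2)) => // p [Up _].
  exact: YZ.
apply: (Crb_mulmx fr (b := false) oO _ cZ).
apply: (Crb_mulmx fr (b := false) oO cY).
exact: CA.2.
Qed.

Lemma sensitivity_primitive v x : U x -> forall i j,
  let f := fun t => (Y x t *m 'D_(v, 0) A (x, t) *m Z x t) i j in
  primitive f 0 = 0 /\ forall t, is_derive t (1 : R) (primitive f) (f t).
Proof.
move=> Ux i j; apply: primitiveP.
have /(Crb_mxP fr false _ oO)/(_ i j) := @sensitivity_integrand_continuous v.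
by move=> /line_continuous/(_ Ux).
Qed.

Lemma sensitivity_continuous v : Cr 0 O (fun p => sensitivity v p.1 p.2).
Proof.
apply: (Crb_mulmx fr (b := false) oO); last exact: fundamental_continuous.
apply/(Crb_mxP fr false _ oO) => i j.
pose T x s := primitive (fun t => (Y x t *m 'D_(v, 0) A (x, t) *m Z x t) i j) s.
apply: (Crb_eq (b := false) (f := fun p => T p.1 p.2) oO) => [p _|].
  by rewrite mxE.
have /(Crb_mxP fr false _ oO)/(_ i j) cd := @sensitivity_integrand_continuous v.
apply: (primitive_continuous cd) => [x /(sensitivity_primitive v)/(_ i j)[]//|x t].
by move=> /(sensitivity_primitive v)/(_ i j)[].
Qed.

Lemma sensitivity_derive v x s : U x -> is_derive s (1 : R) (sensitivity v x)
  (Y x s *m 'D_(v, 0) A (x, s) + sensitivity v x s *m A (x, s)).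
Proof.
move=> Ux.
have dT : is_derive s (1 : R)
    (fun s => \matrix_(i, j) primitive (fun t => (Y x t *m 'D_(v, 0) A (x, t) *m Z x t) i j) s)
    (Y x s *m 'D_(v, 0) A (x, s) *m Z x s).
  apply/is_derive_mxP => i j.
  rewrite (_ : (fun y => _) = primitive (fun t => (Y x t *m 'D_(v, 0) A (x, t) *m Z x t) i j)).
    exact: (sensitivity_primitive v Ux i j).2.
  by apply/funext => y; rewrite mxE.
have := is_derive_mulmx dT (dY s Ux).
by rewrite -[_ *m Z x s *m Y x s]mulmxA (mulmx1C (YZ s Ux)) mulmx1 mulmxA.
Qed.

(** The remainder D solves the linear equation with matrix [A (x0, t)] and two error terms: the
    product of the increments of Y and A, and Y times the first-order remainder of A. Both are at
    most a constant times [d * |h|], and Gronwall's inequality carries this over to D. *)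
Lemma fundamental_derive v x0 s0 : U x0 ->
  is_derive (x0, s0) (v, 0 : R) (fun p => Y p.1 p.2) (sensitivity v x0 s0).
Proof.
move=> Ux0; apply/is_derive_epsP => eta eta0.
pose b := `|s0|.
have cY : continuous (Y x0) by move=> s; exact: is_derive_continuous (dY s Ux0).
have [a a0 aP] := segment_bound b (line_continuous (Cr1_continuous CA) Ux0).
have [y y0 yP] := segment_bound b cY.
have [q q0 qP] := segment_bound b (line_continuous (CA.2 (v, 0)) Ux0).
pose L := n%:R * a.
have L0 : 0 <= L by rewrite mulr_ge0// ltW.
(* In this factor [(q + 1) * |h|] bounds the increment of A and y bounds Y; the 2 comes from the
   initial term [a + a] in Gronwall's inequality. *)
pose C := (2 + n%:R * (q + 1 + y)) * expR ((L + 1) * b).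
have C0 : 0 < C.
  rewrite mulr_gt0 ?expR_gt0// ltr_wpDr// mulr_ge0// ltW//.
  by rewrite addr_gt0// addr_gt0.
pose d := Num.min 1 (eta / C).
have d0 : 0 < d by rewrite lt_min ltr01 divr_gt0.
have d1 : d <= 1 by rewrite ge_min lexx.
have nA := tube_diff v b CA Ux0 d0.
have nY := near_line v (fundamental_tube b Ux0 d0).
have nU := near_line v (open_nbhs_nbhs (conj oU Ux0)).
apply: filterS3 nA nY nU => h hA hY hU; rewrite line_pair/=.
have [->|h0] := eqVneq h 0.
  by rewrite !scale0r add0r subrr subr0 !normr0 mulr0.
have Uh : U (h *: v + x0) by exact: hU.
have {}hY s : `|s| <= b -> `|Y (h *: v + x0) s - Y x0 s| <= d by exact: hY.
pose D s := Y (h *: v + x0) s - Y x0 s - h *: sensitivity v x0 s.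
pose dA s := 'D_(v, 0) A (x0, s).
pose dD s := Y (h *: v + x0) s *m A (h *: v + x0, s) - Y x0 s *m A (x0, s)
  - h *: (Y x0 s *m dA s + sensitivity v x0 s *m A (x0, s)).
have dDP t : `|t| <= b -> is_derive t (1 : R) D (dD t).
  move=> _; apply: is_deriveB; first by apply: is_deriveB; exact: dY.
  by apply: is_deriveZ; exact: sensitivity_derive.
have dh0 : 0 < d * `|h| by rewrite mulr_gt0// normr_gt0.
have D0 : `|D 0| <= d * `|h|.
  rewrite /D !Y0// subrr sub0r normrN.
  rewrite (_ : sensitivity v x0 0 = 0) ?scaler0 ?normr0 ?(ltW dh0)//.
  rewrite /sensitivity (_ : \matrix_(i, j) _ = 0) ?mul0mx//.
  by apply/matrixP => i j; rewrite !mxE (sensitivity_primitive v Ux0 i j).1.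
have c0 : 0 <= n%:R * (q + 1 + y) * (d * `|h|).
  by rewrite !mulr_ge0// ?(ltW d0)// !addr_ge0// ltW.
have dDle t : `|t| <= b -> `|dD t| <= L * `|D t| + 1 * (n%:R * (q + 1 + y) * (d * `|h|)).
  move=> tb.
  pose Dl := A (h *: v + x0, t) - A (x0, t).
  have Dle : `|Dl| <= (q + 1) * `|h|.
    rewrite -(subrK (h *: dA t) Dl) addrC mulrDl mul1r.
    apply: le_trans (ler_normD _ _) _; apply: lerD.
      by rewrite normrZ mulrC ler_wpM2r//; exact: qP.
    apply: le_trans (hA t tb) _; rewrite -[leRHS]mul1r; exact: ler_wpM2r.
  have -> : dD t = D t *m A (x0, t) + ((Y (h *: v + x0) t - Y x0 t) *m Dl
      + Y x0 t *m (Dl - h *: dA t)).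
    rewrite /dD /D /Dl !mulmxBl !mulmxBr -!scalemxAl -!scalemxAr.
    move: (Y _ _ *m A _) (Y _ t *m A _) (Y _ t *m A _) (Y _ t *m A _).
    move: (sensitivity v x0 t *m _) (Y x0 t *m _) => *.
    by apply/matrixP => i j; rewrite !mxE; ring.
  rewrite mul1r; apply: le_trans (ler_normD _ _) _; apply: lerD.
    apply: (le_trans (mx_norm_mul _ _)); rewrite /L -mulrA ler_wpM2l//.
    by rewrite mulrC ler_wpM2r//; exact: aP.
  rewrite mulrDr mulrDl; apply: le_trans (ler_normD _ _) _; apply: lerD.
    apply: (le_trans (mx_norm_mul _ _)); rewrite -mulrA ler_wpM2l//.
    by rewrite [leRHS]mulrCA ler_pM//; exact: hY.
  apply: (le_trans (mx_norm_mul _ _)); rewrite -mulrA ler_wpM2l// ler_pM//; first exact: yP.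
  exact: hA.
have := gronwall_sym dDP L0 ltr01 c0 dh0 D0 dDle (lexx b).
rewrite -/(D s0) => /le_trans; apply.
apply: (@le_trans _ _ (d * C * `|h|)).
  rewrite le_eqVlt; apply/orP; left; apply/eqP.
  by rewrite /C /b; ring.
by rewrite ler_wpM2r// -ler_pdivlMr// ge_min lexx orbT.
Qed.

Lemma fundamental_Cr1 : Cr 1 O (fun p => Y p.1 p.2).
Proof.
apply: (Cr1_partials fr oO (g := fun i p => match i with
  | inl j => sensitivity (delta_mx 0 j) p.1 p.2 | inr _ => Y p.1 p.2 *m A p end)).
- move=> [j|j] [x0 s0] [/= Ux0 _]; first exact: fundamental_derive.
  apply/is_derive_epsP => eta eta0.
  have /is_derive_epsP/(_ eta eta0) := dY s0 Ux0.
  by apply: filterS => h; rewrite line_pair2.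
- move=> [j|j]; first exact: sensitivity_continuous.
  apply: (Crb_mulmx fr (b := false) oO); first exact: fundamental_continuous.
  exact: Cr1_continuous CA.
Qed.

End FundamentalMatrix.

End ParameterDependence.

(** * Curves on an embedded cylinder *)

Section Lifting.
Variables (R : realType) (k n : nat).
Local Notation P := ('rV[R]_k * R)%type.
Local Notation fr := (frame_prod R k).

Lemma pair_normE (p : P) : `|p| = Num.max `|p.1| `|p.2|.
Proof. by []. Qed.

Lemma norm_fst_le (p : P) : `|p.1| <= `|p|.
Proof. by rewrite pair_normE le_max lexx. Qed.

Lemma ball_compact (r : R) : compact [set v : 'rV[R]_k | `|v| <= r].
Proof.
apply: bounded_closed_compact.
  by exists r; split; [exact: num_real|move=> s rs v Bv; exact: le_trans (ltW rs)].
apply: (@closed_comp _ _ (fun v : 'rV[R]_k => `|v|) [set s : R | s <= r]).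
  by move=> v _; exact: norm_continuous.
exact: closed_le.
Qed.

(** The constant is the minimum of [|L v|] on the unit sphere, which is compact. *)
Lemma injective_lower_bound (W : normedModType R) (L : {linear P -> W}) :
  injective L -> exists2 c : R, 0 < c & forall v, c * `|v| <= `|L v|.
Proof.
move=> injL; pose S := [set v : P | `|v| = 1].
have cS : compact S.
  have -> : S = S `&` ([set v : 'rV[R]_k | `|v| <= 1] `*` `[-1, 1]%classic).
    apply/seteqP; split=> v; last by case.
    move=> Sv; split=> //; rewrite /S/= pair_normE in Sv.
    split; first by rewrite /= -Sv le_max lexx.
    by rewrite /= in_itv/= -ler_norml -Sv le_max lexx orbT.
  rewrite setIC; apply: compact_closedI.
    by apply: compact_setX; [exact: ball_compact|exact: segment_compact].
  apply: (@closed_comp _ _ (fun v : P => `|v|) [set 1]).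
    by move=> v _; exact: norm_continuous.
  exact: closed_eq.
have S01 : S (0, 1) by rewrite /S/= pair_normE/= normr0 normr1 max_r.
have cL : {within S, continuous (fun v => `|L v|)}.
  have cL0 : continuous L := @frame_linear_continuous R _ _ _ _ fr _ L.
  apply: continuous_subspaceT => v; have cLv := cL0 v.
  by apply: continuous_comp cLv _; exact: norm_continuous.
have [|v0 Sv0 minv0] := compact_EVT_min _ cS cL; first by exists (0, 1).
have v00 : v0 != 0.
  by apply/eqP => v0E; move: Sv0; rewrite inE /S/= v0E normr0 => /eqP; rewrite eq_sym oner_eq0.
exists `|L v0|.
  by rewrite normr_gt0; apply: contra v00 => /eqP Lv0; apply/eqP/injL; rewrite Lv0 linear0.
move=> v; have [->|vn0] := eqVneq v 0; first by rewrite normr0 mulr0.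
have nv : 0 < `|v| by rewrite normr_gt0.
have Sv : `|v|^-1 *: v \in S.
  by rewrite inE /S/= normrZ normfV normr_id mulVf// gt_eqF.
have := minv0 _ Sv; rewrite linearZ normrZ normfV normr_id => h.
by rewrite -ler_pdivlMr// mulrC.
Qed.

(** Here p is only known to be continuous. Since ['d G] is bounded below, the error
    [Y = p (t0 + h) - p t0 - h *: X] is controlled by the expansions of z and of G; the part of the
    latter that is proportional to [|Y|] is absorbed. *)
Lemma lift_derive (G : P -> 'rV[R]_n) (p : R -> P) (z : R -> 'rV[R]_n) (t0 : R) (X : P) :
  differentiable G (p t0) -> injective ('d G (p t0)) ->
  {for t0, continuous p} -> (\forall t \near t0, z t = G (p t)) ->
  is_derive t0 (1 : R) z ('d G (p t0) X) ->
  is_derive t0 (1 : R) p X.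
Proof.
move=> dG injG cp zG dz.
set p0 := p t0 in dG injG dz *; set L := 'd G p0 in injG dz.
have [c c0 cP] := injective_lower_bound injG.
apply/is_derive_epsP => e e0.
pose X1 := `|X| + 1.
have X10 : 0 < X1 by rewrite ltr_wpDl.
(* The first bound absorbs [e1 * |Y|] into half of [c * |Y|]; the second makes the rest of
   [e1 * |D|] equal at most a quarter of [e * c * |h|]. *)
pose e1 := Num.min (c / 2) (e * c / (4 * X1)).
have e10 : 0 < e1 by rewrite lt_min !divr_gt0// ?mulr_gt0.
have e20 : 0 < e * c / 4 by rewrite !(divr_gt0, mulr_gt0).
have Gp := (is_diff_epsP _ _ (diff_continuous dG)).1 (differentiableP dG) e1 e10.
have line : (h *: 1 + t0) @[h --> (0 : R)] --> t0.
  have : (h *: 1 + t0) @[h --> (0 : R)] --> (0 *: 1 + t0 : R).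
    by apply: cvgD; [apply: cvgZr_tmp; exact: cvg_id|exact: cvg_cst].
  by rewrite scale0r add0r.
have pp : (p (h *: 1 + t0) - p0) @[h --> (0 : R)] --> (0 : P).
  rewrite -(subrr p0); apply: cvgB; last exact: cvg_cst.
  by apply: cvg_comp line _; exact: cp.
have n1 : \forall h \near (0 : R), `|G (p (h *: 1 + t0)) - G p0 - L (p (h *: 1 + t0) - p0)|
    <= e1 * `|p (h *: 1 + t0) - p0|.
  have : \forall h \near (0 : R), `|G (p (h *: 1 + t0) - p0 + p0) - G p0 -
      L (p (h *: 1 + t0) - p0)| <= e1 * `|p (h *: 1 + t0) - p0| by exact: (pp _ Gp).
  by apply: filterS => h; rewrite subrK.
have n2 := (is_derive_epsP _ _ _ _).1 dz _ e20.
have n3 : \forall h \near (0 : R), z (h *: 1 + t0) = G (p (h *: 1 + t0)).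
  exact: (line _ zG).
have z0 : z t0 = G p0 by exact: nbhs_singleton zG.
apply: filterS3 n1 n2 n3 => h h1 h2 h3.
rewrite h3 z0 in h2.
set D := p (h *: 1 + t0) - p0 in h1 *; set Y := D - h *: X.
have LY : c * `|Y| <= e1 * `|D| + e * c / 4 * `|h|.
  apply: (le_trans (cP Y)).
  have -> : L Y = (G (p (h *: 1 + t0)) - G p0 - h *: L X) -
      (G (p (h *: 1 + t0)) - G p0 - L D).
    by rewrite /Y linearB linearZ/= opprB [RHS]addrC addrA subrK.
  by rewrite [leRHS]addrC; apply: (le_trans (ler_normB _ _)); apply: lerD.
have DY : `|D| <= `|Y| + `|h| * X1.
  rewrite -(subrK (h *: X) D) -/Y; apply: le_trans (ler_normD _ _) _.
  by rewrite lerD2l normrZ ler_wpM2l// lerDl.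
have e1c : e1 <= c / 2 by rewrite ge_min lexx.
have e1X : e1 * X1 <= e * c / 4.
  apply: (@le_trans _ _ (e * c / (4 * X1) * X1)).
    by rewrite ler_wpM2r ?(ltW X10)// ge_min lexx orbT.
  by rewrite le_eqVlt; apply/orP; left; apply/eqP; field; rewrite gt_eqF.
have h4 : e1 * `|D| <= c / 2 * `|Y| + e * c / 4 * `|h|.
  apply: (@le_trans _ _ (e1 * (`|Y| + `|h| * X1))); first by rewrite ler_wpM2l// ltW.
  rewrite mulrDr; apply: lerD; first by rewrite ler_wpM2r.
  by rewrite mulrCA mulrC ler_wpM2r.
have h5 : c / 2 * `|Y| <= c / 2 * (e * `|h|).
  have : c / 2 * (e * `|h|) = e * c / 4 * `|h| + e * c / 4 * `|h| by field.
  have : c * `|Y| = c / 2 * `|Y| + c / 2 * `|Y| by field.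
  by lra.
by rewrite -(ler_pM2l (_ : 0 < c / 2)) ?divr_gt0.
Qed.

Lemma int_mul2pi_small (j : int) : `|j%:~R * (2 * pi)| < 2 * (pi : R) -> j = 0.
Proof.
have p0 : 0 < 2 * (pi : R) by rewrite mulr_gt0// pi_gt0.
rewrite normrM (gtr0_norm p0) gtr_pMl// -intr_norm -[1]/(1%:~R) ltr_int.
by case: j => [[|m]|m].
Qed.

(** The coordinates q are chosen separately at each time, so their phase may jump by multiples of
    [2 * pi]. Correcting it to the branch near the phase at t0 gives a curve p that is continuous at
    t0, because the inverse embedding is, and [lift_derive] applies. *)
Lemma embedding_lift r (U : set 'rV[R]_k) (G : P -> 'rV[R]_n) (q : R -> P)
    (z : R -> 'rV[R]_n) (t0 : R) (X : P) :
  embedding r.+1 U G -> (\forall t \near t0, U (q t).1 /\ z t = G (q t)) ->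
  is_derive t0 (1 : R) z ('d G (q t0) X) ->
  exists p : R -> P, [/\ p t0 = q t0, is_derive t0 (1 : R) p X &
    forall t, exists j : int, p t = ((q t).1, (q t).2 + j%:~R * (2 * pi))].
Proof.
move=> emb nq dz; have [Uq0 zq0] := nbhs_singleton nq.
have [dG _] := embedding_smooth emb.
(* Branches are [2 * pi] apart, so at most one lies within distance 1 of the phase at t0. Where
   there is none, [xget] returns 0, which does not affect the behaviour near t0. *)
pose J t := [set j : int | `|(q t).2 + j%:~R * (2 * pi) - (q t0).2| < 1].
pose p t : P := ((q t).1, (q t).2 + (xget 0 (J t))%:~R * (2 * pi)).
have pi2 : 2 <= (pi : R) by exact: pi_ge2.
have uniqJ t (j j' : int) : J t j -> J t j' -> j = j'.
  rewrite /J/= => h h'; apply/eqP; rewrite -subr_eq0; apply/eqP/int_mul2pi_small.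
  rewrite rmorphB/= mulrBl.
  move: h h'; rewrite !ltr_norml => /andP[h1 h2] /andP[h3 h4].
  by apply/andP; split; lra.
have p0 : p t0 = q t0.
  have J0 : J t0 0 by rewrite /J/= mul0r addr0 subrr normr0.
  have JE : xget 0 (J t0) = 0 by apply: (uniqJ t0) => //; exact: (xgetI 0 J0).
  by rewrite /p JE mul0r addr0 -surjective_pairing.
exists p; split=> //; last by move=> t; exists (xget 0 (J t)).
have dGp : differentiable G (p t0) by apply: dG; split=> //; rewrite p0.
have injG : injective ('d G (p t0)) by rewrite p0; exact: embedding_immersion emb _ Uq0.
have cp : {for t0, continuous p}.
  apply/cvgrPdist_lt => d d0.
  pose d1 := Num.min d 1.
  have d10 : 0 < d1 by rewrite lt_min d0 ltr01.
  have [e e0 eP] := embedding_inverse_continuous emb (q t0).2 Uq0 d10.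
  have /cvgrPdist_lt/(_ e e0) : {for t0, continuous z} by exact: is_derive_continuous dz.
  apply: filterS2 nq => t [Uqt zqt] ze.
  have [] := eP (q t).1 (q t).2 Uqt.
    rewrite -!surjective_pairing -zqt -zq0 distrC; exact: ze.
  move=> x_close [j j_close].
  have Jj : J t j.
    by apply: (lt_le_trans j_close); rewrite ge_min lexx orbT.
  have jE : xget 0 (J t) = j by apply: (uniqJ t) => //; exact: (xgetI 0 Jj).
  have d1d : d1 <= d by rewrite ge_min lexx.
  rewrite p0 distrC pair_normE gt_max /p jE/=.
  by rewrite (lt_le_trans x_close)//= (lt_le_trans j_close).
have zp : \forall t \near t0, z t = G (p t).
  apply: filterS nq => t [Uqt ->]; rewrite [q t]surjective_pairing.
  by rewrite (periodic_int (f := fun s => G ((q t).1, s)))// => s; exact: embedding_periodic emb _ _ _.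
have dz' : is_derive t0 (1 : R) z ('d G (p t0) X) by rewrite p0.
exact: (lift_derive dGp injG cp zp dz').
Qed.

(** Near a point the immersion is expanding with constant [c / 2], and continuity of the inverse
    excludes points of the image that are close in R^n but far in the parameters. Smallness is
    expressed by [* M <= 1] so that the property is monotone in M and [compact_uniform] applies. *)
Lemma embedding_inverse_lipschitz (U K : set 'rV[R]_k) (G : P -> 'rV[R]_n) :
  open U -> embedding 2 U G -> compact K -> K `<=` U ->
  exists2 M : R, 0 < M & forall xi p, K xi -> U p.1 ->
    `|G p - G (xi, 0)| * M <= 1 -> `|p.1 - xi| <= M * `|G p - G (xi, 0)|.
Proof.
move=> oU emb cK KU.
have [dG cdG] := embedding_smooth emb.
have oO := open_cylinder oU.
have [||M M0 MP] := @compact_uniform R _ K (fun M xi => 0 <= M /\ forall p, U p.1 ->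
    `|G p - G (xi, 0)| * M <= 1 -> `|p.1 - xi| <= M * `|G p - G (xi, 0)|) cK.
- move=> M M' xi MM' [M0 MP]; split; first exact: le_trans MM'.
  move=> p Up pM; apply: le_trans (MP p Up _) _; last by rewrite ler_wpM2r.
  by apply: le_trans pM; rewrite ler_wpM2l.
- move=> xi0 /KU Uxi0; set p0 : P := (xi0, 0); set L := 'd G p0.
  have Op0 : (U `*` [set: R]) p0 by split.
  have [c c0 cP] := injective_lower_bound (embedding_immersion emb (p := p0) Uxi0).
  have c20 : 0 < c / 2 by rewrite divr_gt0.
  have /nbhs_ballP[rho/= rho0 rhoP] :=
    Cr1_diff_near fr oO (Cr2_Cr1 (embedding_smooth emb)) Op0 c20.
  have lower p q : ball p0 rho p -> ball p0 rho q -> c / 2 * `|p - q| <= `|G p - G q|.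
    move=> bp bq.
    have : `|G p - G q - L (p - q)| <= c / 2 * `|p - q|.
      apply: segment_taylor => s /andP[s0 s1].
      set w := s *: (p - q) + q.
      have bw : ball p0 rho w.
        rewrite -ball_normE/=.
        have -> : p0 - w = s *: (p0 - p) + (1 - s) *: (p0 - q).
          rewrite /w opprD -scalerN opprB addrCA scalerBl scale1r.
          rewrite [RHS]addrCA -scalerBr opprB [_ - p + _]addrC subrKA.
          by rewrite [RHS]addrC.
        apply: le_lt_trans (ler_normD _ _) _; rewrite !normrZ !ger0_norm ?subr_ge0//.
        move: bp bq; rewrite -!ball_normE/= => bp bq.
        have [->|sn0] := eqVneq s 0; first by rewrite mul0r add0r subr0 mul1r.
        have : s * `|p0 - p| < s * rho by rewrite ltr_pM2l// lt0r sn0.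
        have : (1 - s) * `|p0 - q| <= (1 - s) * rho.
          by rewrite ler_wpM2l ?subr_ge0// ltW.
        by lra.
      have [Ow _] := rhoP w bw; have dGw := dG w Ow.
      by split=> //; exact: (rhoP w bw).2.
    have := cP (p - q); have := lerB_dist (L (p - q)) (G p - G q).
    rewrite [`|L _ - _|]distrC.
    have : c * `|p - q| = c / 2 * `|p - q| + c / 2 * `|p - q| by field.
    by rewrite -/L; lra.
  have [e e0 eP] := embedding_inverse_continuous emb 0 Uxi0 rho0.
  (* The term [2 / c] is the local Lipschitz constant; [4 / e] forces [|G p - G (xi, 0)| < e / 2],
     which leaves room for moving xi0 to xi. *)
  exists (2 / c + 4 / e).
  have e20 : 0 < e / 2 by rewrite divr_gt0.
  have near1 : \forall xi \near xi0, ball p0 rho (xi, 0).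
    apply: filterS (@nbhsx_ballx _ _ xi0 rho rho0) => xi xib.
    by split=> //=; exact: ballxx.
  have near2 : \forall xi \near xi0, `|G p0 - G (xi, 0)| < e / 2.
    have /cvgrPdist_lt/(_ _ e20) nG := differentiable_continuous (dG p0 Op0).
    have : (xi, 0 : R) @[xi --> xi0] --> p0.
      move=> S [[B1 B2] /= [nB1 nB2] BS]; apply: filterS nB1 => xi' B1xi'; apply: BS.
      by split=> //=; exact: nbhs_singleton.
    by move=> /(_ _ nG).
  apply: filterS2 near1 near2 => xi bxi xie.
  have M0 : 0 <= 2 / c + 4 / e by rewrite addr_ge0// divr_ge0// ltW.
  split=> // p Up pM.
  have pe : `|G p - G (xi, 0)| < e / 2.
    rewrite ltNge; apply/negP => h.
    have : e / 2 * (2 / c + 4 / e) <= 1 by apply: le_trans pM; rewrite ler_wpM2r.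
    have -> : e / 2 * (2 / c + 4 / e) = e / c + 2 by field; rewrite !gt_eqF.
    have ec : 0 < e / c by rewrite divr_gt0.
    by lra.
  have Gpp0 : `|G (p.1, p.2) - G (xi0, 0)| < e.
    rewrite -surjective_pairing -(subrK (G (xi, 0)) (G p)) -addrA.
    apply: le_lt_trans (ler_normD _ _) _.
    by move: xie; rewrite distrC -/p0; lra.
  have [px [j pj]] := eP p.1 p.2 Up Gpp0.
  pose p' : P := (p.1, p.2 + j%:~R * (2 * pi)).
  have Gp' : G p' = G p.
    rewrite [p in RHS]surjective_pairing.
    rewrite (periodic_int (f := fun s => G (p.1, s)))// => s; exact: embedding_periodic emb _ _ _.
  have bp' : ball p0 rho p'.
    rewrite -ball_normE/= distrC pair_normE gt_max; apply/andP; split; first exact: px.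
    by exact: pj.
  have := lower _ _ bp' bxi; rewrite Gp' -ler_pdivlMl ?divr_gt0// => h.
  apply: (@le_trans _ _ `|p' - (xi, 0)|); first exact: (norm_fst_le (p' - (xi, 0))).
  apply: (le_trans h); rewrite invf_div ler_wpM2r// lerDl divr_ge0// (ltW e0) //=.
by exists M => // xi p Kxi; have [_] := MP xi Kxi; exact.
Qed.

End Lifting.

(** * Floquet theory of the family of periodic orbits *)

Section CrPairs.
Variables (R : realType) (V : normedModType R) (I : finType).
Variables (e : I -> V) (c : I -> V -> R).
Hypothesis fr : frame e c.
Implicit Types (W : normedModType R).

Lemma Cr1_pair W W' (A : set V) (f : V -> W) (g : V -> W') : open A ->
  Cr 1 A f -> Cr 1 A g -> Cr 1 A (fun q => (f q, g q)).
Proof.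
move=> oA [df cdf] [dg cdg].
apply: (Cr1_intro (G := fun v q => ('D_v f q, 'D_v g q))) => //.
- by move=> q Aq; apply: differentiable_pair; [exact: df|exact: dg].
- move=> v q Aq; have fq := df q Aq; have gq := dg q Aq.
  by rewrite diff_pair// !deriveE.
- move=> v q Aq S [[B1 B2] /= [nB1 nB2] BS].
  have h1 : \forall q' \near q, B1 ('D_v f q') by exact: cdf nB1.
  have h2 : \forall q' \near q, B2 ('D_v g q') by exact: cdg nB2.
  by apply: filterS2 h1 h2 => q' Bq1 Bq2; apply: BS.
Qed.

Lemma Cr1_linear W (A : set V) (L : {linear V -> W}) : open A -> Cr 1 A L.
Proof.
move=> oA; have cL := @frame_linear_continuous R _ _ _ _ fr _ L.
apply: (Cr1_intro (G := fun v q => L v)) => //.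
- by move=> q Aq; exact: linear_differentiable.
- by move=> v q Aq; rewrite diff_lin.
- by move=> v q Aq; exact: cst_continuous.
Qed.

End CrPairs.

Section ChainRule.
Variable R : realType.
Implicit Types V W Z : normedModType R.

Lemma is_derive_unique V W (f : V -> W) x v d d' :
  is_derive x v f d -> is_derive x v f d' -> d = d'.
Proof. by move=> [_ <-] [_ <-]. Qed.

Lemma is_derive_chain V W Z (f : V -> W) (g : W -> Z) x v :
  differentiable f x -> differentiable g (f x) ->
  is_derive x v (g \o f) ('d g (f x) ('d f x v)).
Proof.
move=> fx gx; have gfx : differentiable (g \o f) x by exact: differentiable_comp.
by apply: DeriveDef; [exact: diff_derivable|rewrite deriveE// diff_comp].
Qed.

End ChainRule.

(** * Uniqueness for linear differential equations *)

Section LinearODE.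
Variables (R : realType) (m n : nat).

(** Gronwall's inequality asks for a positive initial bound; it is taken as [b / (2 * C)] with b
    arbitrary. *)
Lemma linear_ode_zero (D : R -> 'M[R]_(m, n)) (A : R -> 'M[R]_n) (t0 : R) :
  continuous A -> (forall t, is_derive t (1 : R) D (D t *m A t)) -> D t0 = 0 ->
  forall t, D t = 0.
Proof.
move=> cA dD D0 t.
pose E s := D (1 * s + t0); pose dE s := 1 *: (D (1 * s + t0) *m A (1 * s + t0)).
have dEP s : is_derive s (1 : R) E (dE s) by apply: is_derive_reparam; exact: dD.
have cA' : continuous (fun s : R => A (1 * s + t0)).
  move=> s; apply: (@continuous_comp _ _ _ (fun s : R => 1 * s + t0) A); last exact: cA.
  apply: continuousD; last exact: cst_continuous.
  by apply: continuousM; [exact: cst_continuous|exact: cvg_id].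
have [a a0 aP] := segment_bound `|t - t0| cA'.
have L0 : 0 <= n%:R * a by rewrite mulr_ge0// ltW.
have dEle s : `|s| <= `|t - t0| -> `|dE s| <= n%:R * a * `|E s| + 1 * 0.
  move=> st; rewrite mulr0 addr0 /dE scale1r; apply: (le_trans (mx_norm_mul _ _)).
  by rewrite -mulrA ler_wpM2l// mulrC ler_wpM2r// aP.
apply/eqP; rewrite -normr_le0; apply/ler_addgt0Pr => b b0; rewrite add0r.
pose C := expR ((n%:R * a + 1) * `|t - t0|).
have C0 : 0 < C by exact: expR_gt0.
have b20 : 0 < b / (2 * C) by rewrite divr_gt0// mulr_gt0.
have E0 : `|E 0| <= b / (2 * C) by rewrite /E mulr0 add0r D0 normr0 ltW.
have := gronwall_sym (fun s _ => dEP s) L0 ltr01 (lexx 0) b20 E0 dEle (lexx _).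
rewrite /E mul1r subrK addr0 => /le_trans; apply.
rewrite -/C le_eqVlt; apply/orP; left; apply/eqP; field.
by rewrite gt_eqF.
Qed.

Lemma linear_ode_unique (D D' : R -> 'M[R]_(m, n)) (A : R -> 'M[R]_n) (t0 : R) :
  continuous A -> (forall t, is_derive t (1 : R) D (D t *m A t)) ->
  (forall t, is_derive t (1 : R) D' (D' t *m A t)) -> D t0 = D' t0 ->
  forall t, D t = D' t.
Proof.
move=> cA dD dD' DD' t; apply/eqP; rewrite -subr_eq0; apply/eqP.
apply: (@linear_ode_zero (fun t => D t - D' t) A t0) => //; last by rewrite DD' subrr.
by move=> s; rewrite mulmxBl; apply: is_deriveB.
Qed.

Lemma is_derive_mulmxl p (M : 'M[R]_(p, m)) (D : R -> 'M[R]_(m, n)) t d :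
  is_derive t (1 : R) D d -> is_derive t (1 : R) (fun t => M *m D t) (M *m d).
Proof.
move=> dD; have := is_derive_mulmx (is_derive_cst M t 1) dD.
by rewrite mul0mx add0r.
Qed.

End LinearODE.

(** * The variational equation with the phase as independent variable *)

Section Floquet.
Variables (R : realType) (k n : nat) (F0 F1 : 'rV[R]_n -> 'rV[R]_n) (U : set 'rV[R]_k).
Variables (G : 'rV[R]_k * R -> 'rV[R]_n) (w : 'rV[R]_k -> R) (per : R).
Variables (gamma0 : 'rV[R]_k -> R -> 'rV[R]_n) (Phi : 'rV[R]_k -> R -> R -> 'M[R]_n).
Local Notation P := ('rV[R]_k * R)%type.
Local Notation O := (U `*` [set: R]).
Local Notation frP := (frame_prod R k).
Hypothesis CF0 : Cr 2 setT F0.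
Hypothesis CF1 : Cr 1 setT F1.
Hypothesis oU : open U.
Hypothesis per_gt0 : 0 < per.
Hypothesis w_gt0 : forall x, U x -> 0 < w x.
Hypothesis Cw : Cr 1 U w.
Hypothesis CG : Cr 2 O G.
Hypothesis G_periodic : forall x s, U x -> G (x, s + per) = G (x, s).
Hypothesis G_immersion : forall p, U p.1 -> injective ('d G p).
Hypothesis G_gamma : forall x t, U x -> G (x, w x * t) = gamma0 x t.
Hypothesis gamma_solution :
  forall x t, U x -> is_derive t (1 : R) (gamma0 x) (F0 (gamma0 x t)).
Hypothesis tm : transition_matrix F0 U gamma0 Phi.
Let oO : open O := open_cylinder oU.
Let G_Cr1 : Cr 1 O G := Cr2_Cr1 CG.

Lemma w_neq0 x : U x -> w x != 0.
Proof. by move=> /w_gt0; rewrite lt0r => /andP[]. Qed.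

Fact dG_subproof : {dG : P -> P -> 'rV[R]_n | forall p v, dG p v = 'd G p v}.
Proof. by exists (fun p v => 'd G p v). Qed.

(* An opaque copy of the differential, which unification cannot unfold. *)
Definition dG := sval dG_subproof.

Lemma dGE p v : dG p v = 'd G p v.
Proof. exact: (svalP dG_subproof). Qed.

Lemma dG_split p v r : dG p (v, r) = dG p (v, 0) + r *: dG p (0, 1).
Proof.
rewrite !dGE -linearZ -linearD; congr ('d G _ _); congr (_, _).
  by rewrite [X in _ + X]scaler0 addr0.
by rewrite add0r [RHS]mulr1.
Qed.

Lemma dG_phase p r : dG p (0, r) = r *: dG p (0, 1).
Proof.
rewrite !dGE -linearZ; congr ('d G _ _); congr (_, _).
  by rewrite [RHS]scaler0.
by rewrite [RHS]mulr1.
Qed.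

Lemma G_differentiable x s : U x -> differentiable G (x, s).
Proof. by move=> Ux; apply: G_Cr1.1. Qed.

Definition jacobian_on (p : P) : 'M[R]_n := 'J F0 (G p).
(** Dividing by the frequency gives the variational equations of all orbits the common period [per],
    so that x is a mere parameter of the coefficients. *)
Definition phase_jacobian (p : P) : 'M[R]_n := (w p.1)^-1 *: jacobian_on p.

Lemma jacobian_on_Cr1 : Cr 1 O jacobian_on.
Proof.
apply/(Crb_mxP frP true _ oO) => i j.
apply: (@Crb_eq _ _ true _ _ (fun p => ('D_(delta_mx 0 i) F0 (G p)) 0 j)) => // [p Op|].
  by rewrite /jacobian_on /jacobian mxE deriveE//; exact: CF0.1.
have CDF : Cr 1 O (fun p => 'D_(delta_mx 0 i) F0 (G p)).
  exact: (Cr1_comp frP (frame_rV R n) (B := setT) (f := G)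
    (g := 'D_(delta_mx 0 i) F0) oO (fun _ _ => I) G_Cr1 (CF0.2 _)).
by move/(Crb_mxP frP true _ oO) : CDF; exact.
Qed.

Lemma w_fst_Cr1 : Cr 1 O (fun p => w p.1).
Proof.
have Cfst : Cr 1 O (fst : P -> 'rV[R]_k) by exact: (Cr1_linear frP _ oO).
exact: (Cr1_comp frP (frame_rV R k) (f := fst) (g := w) oO (fun p Op => Op.1) Cfst Cw).
Qed.

Lemma phase_jacobian_Cr1 : Cr 1 O phase_jacobian.
Proof.
apply: (Crb_scale frP (b := true) oO); last exact: jacobian_on_Cr1.
apply: (Crb_inv frP (b := true) oO); last exact: w_fst_Cr1.
by move=> p [Up _]; exact: w_neq0.
Qed.

Lemma phase_jacobian_periodic x s : U x -> phase_jacobian (x, s + per) = phase_jacobian (x, s).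
Proof. by move=> Ux; rewrite /phase_jacobian /jacobian_on/= G_periodic. Qed.

Lemma phase_jacobian_continuous x : U x -> continuous (fun s => phase_jacobian (x, s)).
Proof. by move=> Ux; apply: (line_continuous (Cr1_continuous phase_jacobian_Cr1)). Qed.

Definition flow_mx (x : 'rV[R]_k) (s : R) : 'M[R]_n := Phi x ((w x)^-1 * s) 0.
Definition flow_inv (x : 'rV[R]_k) (s : R) : 'M[R]_n := Phi x 0 ((w x)^-1 * s).

Lemma flow_mx0 x : U x -> flow_mx x 0 = 1%:M.
Proof. by move=> Ux; rewrite /flow_mx mulr0; have [] := tm Ux 0. Qed.

Lemma flow_mx_derive x s : U x -> is_derive s (1 : R) (flow_mx x) (flow_mx x s *m phase_jacobian (x, s)).
Proof.
move=> Ux; have [_ dPhi] := tm Ux 0.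
have AE : phase_jacobian (x, s) = (w x)^-1 *: 'J F0 (gamma0 x ((w x)^-1 * s)).
  have E : G (x, s) = gamma0 x ((w x)^-1 * s) by rewrite -G_gamma// mulVKf// w_neq0.
  by rewrite /phase_jacobian /jacobian_on E.
have := @is_derive_reparam R _ (fun t => Phi x t 0) (w x)^-1 0 s _ (dPhi _).
rewrite addr0 (_ : (fun u => Phi x _ 0) = flow_mx x); last first.
  by apply/funext => u; rewrite /flow_mx addr0.
by rewrite AE -scalemxAr.
Qed.

(** With [t1 = (w x)^-1 * s], the functions [Phi x t1 0 *m Phi x t t1] and [Phi x t 0] of t solve
    the same equation and agree at t1; evaluate at t = 0. *)
Lemma YZ x s : U x -> flow_mx x s *m flow_inv x s = 1%:M.
Proof.
move=> Ux; set t1 := (w x)^-1 * s.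
pose A t := 'J F0 (gamma0 x t).
have cA : continuous A.
  have -> : A = (fun t => jacobian_on (x, w x * t)) by apply/funext => t; rewrite /jacobian_on G_gamma.
  move=> t; have cJ := line_continuous (Cr1_continuous jacobian_on_Cr1) Ux.
  apply: (@continuous_comp _ _ _ (fun t => w x * t) (fun s => jacobian_on (x, s))); last exact: cJ.
  by apply: continuousM; [exact: cst_continuous|exact: cvg_id].
have [P0 dP0] := tm Ux 0; have [P1 dP1] := tm Ux t1.
have := @linear_ode_unique R n n (fun t => Phi x t1 0 *m Phi x t t1) (fun t => Phi x t 0) A t1 cA.
move=> /(_ _ dP0 _ 0); rewrite P0; apply; last by rewrite P1 mulmx1.
by move=> t; rewrite -mulmxA; exact: is_derive_mulmxl.
Qed.

Lemma flow_mx_Cr1 : Cr 1 O (fun p => flow_mx p.1 p.2).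
Proof. exact: (fundamental_Cr1 oU phase_jacobian_Cr1 flow_mx0 (fun x s => @flow_mx_derive x s) YZ). Qed.

Lemma flow_inv_Cr1 : Cr 1 O (fun p => flow_inv p.1 p.2).
Proof.
apply: (Crb_inverse frP (b := true) oO (M := fun p => flow_mx p.1 p.2)); last exact: flow_mx_Cr1.
by move=> p [Up _]; exact: YZ.
Qed.

(** The transition matrix is given by an equation in its final time only; the derivative in the
    initial time comes from differentiating [YZ]. *)
Lemma flow_inv_derive x s : U x -> is_derive s (1 : R) (flow_inv x) (- phase_jacobian (x, s) *m flow_inv x s).
Proof.
move=> Ux.
have dZ : is_derive s (1 : R) (flow_inv x) ('D_(0, 1) (fun p => flow_inv p.1 p.2) (x, s)).
  have Zxs : is_derive (x, s) (0 : 'rV[R]_k, 1 : R) (fun p => flow_inv p.1 p.2)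
      ('D_(0, 1) (fun p => flow_inv p.1 p.2) (x, s)).
    by apply/derivableP/diff_derivable; apply: flow_inv_Cr1.1.
  apply/is_derive_epsP => e e0; have /is_derive_epsP/(_ e e0) := Zxs.
  by apply: filterS => h; rewrite line_pair2.
have dYZ := is_derive_mulmx (flow_mx_derive s Ux) dZ.
have : is_derive s (1 : R) (fun s => flow_mx x s *m flow_inv x s) 0.
  rewrite (_ : (fun s => _) = cst 1%:M); first exact: is_derive_cst.
  by apply/funext => u; rewrite YZ.
move=> [_ E1]; have [_ E2] := dYZ; rewrite E1 in E2.
have E3 : flow_mx x s *m 'D_(0, 1) (fun p => flow_inv p.1 p.2) (x, s) =
    - (flow_mx x s *m phase_jacobian (x, s) *m flow_inv x s).
  by apply/eqP; rewrite -addr_eq0 addrC -E2.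
have -> : - phase_jacobian (x, s) *m flow_inv x s = 'D_(0, 1) (fun p => flow_inv p.1 p.2) (x, s).
  rewrite -[RHS]mul1mx -(mulmx1C (YZ s Ux)) -mulmxA E3 mulmxN !mulmxA.
  by rewrite (mulmx1C (YZ s Ux)) mul1mx mulNmx.
exact: dZ.
Qed.

Lemma G_time_derivative x s : U x -> dG (x, s) (0, w x) = F0 (G (x, s)).
Proof.
move=> Ux; pose t := (w x)^-1 * s.
have sE : w x * t = s by rewrite mulVKf// w_neq0.
have dpath : is_derive t (1 : R) (fun u => (x, w x * u) : P) (0, w x).
  apply/is_derive_epsP => e e0; near=> h.
  rewrite [X in `|X|](_ : _ = 0) ?normr0 ?mulr_ge0 ?(ltW e0)//.
  congr (_, _); first by rewrite [X in _ - X]scaler0 subr0 [LHS]subrr.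
  rewrite -[LHS]/(w x * (h * 1 + t) - w x * t - h * w x); ring.
have dG1 : differentiable G (x, w x * t) by apply: G_Cr1.1.
have := is_derive_comp (p := fun u => (x, w x * u) : P) dpath dG1.
rewrite -dGE sE (_ : G \o _ = gamma0 x); last by apply/funext => u; rewrite /= G_gamma.
move=> H; rewrite (is_derive_unique H (gamma_solution t Ux)).
by rewrite -G_gamma// sE.
Unshelve. all: by end_near. Qed.

Lemma gamma_continuous_jacobian x : U x -> continuous (fun t => 'J F0 (gamma0 x t)).
Proof.
move=> Ux.
have -> : (fun t => 'J F0 (gamma0 x t)) = (fun t => jacobian_on (x, w x * t)).
  by apply/funext => t; rewrite /jacobian_on G_gamma.
move=> t; have cJ := line_continuous (Cr1_continuous jacobian_on_Cr1) Ux.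
apply: (@continuous_comp _ _ _ (fun t => w x * t) (fun s => jacobian_on (x, s))); last exact: cJ.
by apply: continuousM; [exact: cst_continuous|exact: cvg_id].
Qed.

Lemma jacobianE (v z : 'rV[R]_n) : 'd F0 z v = v *m 'J F0 z.
Proof. by rewrite /jacobian mul_rV_lin1. Qed.

(** The velocity of an orbit solves the variational equation along it. *)
Lemma field_variation x t : U x -> F0 (gamma0 x t) = F0 (gamma0 x 0) *m Phi x t 0.
Proof.
move=> Ux; have [P0 dP0] := tm Ux 0.
apply: (linear_ode_unique (t0 := 0) (gamma_continuous_jacobian Ux)
  (D := fun t => F0 (gamma0 x t)) (D' := fun t => F0 (gamma0 x 0) *m Phi x t 0)).
- move=> s; rewrite -jacobianE.
  have dF : differentiable F0 (gamma0 x s) by apply: CF0.1.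
  exact: (is_derive_comp (p := gamma0 x) (f := F0) (gamma_solution s Ux) dF).
- by move=> s; rewrite -mulmxA; exact: is_derive_mulmxl.
- by rewrite P0 mulmx1.
Qed.

(** * Transport of tangent vectors of M_0 *)

Definition time_orbits (p : P) : 'rV[R]_n := gamma0 p.1 p.2.
Definition phase_of_time (p : P) : P := (p.1, w p.1 * p.2).

Lemma phase_of_time_Cr1 : Cr 1 O phase_of_time.
Proof.
have Cfst : Cr 1 O (fst : P -> 'rV[R]_k) by exact: (Cr1_linear frP _ oO).
have Csnd : Cr 1 O (snd : P -> R) by exact: (Cr1_linear frP _ oO).
exact: (Cr1_pair oO Cfst (Crb_mul frP (b := true) oO w_fst_Cr1 Csnd)).
Qed.

Lemma time_orbits_phase_of_time p : U p.1 -> time_orbits p = G (phase_of_time p).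
Proof. by move=> Up; rewrite /time_orbits /phase_of_time G_gamma. Qed.

Lemma time_orbits_Cr1 : Cr 1 O time_orbits.
Proof.
apply: (@Crb_eq _ _ true _ _ (G \o phase_of_time)) oO _ _ => [p [Up _]|].
  by rewrite time_orbits_phase_of_time.
exact: (Cr1_comp frP frP (f := phase_of_time) (g := G) (B := O) oO (fun p Op => Op) phase_of_time_Cr1 G_Cr1).
Qed.

Lemma phase_of_time_derive v x t : U x -> ('d phase_of_time (x, t) (v, 0)).1 = v.
Proof.
move=> Ux.
have d1 : differentiable (fst : P -> 'rV[R]_k) (x, t) by apply: (Cr1_linear frP fst oO).1.
have dg : differentiable (fun p : P => w p.1 * p.2) (x, t).
  have Csnd : Cr 1 O (snd : P -> R) by exact: (Cr1_linear frP _ oO).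
  by apply: (Crb_mul frP (b := true) oO w_fst_Cr1 Csnd).1.
have -> : 'd phase_of_time (x, t) (v, 0) =
    ('d (fst : P -> 'rV[R]_k) (x, t) (v, 0), 'd (fun p : P => w p.1 * p.2) (x, t) (v, 0)).
  by rewrite -(congr1 (fun f => f (v, 0)) (diff_pair d1 dg)).
have cfst : continuous (fst : P -> 'rV[R]_k) by move=> p; exact: cvg_fst.
by rewrite /= diff_lin.
Qed.

(** The phase component c comes from the dependence of the frequency on x: at a fixed time,
    neighbouring orbits have reached different phases. *)
Lemma time_orbits_derive v x t : U x ->
  exists c, is_derive (x, t) (v, 0 : R) time_orbits (dG (x, w x * t) (v, c)).
Proof.
move=> Ux; have Oxt : O (x, t) by [].
have dG1 : differentiable G (phase_of_time (x, t)) by apply: G_Cr1.1.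
have dk : differentiable phase_of_time (x, t) by apply: phase_of_time_Cr1.1.
have := is_derive_chain (v, 0) dk dG1; rewrite -dGE.
have := phase_of_time_derive v t Ux; case: ('d phase_of_time _ _) => v' c /= -> H.
exists c; apply: near_eq_is_derive H.
by apply: filterS (open_nbhs_nbhs (conj oO Oxt)) => p [Up _]; rewrite time_orbits_phase_of_time.
Qed.

(* Differentiating the integral equation of the orbits avoids exchanging the
   derivatives in x and in t. *)
Lemma time_orbits_variation v x t : U x ->
  'D_(v, 0) time_orbits (x, t) = 'D_(v, 0) time_orbits (x, 0) *m Phi x t 0.
Proof.
move=> Ux; have [P0 dP0] := tm Ux 0.
pose f j (p : P) := F0 (time_orbits p) 0 j.
have CF : Cr 1 O (F0 \o time_orbits).
  exact: (Cr1_comp frP (frame_rV R n) (B := setT) oO (fun _ _ => I) time_orbits_Cr1 (Cr2_Cr1 CF0)).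
have Cf j : Cr 1 O (f j) by move/(Crb_mxP frP true _ oO) : CF => /(_ 0 j).
pose Ij j (x : 'rV[R]_k) t := gamma0 x t 0 j - gamma0 x 0 0 j.
have I0 j x' : U x' -> Ij j x' 0 = 0 by move=> _; rewrite /Ij subrr.
have dI j x' t' : U x' -> is_derive t' (1 : R) (Ij j x') (f j (x', t')).
  move=> Ux'; have /is_derive_mxP/(_ 0 j) dg := gamma_solution t' Ux'.
  by rewrite -[f j _]subr0; apply: is_deriveB; exact: dg.
pose D t := 'D_(v, 0) time_orbits (x, t).
have dGm s : derivable time_orbits (x, s) (v, 0) by apply/diff_derivable; apply: time_orbits_Cr1.1.
have DE j s : D s 0 j = D 0 0 j + primitive (fun u => 'D_(v, 0) (f j) (x, u)) s.
  have dIj := primitive_derive oU (Cf j) (I0 j) (fun x t => @dI j x t) v s Ux.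
  have dGs : is_derive (x, s) (v, 0 : R) (fun p => time_orbits p 0 j) (D s 0 j).
    by have /derivableP/is_derive_mxP/(_ 0 j) := dGm s.
  have dG0 : is_derive (x, s) (v, 0 : R) (fun p => gamma0 p.1 0 0 j) (D 0 0 j).
    have /derivableP/is_derive_mxP/(_ 0 j)/is_derive_epsP H := dGm 0.
    apply/is_derive_epsP => e e0; apply: filterS (H e e0) => h.
    by rewrite !line_pair.
  have [_ E1] := dIj.
  have [_ E2] : is_derive (x, s) (v, 0 : R) (fun p => Ij j p.1 p.2) (D s 0 j - D 0 0 j).
    exact: is_deriveB.
  by rewrite -E1 E2 addrC subrK.
have dD s : is_derive s (1 : R) D (D s *m 'J F0 (gamma0 x s)).
  apply/is_derive_mxP => i j; rewrite (ord1 i).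
  have -> : (fun y => D y 0 j) = (fun y => D 0 0 j + primitive (fun u => 'D_(v, 0) (f j) (x, u)) y).
    by apply/funext => y; rewrite DE.
  have -> : (D s *m 'J F0 (gamma0 x s)) 0 j = 'D_(v, 0) (f j) (x, s).
    have dFG : derivable (F0 \o time_orbits) (x, s) (v, 0) by apply/diff_derivable; apply: CF.1.
    have /derivableP/is_derive_mxP/(_ 0 j)[_ E] := dFG.
    rewrite [RHS]E deriveE; last by apply: CF.1.
    have dG : differentiable time_orbits (x, s) by apply: time_orbits_Cr1.1.
    have dF : differentiable F0 (time_orbits (x, s)) by apply: CF0.1.
    by rewrite diff_comp// /comp jacobianE -deriveE.
  have [_ dT] := primitive_partialP (Cf j) v Ux.
  have := is_deriveD (is_derive_cst (D 0 0 j) s 1) (dT s); rewrite add0r; exact.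
apply: (linear_ode_unique (t0 := 0) (gamma_continuous_jacobian Ux)
  (D := D) (D' := fun t => D 0 *m Phi x t 0)) => //.
- by move=> s; rewrite -mulmxA; exact: is_derive_mulmxl.
- by rewrite P0 mulmx1.
Qed.

Lemma phase_transport x s : U x ->
  dG (x, 0) (0, 1) *m flow_mx x s = dG (x, s) (0, 1).
Proof.
move=> Ux; have w0 := w_neq0 Ux.
have dE u : dG (x, u) (0, 1) = (w x)^-1 *: F0 (G (x, u)).
  by rewrite -G_time_derivative// dG_phase scalerA mulVf// scale1r.
have key : F0 (G (x, 0)) *m flow_mx x s = F0 (G (x, s)).
  have E0 : G (x, 0) = gamma0 x 0 by rewrite -G_gamma// mulr0.
  have Es : G (x, s) = gamma0 x ((w x)^-1 * s) by rewrite -G_gamma// mulVKf.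
  by rewrite E0 Es [RHS]field_variation.
by rewrite (dE 0) (dE s) -key scalemxAl.
Qed.

(** Transport preserves the x-component and shears the phase. Over a full period c need not vanish,
    so the monodromy may have a Jordan block on the tangent space. *)
Lemma tangent_transport v x s : U x ->
  exists c, dG (x, 0) (v, 0) *m flow_mx x s = dG (x, s) (v, c).
Proof.
move=> Ux; have w0 := w_neq0 Ux.
have [c0 [_ E0]] := time_orbits_derive v 0 Ux; have [c1 [_ E1]] := time_orbits_derive v ((w x)^-1 * s) Ux.
rewrite mulr0 dG_split in E0; rewrite (mulVKf w0) in E1.
exists (c1 - c0).
have := time_orbits_variation v ((w x)^-1 * s) Ux.
rewrite E0 E1 -/(flow_mx x s) mulmxDl -scalemxAl phase_transport// => E.
by rewrite dG_split scalerBl addrA -dG_split E [RHS]addrK.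
Qed.

(** Normal hyperbolicity at the base point of one orbit, sampled at whole periods and with the phase
    in place of time. *)
Hypothesis hyp : forall x, U x ->
  exists (Ns Nu : {vspace 'rV[R]_n}) (K a : R),
    let T := tangent_space G (x, 0) in
    [/\ 0 < a, (T + Ns + Nu)%VS = fullv & directv (T + Ns + Nu)%VS] /\
    [/\ forall v, v \in Ns -> v *m flow_mx x per \in Ns,
        forall v, v \in Nu -> v *m flow_mx x per \in Nu,
        forall v (j : nat), v \in Ns ->
          `|v *m flow_mx x (j%:R * per)| <= K * expR (- (a * j%:R)) * `|v| &
        forall v (j : nat), v \in Nu ->
          `|v *m flow_mx x (- (j%:R * per))| <= K * expR (- (a * j%:R)) * `|v|].

(** * Functionals fixed by the monodromy matrix *)

Definition monodromy x : 'M[R]_n := flow_mx x per.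

Lemma flow_mx_shift x s : U x -> flow_mx x (s + per) = monodromy x *m flow_mx x s.
Proof.
move=> Ux.
apply: (linear_ode_unique (t0 := 0) (phase_jacobian_continuous Ux)
  (D := fun s => flow_mx x (s + per)) (D' := fun s => monodromy x *m flow_mx x s)).
- move=> u; have := @is_derive_reparam R _ (flow_mx x) 1 per u _ (flow_mx_derive (1 * u + per) Ux).
  rewrite scale1r mul1r phase_jacobian_periodic// (_ : (fun s => _) = (fun s => flow_mx x (s + per))) //.
  by apply/funext => r; rewrite mul1r.
- by move=> u; rewrite -mulmxA; apply: is_derive_mulmxl; exact: flow_mx_derive.
- by rewrite add0r flow_mx0// mulmx1.
Qed.

Lemma monodromy_fix_iter x (c : 'cV[R]_n) : U x -> monodromy x *m c = c ->
  forall j : nat, flow_mx x (j%:R * per) *m c = c /\ flow_mx x (- (j%:R * per)) *m c = c.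
Proof.
move=> Ux Mc; elim=> [|j [IH1 IH2]]; first by rewrite mul0r oppr0 flow_mx0// mul1mx.
split; first by rewrite -natr1 mulrDl mul1r flow_mx_shift// -mulmxA IH1.
have E : - (j.+1%:R * per) + per = - (j%:R * per) by rewrite -natr1 mulrDl mul1r; ring.
have := flow_mx_shift (- (j.+1%:R * per)) Ux; rewrite E => E2.
have ZM := mulmx1C (YZ per Ux).
rewrite -[LHS]mul1mx -ZM -mulmxA [_ *m (_ *m c)]mulmxA -/(monodromy x) -E2 IH2.
by rewrite -[c in LHS]Mc mulmxA ZM mul1mx.
Qed.

(** A nonzero y is refuted by any j with [C < a * j * |y|], since [expR (a * j) >= 1 + a * j]. *)
Lemma exp_decay_zero (y a C : R) : 0 < a ->
  (forall j : nat, `|y| <= C * expR (- (a * j%:R))) -> y = 0.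
Proof.
move=> a0 H; apply/eqP; apply: contraT => y0.
have ny : 0 < `|y| by rewrite normr_gt0.
have C0 : 0 < C.
  by have := H 0%N; rewrite mulr0 oppr0 expR0 mulr1; exact: lt_le_trans.
pose j := (Num.truncn (C / (a * `|y|))).+1.
have jP : C / (a * `|y|) < j%:R by exact: truncnS_gt.
have := H j; rewrite expRN ler_pdivlMr ?expR_gt0// leNgt => /negP[].
rewrite ltr_pdivrMr ?mulr_gt0// in jP.
apply: (lt_le_trans jP).
rewrite [X in X <= _](_ : _ = `|y| * (a * j%:R)); last by ring.
rewrite ler_wpM2l//; apply: le_trans (expR_ge1Dx _).
by rewrite lerDr.
Qed.

Lemma dG_periodic x s q : U x -> dG (x, s + per) q = dG (x, s) q.
Proof.
move=> Ux.
have e1 : 'D_q G (x, s + per) = dG (x, s + per) q.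
  by rewrite dGE; apply: deriveE; exact: G_differentiable.
have e2 : 'D_q G (x, s) = dG (x, s) q.
  by rewrite dGE; apply: deriveE; exact: G_differentiable.
by rewrite -e1 -e2; exact: derive_periodic oU G_periodic _ _ Ux.
Qed.

Lemma eq_rV_mulmx m' m (A B : 'M[R]_(m', m)) : (forall z : 'rV[R]_m', z *m A = z *m B) -> A = B.
Proof. by move=> H; apply/row_matrixP => i; rewrite !rowE H. Qed.

Lemma tangentP x (z : 'rV[R]_n) : z \in tangent_space G (x, 0) ->
  exists v r, z = dG (x, 0) (v, r).
Proof.
move=> /memv_imgP[[v r] _ ->]; exists v, r.
by rewrite lfunE dGE.
Qed.

(** A functional fixed by the monodromy takes the same value at z and at all its iterates; for z
    stable the forward iterates, for z unstable the backward ones, tend to 0. So c vanishes on [Ns]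
    and [Nu] as well as on the tangent space. *)
Lemma fixed_functional_zero x (c : 'cV[R]_n) : U x ->
  (forall v r, dG (x, 0) (v, r) *m c = 0) -> monodromy x *m c = c -> c = 0.
Proof.
move=> Ux Tc Mc; have [Ns [Nu [K [a [[a0 full _] [_ _ ds du]]]]]] := hyp Ux.
have iter := monodromy_fix_iter Ux Mc.
have zero (z : 'rV[R]_n) (y : nat -> 'M[R]_n) :
    (forall j, y j *m c = c) -> (forall j, `|z *m y j| <= K * expR (- (a * j%:R)) * `|z|) ->
    z *m c = 0.
  move=> yc yd; apply/eqP; rewrite -normr_eq0; apply/eqP.
  apply: (@exp_decay_zero _ a (n%:R * (K * `|z| * `|c|)) a0) => j.
  rewrite normr_id -[c in leLHS](yc j) mulmxA; apply: (le_trans (mx_norm_mul _ _)).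
  rewrite -mulrA ler_wpM2l// mulrAC ler_wpM2r// mulrAC.
  exact: yd.
apply: eq_rV_mulmx => z; rewrite mulmx0.
have : z \in fullv by exact: memvf.
rewrite -full => /memv_addP[u /memv_addP[t tT [s sNs ->]] [r rNu ->]].
rewrite !mulmxDl.
have [v [q ->]] := tangentP tT; rewrite Tc add0r.
rewrite (zero s (fun j => flow_mx x (j%:R * per))) ?add0r.
- by rewrite (zero r (fun j => flow_mx x (- (j%:R * per))))// => j; [have [] := iter j|exact: du].
- by move=> j; have [] := iter j.
- by move=> j; exact: ds.
Qed.

(** L is the x-component of the projection onto the tangent space along [Ns + Nu]. The monodromy
    preserves [Ns + Nu] and changes a tangent vector only in its phase component, hence fixes L. *)
Lemma section_functional x : U x -> exists L : 'M[R]_(n, k),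
  (forall v r, dG (x, 0) (v, r) *m L = v) /\ monodromy x *m L = L.
Proof.
move=> Ux; have [Ns [Nu [K [a [[a0 full direct] [invs invu _ _]]]]]] := hyp Ux.
set T := tangent_space G (x, 0) in full direct.
pose N := (Ns + Nu)%VS.
have TN0 : (T :&: N)%VS = 0%VS.
  move: direct; rewrite directv_addE => /and3P[].
  rewrite directv_addE => /and3P[_ _ /eqP TNs0] _ /eqP TNsNu0.
  apply/eqP; rewrite -subv0; apply/subvP => t /memv_capP[tT /memv_addP[u uNs [v vNu tE]]].
  have v0 : v \in 0%VS.
    rewrite -TNsNu0; apply/memv_capP; split=> //.
    have -> : v = t - u by rewrite tE addrAC subrr add0r.
    by apply: memv_add => //; rewrite memvN.
  move: v0; rewrite memv0 => /eqP v0; rewrite v0 addr0 in tE.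
  by rewrite -TNs0; apply/memv_capP; split=> //; rewrite tE.
have TNf : (T + N)%VS = fullv by rewrite addvA.
pose f : 'Hom(P, 'rV[R]_n) := linfun ('d G (x, 0)).
have fE q : f q = dG (x, 0) q by rewrite lfunE dGE.
have injf : lker f == 0%VS.
  apply/lker0P => p q; rewrite !fE !dGE; exact: G_immersion.
pose pT := daddv_pi T N.
have pT_id z : z \in T -> pT z = z by exact: daddv_pi_id.
have pT_N z : z \in N -> pT z = 0.
  move=> zN; have NT0 : (N :&: T)%VS = 0%VS by rewrite capvC.
  have := daddv_pi_add TN0 (w := z); rewrite TNf memvf => /(_ isT).
  by rewrite (daddv_pi_id NT0 zN) -/(pT z) -[RHS]add0r => /addIr.
pose l0 z : 'rV[R]_k := ((f^-1)%VF (pT z)).1.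
have lin_l : linear l0 by move=> b u v; rewrite /l0 !linearP.
pose l : {linear 'rV[R]_n -> 'rV[R]_k} := HB.pack l0 (GRing.isLinear.Build R _ _ _ l0 lin_l).
have lE z : z *m lin1_mx l = l0 z by rewrite mul_rV_lin1.
have lT v r : l0 (dG (x, 0) (v, r)) = v.
  rewrite /l0 pT_id; first by rewrite -fE lker0_lfunK.
  by rewrite -fE memv_img// memvf.
have lN z : z \in N -> l0 z = 0 by move=> zN; rewrite /l0 pT_N// linear0.
exists (lin1_mx l); split=> [v r|]; first by rewrite lE.
apply: eq_rV_mulmx => z; rewrite mulmxA !lE.
have : z \in fullv by exact: memvf.
rewrite -full => /memv_addP[u /memv_addP[t tT [s sNs ->]] [r rNu ->]].
have l0D z1 z2 : l0 (z1 + z2) = l0 z1 + l0 z2 by rewrite -[LHS]/(l (z1 + z2)) linearD.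
have sN : s \in N by rewrite -[s]addr0; apply: memv_add => //; exact: mem0v.
have rN : r \in N by rewrite -[r]add0r; apply: memv_add => //; exact: mem0v.
have sMN : s *m monodromy x \in N.
  by rewrite -[s *m _]addr0; apply: memv_add; [exact: invs|exact: mem0v].
have rMN : r *m monodromy x \in N.
  by rewrite -[r *m _]add0r; apply: memv_add; [exact: mem0v|exact: invu].
rewrite !mulmxDl !l0D (lN s)// (lN r)// (lN _ sMN) (lN _ rMN) !addr0.
have [v [q ->]] := tangentP tT; rewrite lT dG_split mulmxDl -scalemxAl.
rewrite phase_transport//; have [b ->] := tangent_transport v per Ux.
have dGper q' : dG (x, per) q' = dG (x, 0) q' by rewrite -[per]add0r dG_periodic.
by rewrite !dGper -dG_phase -[v in RHS](lT v (b + q)) (dG_split _ v b) (dG_split _ v (b + q))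
  scalerDl addrA (dG_phase _ q).
Qed.

(* The dual of the section is the unique L with [section_frame *m L = 1],
   [phase_vector *m L = 0] and [monodromy *m L = L]; this overdetermined system
   is solved by the normal equations, so that L depends on x as smoothly as the
   data. *)
Definition section_frame x : 'M[R]_(k, n) := \matrix_(i, j) dG (x, 0) (delta_mx 0 i, 0) 0 j.
Definition phase_vector x : 'rV[R]_n := dG (x, 0) (0, 1).
Definition gram x : 'M[R]_n :=
  (section_frame x)^T *m section_frame x + (phase_vector x)^T *m phase_vector x +
  (monodromy x - 1%:M)^T *m (monodromy x - 1%:M).
Definition section_dual x : 'M[R]_(n, k) := invmx (gram x) *m (section_frame x)^T.

Lemma section_frame_mul x v : v *m section_frame x = dG (x, 0) (v, 0).
Proof.
apply/rowP => j; rewrite mxE [v in RHS](row_sum_delta v).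
have -> : dG (x, 0) (\sum_i v 0 i *: delta_mx 0 i, 0) =
    \sum_i v 0 i *: dG (x, 0) (delta_mx 0 i, 0).
  rewrite dGE (_ : (\sum_i v 0 i *: delta_mx 0 i, 0) = \sum_i v 0 i *: (delta_mx 0 i, 0)).
    by rewrite linear_sum; apply: eq_bigr => i _; rewrite linearZ dGE.
  apply: (big_ind2 (fun (y : 'rV[R]_k) (z : P) => (y, 0) = z)) => //.
    by move=> y1 ? y2 ? <- <-; congr (_, _); rewrite addr0.
  by move=> i _; congr (_, _); rewrite scaler0.
by rewrite summxE; apply: eq_bigr => i _; rewrite !mxE.
Qed.

Lemma sum_sq_eq0 m (c : 'cV[R]_m) : c^T *m c = 0 -> c = 0.
Proof.
move=> /matrixP/(_ 0 0); rewrite !mxE => /eqP.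
rewrite psumr_eq0 => [/allP H|i _]; last by rewrite !mxE -expr2 sqr_ge0.
apply/colP => i; rewrite mxE; have := H i (mem_index_enum _).
by rewrite /= !mxE -expr2 sqrf_eq0 => /eqP.
Qed.

(** The quadratic form of [gram] is a sum of three squares. Where it vanishes, the functional kills
    the tangent space and is fixed by the monodromy, hence is zero by [fixed_functional_zero]. *)
Lemma gram_unit x : U x -> gram x \in unitmx.
Proof.
move=> Ux; rewrite -row_free_unit -kermx_eq0; apply/rowV0P => u /sub_kermxP uG.
pose c := u^T.
have sq m' (M : 'M[R]_(m', n)) : u *m (M^T *m M) *m c = (M *m c)^T *m (M *m c).
  by rewrite trmx_mul trmxK !mulmxA.
have sq_ge0 m' (c' : 'cV[R]_m') : 0 <= (c'^T *m c') 0 0.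
  by rewrite mxE; apply: sumr_ge0 => i _; rewrite !mxE -expr2 sqr_ge0.
have : (u *m gram x *m c) 0 0 = 0 by rewrite uG mul0mx mxE.
have [N NE] : exists N, N = monodromy x - 1%:M by eexists.
rewrite /gram -NE !mulmxDr !mulmxDl !sq mxE [X in X + _]mxE => /eqP.
rewrite !paddr_eq0 ?addr_ge0 ?sq_ge0// => /andP[/andP[/eqP h1 /eqP h2] /eqP h3].
have zero m' (c' : 'cV[R]_m') : (c'^T *m c') 0 0 = 0 -> c' = 0.
  by move=> h; apply: sum_sq_eq0; apply/matrixP => i j; rewrite !ord1 h mxE.
have c0 : c = 0.
  apply: (fixed_functional_zero Ux) => [v r|].
    by rewrite dG_split mulmxDl -section_frame_mul -mulmxA (zero _ _ h1) mulmx0 add0r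
      -scalemxAl (zero _ _ h2) scaler0.
  by have := zero _ _ h3; rewrite NE mulmxBl mul1mx => /eqP; rewrite subr_eq0 => /eqP.
by rewrite -[u]trmxK -/c c0 trmx0.
Qed.

(** The functional L of [section_functional] solves the overdetermined system, hence its normal
    equations, which have a unique solution. *)
Lemma LFP x : U x ->
  (forall v r, dG (x, 0) (v, r) *m section_dual x = v) /\ monodromy x *m section_dual x = section_dual x.
Proof.
move=> Ux; have [L [LT LM]] := section_functional Ux.
suff -> : section_dual x = L by [].
have -> : L = invmx (gram x) *m (gram x *m L) by rewrite mulmxA mulVmx ?gram_unit// mul1mx.
congr (_ *m _); rewrite /gram !mulmxDl -!mulmxA.
have -> : section_frame x *m L = 1%:M.
  by apply: eq_rV_mulmx => z; rewrite mulmxA section_frame_mul LT mulmx1.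
have -> : phase_vector x *m L = 0 by exact: LT.
have -> : (monodromy x - 1%:M) *m L = 0 by rewrite mulmxBl mul1mx LM subrr.
by rewrite mulmx1 !mulmx0 !addr0.
Qed.

Local Notation frV := (frame_rV R k).

Lemma embed_Cr1 (s : R) : Cr 1 U (fun x : 'rV[R]_k => (x, s)).
Proof.
have Cid : Cr 1 U (@idfun 'rV[R]_k) by exact: (Cr1_linear frV _ oU).
exact: (Cr1_pair oU Cid (Crb_cst true s oU)).
Qed.

Lemma slice_Cr1 (W : normedModType R) (f : P -> W) (s : R) :
  Cr 1 O f -> Cr 1 U (fun x => f (x, s)).
Proof.
move=> Cf; have Op x : U x -> O (x, s) by [].
exact: (Cr1_comp frV frP (f := fun x : 'rV[R]_k => (x, s)) (g := f) oU Op (embed_Cr1 s) Cf).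
Qed.

Lemma fst_Cr1 (W : normedModType R) (f : 'rV[R]_k -> W) :
  Cr 1 U f -> Cr 1 O (fun p => f p.1).
Proof.
move=> Cf; have Cfst : Cr 1 O (fst : P -> 'rV[R]_k) by exact: (Cr1_linear frP _ oO).
exact: (Cr1_comp frP frV (f := fst) (g := f) oO (fun p Op => Op.1) Cfst Cf).
Qed.

Lemma dG_section_Cr1 v : Cr 1 U (fun x => dG (x, 0) v).
Proof.
apply: (Crb_eq (b := true) oU _ (slice_Cr1 0 (CG.2 v))) => x Ux.
by rewrite dGE; apply: deriveE; exact: G_differentiable.
Qed.

Lemma section_frame_Cr1 : Cr 1 U section_frame.
Proof.
apply/(Crb_mxP frV true _ oU) => i j.
apply: (Crb_eq (b := true) (f := fun x => dG (x, 0) (delta_mx 0 i, 0) 0 j) oU) => [x _|].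
  by rewrite mxE.
by move/(Crb_mxP frV true _ oU) : (dG_section_Cr1 (delta_mx 0 i, 0)); exact.
Qed.

Lemma section_dual_Cr1 : Cr 1 U section_dual.
Proof.
have CB := section_frame_Cr1; have CdG := dG_section_Cr1.
have CBT := Crb_trmx frV (b := true) oU CB.
have CbT := Crb_trmx frV (b := true) oU (CdG (0, 1)).
have CM : Cr 1 U (fun x => monodromy x - 1%:M).
  exact: (Crb_add (b := true) oU (slice_Cr1 per flow_mx_Cr1) (Crb_cst true _ oU)).
have CMT := Crb_trmx frV (b := true) oU CM.
have Cgram : Cr 1 U gram.
  apply: (Crb_add (b := true) oU); last exact: (Crb_mulmx frV (b := true) oU CMT CM).
  apply: (Crb_add (b := true) oU); first exact: (Crb_mulmx frV (b := true) oU CBT CB).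
  exact: (Crb_mulmx frV (b := true) oU CbT (CdG (0, 1))).
have Cinv : Cr 1 U (fun x => invmx (gram x)).
  apply: (Crb_inverse frV (b := true) oU _ Cgram) => x Ux.
  by rewrite mulmxV// gram_unit.
exact: (Crb_mulmx frV (b := true) oU Cinv CBT).
Qed.

(** The function pi: the dual of the section carried along the orbit by the adjoint equation.
    Invariance of [section_dual] under the monodromy becomes periodicity. *)
Definition slow_projection (p : P) : 'M[R]_(n, k) := flow_inv p.1 p.2 *m section_dual p.1.

Lemma slow_projection_Cr1 : Cr 1 O slow_projection.
Proof. exact: (Crb_mulmx frP (b := true) oO flow_inv_Cr1 (fst_Cr1 section_dual_Cr1)). Qed.

Lemma slow_projection_periodic x s : U x -> slow_projection (x, s + per) = slow_projection (x, s).
Proof.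
move=> Ux; have [_ ML] := LFP Ux.
have E : flow_mx x (s + per) *m (flow_inv x s *m section_dual x) = section_dual x.
  by rewrite flow_mx_shift// -mulmxA [flow_mx x s *m _]mulmxA YZ// mul1mx.
rewrite /slow_projection/= -{1}E mulmxA.
by rewrite (mulmx1C (YZ (s + per) Ux)) mul1mx.
Qed.

(** The phase direction is transported to itself and killed, so the unknown shear c of
    [tangent_transport] can be replaced by any r. *)
Lemma slow_projection_section x s v r : U x -> dG (x, s) (v, r) *m slow_projection (x, s) = v.
Proof.
move=> Ux; have [LT _] := LFP Ux; rewrite /slow_projection/=.
have L0 : dG (x, s) (0, 1) *m (flow_inv x s *m section_dual x) = 0.
  by rewrite -phase_transport// -mulmxA [flow_mx x s *m _]mulmxA YZ// mul1mx LT.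
have [c E] := tangent_transport v s Ux.
rewrite dG_split mulmxDl -scalemxAl L0 scaler0.
have : dG (x, s) (v, c) *m (flow_inv x s *m section_dual x) = v.
  by rewrite -E -mulmxA [flow_mx x s *m _]mulmxA YZ// mul1mx LT.
by rewrite dG_split mulmxDl -scalemxAl L0 scaler0.
Qed.

Lemma diff_phase (W : normedModType R) (f : P -> W) x s d a :
  differentiable f (x, s) -> is_derive s (1 : R) (fun s => f (x, s)) d ->
  'd f (x, s) (0, a) = a *: d.
Proof.
move=> df dfs.
have -> : (0 : 'rV[R]_k, a) = a *: (0, 1).
  by congr (_, _); [rewrite [RHS]scaler0|rewrite [RHS]mulr1].
rewrite linearZ; congr (_ *: _).
have H : is_derive (x, s) (0 : 'rV[R]_k, 1 : R) f ('d f (x, s) (0, 1)).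
  exact: diff_is_derive.
have {}H : is_derive s (1 : R) (fun s => f (x, s)) ('d f (x, s) (0, 1)).
  apply/is_derive_epsP => e e0; have /is_derive_epsP/(_ e e0) := H.
  by apply: filterS => h; rewrite line_pair2.
exact: is_derive_unique H dfs.
Qed.

Lemma slow_projection_derive x s : U x ->
  'd slow_projection (x, s) (0, w x) = - (jacobian_on (x, s) *m slow_projection (x, s)).
Proof.
move=> Ux; have dpi : differentiable slow_projection (x, s) by apply: slow_projection_Cr1.1.
have dL : is_derive s (1 : R) (fun s => slow_projection (x, s))
    (- phase_jacobian (x, s) *m flow_inv x s *m section_dual x).
  have := is_derive_mulmx (flow_inv_derive s Ux) (is_derive_cst (section_dual x) s 1).
  by rewrite mulmx0 addr0.
rewrite (diff_phase _ dpi dL) /slow_projection/= -!mulNmx -!mulmxA scalemxAl; congr (_ *m _).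
by rewrite /phase_jacobian/= scalerN scalerA mulfV ?w_neq0// scale1r.
Qed.

(** * Mean and oscillation of the forcing *)

Definition forcing (p : P) : 'rV[R]_k := F1 (G p) *m slow_projection p.

Lemma forcing_Cr1 : Cr 1 O forcing.
Proof.
have CF : Cr 1 O (F1 \o G).
  exact: (Cr1_comp frP (frame_rV R n) (B := setT) (f := G) (g := F1) oO (fun _ _ => I) G_Cr1 CF1).
exact: (Crb_mulmx frP (b := true) oO CF slow_projection_Cr1).
Qed.

Lemma forcing_periodic x s : U x -> forcing (x, s + per) = forcing (x, s).
Proof. by move=> Ux; rewrite /forcing slow_projection_periodic// G_periodic. Qed.

Definition forcing_integral (x : 'rV[R]_k) (s : R) : 'rV[R]_k :=
  \row_j primitive (fun s => forcing (x, s) 0 j) s.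

Let forcing_entry_Cr1 j : Cr 1 O (fun p => forcing p 0 j).
Proof. by move/(Crb_mxP frP true _ oO) : forcing_Cr1; exact. Qed.

Lemma forcing_integral_primitive x j : U x -> let f := (fun s => forcing (x, s) 0 j) in
  primitive f 0 = 0 /\ forall s, is_derive s (1 : R) (primitive f) (f s).
Proof.
move=> Ux; apply: primitiveP.
exact: (line_continuous (f := fun p => forcing p 0 j) (Cr1_continuous (forcing_entry_Cr1 j)) Ux).
Qed.

Lemma forcing_integral0 x : U x -> forcing_integral x 0 = 0.
Proof. by move=> Ux; apply/rowP => j; rewrite !mxE (forcing_integral_primitive j Ux).1. Qed.

Lemma forcing_integral_derive x s : U x -> is_derive s (1 : R) (forcing_integral x) (forcing (x, s)).
Proof.
move=> Ux; apply/is_derive_mxP => i j; rewrite (ord1 i).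
rewrite (_ : (fun y => _) = primitive (fun s => forcing (x, s) 0 j)).
  exact: (forcing_integral_primitive j Ux).2.
by apply/funext => y; rewrite mxE.
Qed.

Lemma forcing_integral_Cr1 : Cr 1 O (fun p => forcing_integral p.1 p.2).
Proof.
apply/(Crb_mxP frP true _ oO) => i j; rewrite (ord1 i).
have C := primitive_Cr1 oU (I := fun x => primitive (fun s => forcing (x, s) 0 j)) (forcing_entry_Cr1 j)
  (fun x Ux => (forcing_integral_primitive j Ux).1) (fun x t Ux => (forcing_integral_primitive j Ux).2 t).
by apply: (Crb_eq (b := true) oO _ C) => p _; rewrite mxE.
Qed.

Definition forcing_mean (x : 'rV[R]_k) : 'rV[R]_k := per^-1 *: forcing_integral x per.

Lemma forcing_mean_Cr1 : Cr 1 U forcing_mean.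
Proof.
apply: (Crb_scale frV (b := true) oU); first exact: (Crb_cst true _ oU).
exact: (slice_Cr1 per forcing_integral_Cr1).
Qed.

(** The function h. The subtracted linear term removes what the integral gains over one period,
    which makes the difference periodic. *)
Definition corrector (p : P) : 'rV[R]_k := (w p.1)^-1 *: (forcing_integral p.1 p.2 - p.2 *: forcing_mean p.1).

Lemma corrector_Cr1 : Cr 1 O corrector.
Proof.
have Csnd : Cr 1 O (snd : P -> R) by exact: (Cr1_linear frP _ oO).
apply: (Crb_scale frP (b := true) oO).
  apply: (Crb_inv frP (b := true) oO _ w_fst_Cr1) => p [Up _]; exact: w_neq0.
apply: (Crb_add (b := true) oO forcing_integral_Cr1).
have C := Crb_scale frP (b := true) oO (Crb_cst true (- 1 : R) oO)
  (Crb_scale frP (b := true) oO Csnd (fst_Cr1 forcing_mean_Cr1)).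
by apply: (Crb_eq (b := true) oO _ C) => p _; rewrite scaleN1r.
Qed.

Lemma corrector_periodic x s : U x -> corrector (x, s + per) = corrector (x, s).
Proof.
move=> Ux; rewrite /corrector/=; congr (_ *: _).
have IFs : forcing_integral x (s + per) = forcing_integral x s + forcing_integral x per.
  have dD t : is_derive t (1 : R) (fun t => forcing_integral x (1 * t + per) - forcing_integral x t) 0.
    have d1 := is_derive_reparam (forcing_integral_derive (1 * t + per) Ux).
    rewrite scale1r mul1r forcing_periodic// in d1.
    rewrite -(subrr (forcing (x, t))); apply: is_deriveB => //; exact: forcing_integral_derive.
  have := constant_of_derive0 dD s; rewrite mulr0 add0r mul1r forcing_integral0// subr0.
  by move/eqP; rewrite subr_eq => /eqP ->; rewrite addrC.
have f1E : per *: forcing_mean x = forcing_integral x per.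
  by rewrite /forcing_mean scalerA mulfV ?gt_eqF// scale1r.
by rewrite IFs scalerDl opprD addrACA f1E subrr addr0.
Qed.

Lemma corrector_derive x s : U x -> 'd corrector (x, s) (0, w x) = forcing (x, s) - forcing_mean x.
Proof.
move=> Ux; have dh : differentiable corrector (x, s) by apply: corrector_Cr1.1.
have dL : is_derive s (1 : R) (fun s => corrector (x, s)) ((w x)^-1 *: (forcing (x, s) - forcing_mean x)).
  have d1 : is_derive s (1 : R) (fun s => s *: forcing_mean x) (forcing_mean x).
    have := is_derive_scale (is_derive_id s (1 : R)) (is_derive_cst (forcing_mean x) s 1).
    by rewrite scale1r scaler0 addr0.
  have d2 := is_deriveB (forcing_integral_derive s Ux) d1.
  have := is_derive_scale (is_derive_cst (w x)^-1 s (1 : R)) d2.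
  by rewrite scale0r add0r.
by rewrite (diff_phase _ dh dL) scalerA mulfV ?w_neq0// scale1r.
Qed.

Theorem averaging_data : exists (pi : P -> 'M[R]_(n, k)) (h : P -> 'rV[R]_k)
    (f1 : 'rV[R]_k -> 'rV[R]_k),
  [/\ Cr 1 O pi, Cr 1 O h & Cr 1 U f1] /\
  [/\ forall x s, U x -> pi (x, s + per) = pi (x, s) /\ h (x, s + per) = h (x, s),
      forall x s v r, U x -> 'd G (x, s) (v, r) *m pi (x, s) = v,
      forall x s, U x -> 'd pi (x, s) (0, w x) = - ('J F0 (G (x, s)) *m pi (x, s)),
      forall x s, U x -> 'd h (x, s) (0, w x) = F1 (G (x, s)) *m pi (x, s) - f1 x &
      forall x s, U x -> 'd G (x, s) (0, w x) = F0 (G (x, s))].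
Proof.
exists slow_projection, corrector, forcing_mean.
split; first by split; [exact: slow_projection_Cr1|exact: corrector_Cr1|exact: forcing_mean_Cr1].
split.
- by move=> x s Ux; rewrite slow_projection_periodic// corrector_periodic.
- by move=> x s v r Ux; rewrite -dGE slow_projection_section.
- by move=> x s Ux; exact: slow_projection_derive.
- by move=> x s Ux; exact: corrector_derive.
- by move=> x s Ux; rewrite -dGE G_time_derivative.
Qed.

End Floquet.

(** * Floquet data of the given family, with phases of period 2 pi *)

Section Family.
Variables (R : realType) (k n : nat) (F0 F1 : 'rV[R]_n -> 'rV[R]_n) (U : set 'rV[R]_k).
Variables (gamma0 : 'rV[R]_k -> R -> 'rV[R]_n) (tau : 'rV[R]_k -> R).
Variable Phi : 'rV[R]_k -> R -> R -> 'M[R]_n.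
Hypothesis fam : periodic_family 2 F0 U gamma0 tau.

Lemma tau_gt0 x : U x -> 0 < tau x.
Proof.
move=> Ux; have [a [b [a0 H]]] := period_bounded fam.
by have /andP[+ _] := H x Ux; exact: lt_le_trans.
Qed.

Lemma omega_gt0 x : U x -> 0 < omega tau x.
Proof. by move=> Ux; rewrite divr_gt0 ?tau_gt0// mulr_gt0// pi_gt0. Qed.

Lemma omegaV_period x : U x -> (omega tau x)^-1 * (2 * pi) = tau x.
Proof.
move=> Ux; rewrite /omega invf_div -mulrA mulVf ?mulr1//.
by rewrite mulf_neq0// gt_eqF// pi_gt0.
Qed.

Lemma omega_Cr1 : open U -> Cr 1 U (omega tau).
Proof.
move=> oU; apply: (Crb_mul (frame_rV R k) (b := true) oU (Crb_cst true (2 * pi) oU)).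
apply: (Crb_inv (frame_rV R k) (b := true) oU); last exact: (Cr2_Cr1 (period_smooth fam)).
by move=> x Ux; rewrite gt_eqF// tau_gt0.
Qed.

Lemma family_averaging_data : Cr 2 setT F0 -> Cr 1 setT F1 -> open U ->
  embedding 2 U (Gamma0 gamma0 tau) -> transition_matrix F0 U gamma0 Phi ->
  normally_hyperbolic U gamma0 tau Phi ->
  let G := Gamma0 gamma0 tau in let O := U `*` [set: R] in
  exists (pi_ : 'rV[R]_k * R -> 'M[R]_(n, k)) (h : 'rV[R]_k * R -> 'rV[R]_k)
    (f1 : 'rV[R]_k -> 'rV[R]_k),
  [/\ Cr 1 O pi_, Cr 1 O h & Cr 1 U f1] /\
  [/\ forall x s, U x -> pi_ (x, s + 2 * pi) = pi_ (x, s) /\ h (x, s + 2 * pi) = h (x, s),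
      forall x s v r, U x -> 'd G (x, s) (v, r) *m pi_ (x, s) = v,
      forall x s, U x ->
        'd pi_ (x, s) (0, omega tau x) = - ('J F0 (G (x, s)) *m pi_ (x, s)),
      forall x s, U x ->
        'd h (x, s) (0, omega tau x) = F1 (G (x, s)) *m pi_ (x, s) - f1 x &
      forall x s, U x -> 'd G (x, s) (0, omega tau x) = F0 (G (x, s))].
Proof.
move=> CF0 CF1 oU emb tm nh G O.
have per0 : 0 < 2 * pi :> R by rewrite mulr_gt0// pi_gt0.
have G_gamma x t : U x -> G (x, omega tau x * t) = gamma0 x t.
  by move=> Ux; rewrite /G /Gamma0/= mulKf// gt_eqF// omega_gt0.
apply: (averaging_data CF0 CF1 oU per0 omega_gt0 (omega_Cr1 oU) (embedding_smooth emb)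
  (embedding_periodic emb) (embedding_immersion emb) G_gamma (family_solution fam) tm).
move=> x Ux; have [Ns [Nu [K [lam0 [lams [lamu [K1 l0 lamP nhP]]]]]]] := nh.
have [split inv decs decu _] := nhP x Ux.
have tx := tau_gt0 Ux.
have K0 : 0 <= K by exact: le_trans K1.
have gper : gamma0 x (tau x) = gamma0 x 0 by rewrite -{1}[tau x]add0r (family_period fam).
have YE (v : 'rV[R]_n) r : v *m flow_mx (omega tau) Phi x (r * (2 * pi)) = v *m Phi x (r * tau x) 0.
  by rewrite /flow_mx mulrCA omegaV_period.
have /lamP := Ux; rewrite le_min => /andP[ls lu].
(* A period lasts [tau x], so [lam0 * tau x] is a decay exponent per period, common to the stable
   and unstable directions. *)
exists (Ns (gamma0 x 0)), (Nu (gamma0 x 0)), K, (lam0 * tau x) => T.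
have [full direct] := split 0; rewrite mulr0 in full direct.
have decay (l : R) (j : nat) : lam0 <= l ->
    K * expR (- l * (j%:R * tau x)) <= K * expR (- (lam0 * tau x * j%:R)).
  move=> ll; rewrite ler_wpM2l// ler_expR mulNr lerN2 -mulrA [tau x * _]mulrC.
  by rewrite ler_wpM2r// mulr_ge0// ltW.
have jt (j : nat) : 0 <= j%:R * tau x by rewrite mulr_ge0// ltW.
split; first by split=> //; rewrite mulr_gt0.
split=> v.
- have [_ + _] := inv (tau x) 0 v; rewrite gper /flow_mx omegaV_period//; exact.
- have [_ _] := inv (tau x) 0 v; rewrite gper /flow_mx omegaV_period//; exact.
- move=> j vN; rewrite YE; apply: (le_trans (decs _ _ _ vN (jt j))).
  by rewrite subr0 ler_wpM2r// decay.
- move=> j vN; rewrite -mulNr YE.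
  have jt' : - j%:R * tau x <= 0 by rewrite mulNr oppr_le0.
  apply: (le_trans (decu _ _ _ vN jt')).
  by rewrite subr0 ler_wpM2r// mulNr mulrN -mulNr decay.
Qed.

End Family.

(** * The averaged system *)

Lemma diff_sub_bound (R : realType) (V W : normedModType R) (I : finType)
    (e : I -> V) (c : I -> V -> R) (fr : frame e c) (f : V -> W) p q v (D : I -> R) :
  differentiable f p -> differentiable f q ->
  (forall i, `|'D_(e i) f p - 'D_(e i) f q| <= D i) ->
  `|'d f p v - 'd f q v| <= (\sum_i D i) * `|v|.
Proof.
move=> dfp dfq DP; rewrite (diffE_frame fr f p v) (diffE_frame fr f q v) -sumrB.
apply: le_trans (ler_norm_sum _ _ _) _; rewrite mulr_suml; apply: ler_sum => i _.
rewrite -scalerBr normrZ mulrC ler_pM//; last exact: (frame_coord fr).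
by rewrite -!deriveE.
Qed.

(** * Expansion of the perturbed field near M_0 *)

Section FieldExpansion.
Variables (R : realType) (n : nat).
Local Notation V := 'rV[R]_n.
Local Notation fr := (frame_rV R n).
Local Notation ball_ r := [set v : V | `|v| <= r].

Lemma segment_in_ball (r s : R) (x y : V) : ball_ r x -> ball_ r y ->
  0 <= s <= 1 -> ball_ r (s *: (y - x) + x).
Proof.
move=> /= xr yr /andP[s0 s1].
have -> : s *: (y - x) + x = s *: y + (1 - s) *: x.
  by rewrite scalerBr scalerBl scale1r -addrA; congr (_ + _); rewrite addrC.
apply: (le_trans (ler_normD _ _)); rewrite !normrZ (ger0_norm s0).
have s1' : 0 <= 1 - s by rewrite subr_ge0.
rewrite (ger0_norm s1').
have h1 : s * `|y| <= s * r by rewrite ler_wpM2l.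
have h2 : (1 - s) * `|x| <= (1 - s) * r by rewrite ler_wpM2l.
by apply: (le_trans (lerD h1 h2)); rewrite -mulrDl addrC subrK mul1r.
Qed.

Lemma lipschitz_on_ball (W : normedModType R) (f : V -> W) (r : R) : Cr 1 setT f ->
  exists2 M : R, 0 < M & forall x y, `|x| <= r -> `|y| <= r -> `|f y - f x| <= M * `|y - x|.
Proof.
move=> Cf; have [M M0 MP] := compact_diff_bound fr Cf (@ball_compact R n r) (fun _ _ => I).
exists M => // x y xr yr; apply: segment_lipschitz => s s01; split; first exact: Cf.1.
exact: (MP _ _ (segment_in_ball xr yr s01)).
Qed.

Lemma taylor_on_ball (W : normedModType R) (f : V -> W) (r : R) : Cr 2 setT f ->
  exists2 M : R, 0 < M & forall x y, `|x| <= r -> `|y| <= r ->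
    `|f y - f x - 'd f x (y - x)| <= M * `|y - x| ^+ 2.
Proof.
move=> [df cdf].
have /fin_all_exists2[M M0 MP] (i : 'I_n) : exists2 M : R, 0 < M &
    forall x y, `|x| <= r -> `|y| <= r ->
      `|'D_(delta_mx 0 i) f y - 'D_(delta_mx 0 i) f x| <= M * `|y - x|.
  exact: lipschitz_on_ball.
have S0 : 0 <= \sum_i M i by apply: sumr_ge0 => i _; exact/ltW.
exists (\sum_i M i + 1); first by rewrite ltr_wpDl.
move=> x y xr yr; apply: (@le_trans _ _ ((\sum_i M i) * `|y - x| ^+ 2)); last first.
  by rewrite ler_wpM2r ?lerDl// exprn_ge0.
apply: segment_taylor => s s01; split; first exact: df.
set z := s *: _ + x; have zr : `|z| <= r by exact: segment_in_ball.
have zx : `|z - x| <= `|y - x|.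
  rewrite /z addrK normrZ; case/andP: s01 => s0 s1.
  by rewrite ger0_norm// ler_piMl.
rewrite expr2 mulrA mulr_suml; apply: (diff_sub_bound fr); [exact: df|exact: df|].
by move=> i; apply: (le_trans (MP i _ _ xr zr)); rewrite ler_wpM2l// ltW.
Qed.

(** The zeroth field leaves a Taylor remainder [M0 * c ^+ 2], the first a Lipschitz error [M1 * c],
    and the others only their bounds on the ball, since [eps ^+ i.+2 <= eps ^+ 2]. *)
Lemma perturbed_field_expansion m (Fi : nat -> V -> V) (r c : R) : (1 <= m)%N ->
  (forall i, (i <= m)%N -> Cr 2 setT (Fi i)) -> 0 <= c ->
  exists2 M : R, 0 < M & forall x z eps, `|x| <= r -> `|z| <= r -> 0 < eps <= 1 ->
    `|z - x| <= c * eps ->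
    `|perturbed_field m Fi z eps - Fi 0%N x - (z - x) *m 'J (Fi 0%N) x - eps *: Fi 1%N x|
      <= M * eps ^+ 2.
Proof.
case: m => // m _ CF c0.
have [M0 M00 M0P] := taylor_on_ball r (CF 0%N isT).
have [M1 M10 M1P] := lipschitz_on_ball r (Cr2_Cr1 (CF 1%N isT)).
have /fin_all_exists2[B B0 BP] (i : 'I_m) : exists2 B : R, 0 < B &
    forall z, `|z| <= r -> `|Fi i.+2 z| <= B.
  apply: compact_bound; first exact: (@ball_compact R n r).
  by move=> z _; apply: (Cr1_continuous (Cr2_Cr1 (CF i.+2 _))) => //; rewrite ltnS.
have S0 : 0 <= \sum_i B i by apply: sumr_ge0 => i _; exact/ltW.
exists (M0 * c ^+ 2 + M1 * c + \sum_i B i + 1).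
  by rewrite ltr_wpDl// !addr_ge0// mulr_ge0 ?exprn_ge0// ltW.
move=> x z eps xr zr /andP[e0 e1] zx.
have e0' := ltW e0.
have -> : perturbed_field m.+1 Fi z eps = Fi 0%N z + eps *: Fi 1%N z +
    \sum_(i < m) eps ^+ i.+2 *: Fi i.+2 z.
  by rewrite /perturbed_field big_mkord 2!big_ord_recl/= expr0 scale1r expr1 addrA.
set S := \sum_(i < m) _.
have -> : Fi 0%N z + eps *: Fi 1%N z + S - Fi 0%N x - (z - x) *m 'J (Fi 0%N) x - eps *: Fi 1%N x =
    (Fi 0%N z - Fi 0%N x - (z - x) *m 'J (Fi 0%N) x) + eps *: (Fi 1%N z - Fi 1%N x) + S.
  by rewrite scalerBr; apply/rowP => j; rewrite !mxE; ring.
have h0 : `|Fi 0%N z - Fi 0%N x - (z - x) *m 'J (Fi 0%N) x| <= M0 * c ^+ 2 * eps ^+ 2.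
  rewrite -jacobianE; apply: (le_trans (M0P _ _ xr zr)).
  by rewrite -mulrA -exprMn ler_wpM2l ?(ltW M00)// lerXn2r// nnegrE ?mulr_ge0.
have h1 : `|eps *: (Fi 1%N z - Fi 1%N x)| <= M1 * c * eps ^+ 2.
  rewrite normrZ ger0_norm// expr2 mulrA mulrC ler_wpM2r//.
  by rewrite -mulrA; apply: (le_trans (M1P _ _ xr zr)); rewrite ler_wpM2l// ltW.
have h2 : `|S| <= (\sum_i B i) * eps ^+ 2.
  apply: (le_trans (ler_norm_sum _ _ _)); rewrite mulr_suml; apply: ler_sum => i _.
  rewrite normrZ ger0_norm ?exprn_ge0// mulrC ler_pM ?exprn_ge0 ?BP//.
  by rewrite -addn2 exprD ler_piMl ?exprn_ge0// exprn_ile1.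
apply: (le_trans (ler_normD _ _)); apply: (le_trans (lerD (ler_normD _ _) (lexx _))).
rewrite !mulrDl mul1r; apply: (le_trans (lerD (lerD h0 h1) h2)).
by rewrite lerDl exprn_ge0.
Qed.

End FieldExpansion.

Lemma is_derive_fst (R : realType) (V W : normedModType R) (p : R -> V * W) (t : R) d :
  is_derive t (1 : R) p d -> is_derive t (1 : R) (fun t => (p t).1) d.1.
Proof.
move=> /is_derive_epsP pd; apply/is_derive_epsP => e e0.
apply: filterS (pd e e0) => h; apply: le_trans.
have H (v : V * W) : `|v.1| <= `|v| by rewrite [`|v|]/(Num.max _ _) le_max lexx.
exact: (H (p (h *: 1 + t) - p t - h *: d)).
Qed.

(** * The slow variable and its rate *)

Section SlowVariable.
Variables (R : realType) (k n : nat) (F0 F1 : 'rV[R]_n -> 'rV[R]_n) (U : set 'rV[R]_k).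
Local Notation P := ('rV[R]_k * R)%type.
Local Notation O := (U `*` [set: R]).
Variables (G0 : P -> 'rV[R]_n) (w : 'rV[R]_k -> R).
Variables (pi_ : P -> 'M[R]_(n, k)) (h : P -> 'rV[R]_k) (f1 : 'rV[R]_k -> 'rV[R]_k).
Hypothesis oU : open U.
Hypothesis emb0 : embedding 2 U G0.
Hypothesis Cpi : Cr 1 O pi_.
Hypothesis Ch : Cr 1 O h.
Hypothesis periodic : forall x s, U x ->
  pi_ (x, s + 2 * pi) = pi_ (x, s) /\ h (x, s + 2 * pi) = h (x, s).
Hypothesis pi_section : forall x s v r, U x -> 'd G0 (x, s) (v, r) *m pi_ (x, s) = v.
Hypothesis pi_transport : forall x s, U x ->
  'd pi_ (x, s) (0, w x) = - ('J F0 (G0 (x, s)) *m pi_ (x, s)).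
Hypothesis h_transport : forall x s, U x ->
  'd h (x, s) (0, w x) = F1 (G0 (x, s)) *m pi_ (x, s) - f1 x.
Hypothesis G0_flow : forall x s, U x -> 'd G0 (x, s) (0, w x) = F0 (G0 (x, s)).

(* The second term removes the displacement of M_eps from M_0, the third one the
   oscillation of the forcing along the orbits. *)
Definition slow (eps : R) (z : 'rV[R]_n) (p : P) : 'rV[R]_k :=
  p.1 + (z - G0 p) *m pi_ p - eps *: h p.

(** This makes the slow variable independent of the branch of the phase, so it can be evaluated on
    coordinates chosen pointwise. *)
Lemma slow_periodic eps z p (j : int) : U p.1 ->
  slow eps z (p.1, p.2 + j%:~R * (2 * pi)) = slow eps z p.
Proof.
case: p => x s /= Ux; rewrite /slow/=.
have Gp := periodic_int (f := fun s => G0 (x, s)) (fun s => embedding_periodic emb0 s Ux).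
have pip := periodic_int (f := fun s => pi_ (x, s)) (fun s => (periodic s Ux).1).
have hp := periodic_int (f := fun s => h (x, s)) (fun s => (periodic s Ux).2).
by rewrite Gp pip hp.
Qed.

(** The rate is computed on a differentiable branch p and carried back to q by [slow_periodic]. The
    velocity [X.1] of the first term cancels against ['d G0 X *m pi_], so the imprecisely known X
    enters only through products with a factor of order eps. *)
Lemma slow_derive eps (Ge : P -> 'rV[R]_n) (q : R -> P) z (t0 : R) (X : P) (Z : 'rV[R]_n) :
  embedding 2 U Ge -> (\forall t \near t0, U (q t).1 /\ z t = Ge (q t)) ->
  is_derive t0 (1 : R) z Z -> Z = 'd Ge (q t0) X ->
  is_derive t0 (1 : R) (fun t => (q t).1) X.1 /\
  is_derive t0 (1 : R) (fun t => slow eps (z t) (q t))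
    (Z *m pi_ (q t0) + (z t0 - G0 (q t0)) *m 'd pi_ (q t0) X - eps *: 'd h (q t0) X).
Proof.
move=> emb nq dz ZE; have [Uq0 zq0] := nbhs_singleton nq.
have dz' : is_derive t0 (1 : R) z ('d Ge (q t0) X) by rewrite -ZE.
have [p [p0 dp pq]] := embedding_lift emb nq dz'.
have d1 : is_derive t0 (1 : R) (fun t => (q t).1) X.1.
  rewrite (_ : (fun t => _) = (fun t => (p t).1)); first exact: is_derive_fst.
  by apply/funext => t; have [j ->] := pq t.
split=> //; rewrite -p0.
have Op0 : O (p t0) by rewrite p0.
have dG : differentiable G0 (p t0) by apply: (embedding_smooth emb0).1.
have dpi : differentiable pi_ (p t0) by apply: Cpi.1.
have dh : differentiable h (p t0) by apply: Ch.1.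
have dGp := is_derive_comp (p := p) (f := G0) dp dG.
have dpip := is_derive_comp (p := p) (f := pi_) dp dpi.
have dhp := is_derive_comp (p := p) (f := h) dp dh.
have d2 := is_derive_mulmx (is_deriveB dz dGp) dpip.
have d3 := is_derive_scale (is_derive_cst eps t0 (1 : R)) dhp.
have d1p := is_derive_fst dp.
have d4 := is_deriveB (is_deriveD d1p d2) d3.
have E : X.1 = 'd G0 (p t0) X *m pi_ (p t0).
  move: Op0; case: (p t0) => x s [/= Ux _]; case: X {ZE dz' dp d1 dGp dpip dhp d2 d3 d1p d4} => v r.
  by rewrite pi_section.
suff H : is_derive t0 (1 : R) (fun t => slow eps (z t) (p t))
    (Z *m pi_ (p t0) + (z t0 - G0 (p t0)) *m 'd pi_ (p t0) X - eps *: 'd h (p t0) X).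
  apply: near_eq_is_derive H; apply: filterS nq => t [Uq _].
  by have [j ->] := pq t; rewrite slow_periodic.
suff -> : Z *m pi_ (p t0) + (z t0 - G0 (p t0)) *m 'd pi_ (p t0) X - eps *: 'd h (p t0) X =
    X.1 + ((Z - 'd G0 (p t0) X) *m (pi_ \o p) t0 + (z - (G0 \o p)) t0 *m 'd pi_ (p t0) X) -
    (0 *: (h \o p) t0 + cst eps t0 *: 'd h (p t0) X) by exact: d4.
rewrite -[(pi_ \o p) t0]/(pi_ (p t0)) -[(z - (G0 \o p)) t0]/(z t0 - G0 (p t0)).
rewrite -[cst eps t0]/eps -[(h \o p) t0]/(h (p t0)).
move: E; generalize ('d G0 (p t0) X) ('d pi_ (p t0) X) ('d h (p t0) X) => a b c ->.
rewrite scale0r add0r (mulmxBl Z a); move: (Z *m _) (a *m _) (_ *m b) => u1 u2 u3.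
by apply/rowP => i; rewrite !mxE; ring.
Qed.

Lemma slow_rate eps (p X : P) (Z nu Rm : 'rV[R]_n) a1 a2 a3 Mpi Mdpi Mdh : U p.1 -> 0 <= eps ->
  Z = F0 (G0 p) + nu *m 'J F0 (G0 p) + eps *: F1 (G0 p) + Rm ->
  `|pi_ p| <= Mpi -> (forall v, `|'d pi_ p v| <= Mdpi * `|v|) ->
  (forall v, `|'d h p v| <= Mdh * `|v|) ->
  0 <= Mdpi -> 0 <= Mdh ->
  `|Rm| <= a1 * eps ^+ 2 -> `|nu| <= a2 * eps -> `|X - (0, w p.1)| <= a3 * eps ->
  `|Z *m pi_ p + nu *m 'd pi_ p X - eps *: 'd h p X - eps *: f1 p.1| <=
    (n%:R * (a1 * Mpi) + n%:R * (a2 * (Mdpi * a3)) + Mdh * a3) * eps ^+ 2.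
Proof.
case: p => x s /= Ux e0 ZE pib dpib dhb Mdpi0 Mdh0 Rb nub Xb.
set del := X - _ in Xb.
have XE : X = (0, w x) + del by rewrite /del addrC subrK.
have E1 : 'd pi_ (x, s) X = - ('J F0 (G0 (x, s)) *m pi_ (x, s)) + 'd pi_ (x, s) del.
  by rewrite -pi_transport// -linearD -XE.
have E2 : 'd h (x, s) X = F1 (G0 (x, s)) *m pi_ (x, s) - f1 x + 'd h (x, s) del.
  by rewrite -h_transport// -linearD -XE.
(* The unperturbed field is the image of the pure phase vector [(0, w x)], so the term of order 1
   disappears. *)
have E3 : F0 (G0 (x, s)) *m pi_ (x, s) = 0 by rewrite -G0_flow// pi_section.
have bp := dpib del; have bh := dhb del.
suff H b b' c c' : b = - ('J F0 (G0 (x, s)) *m pi_ (x, s)) + b' ->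
    c = F1 (G0 (x, s)) *m pi_ (x, s) - f1 x + c' ->
    `|b'| <= Mdpi * `|del| -> `|c'| <= Mdh * `|del| ->
    `|Z *m pi_ (x, s) + nu *m b - eps *: c - eps *: f1 x| <=
      (n%:R * (a1 * Mpi) + n%:R * (a2 * (Mdpi * a3)) + Mdh * a3) * eps ^+ 2.
  exact: H E1 E2 bp bh.
move=> {E1 E2 bp bh} -> -> bp bh; rewrite ZE !mulmxDl E3 -scalemxAl.
set A := 'J F0 _; set Q := pi_ _; set f := F1 _.
have -> : 0 + nu *m A *m Q + eps *: (f *m Q) + Rm *m Q + nu *m (- (A *m Q) + b') -
    eps *: (f *m Q - f1 x + c') - eps *: f1 x = Rm *m Q + nu *m b' - eps *: c'.
  rewrite mulmxDr mulmxN mulmxA; move: (nu *m A *m Q) (f *m Q) (Rm *m Q) (nu *m b') => u1 u2 u3 u4.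
  by apply/rowP => i; rewrite !mxE; ring.
have h1 : `|Rm *m Q| <= n%:R * (a1 * Mpi) * eps ^+ 2.
  apply: (le_trans (mx_norm_mul _ _)); rewrite -!mulrA ler_wpM2l//.
  by rewrite mulrA mulrAC; apply: ler_pM.
have h2 : `|nu *m b'| <= n%:R * (a2 * (Mdpi * a3)) * eps ^+ 2.
  apply: (le_trans (mx_norm_mul _ _)); rewrite -!mulrA ler_wpM2l//.
  have -> : a2 * (Mdpi * (a3 * eps ^+ 2)) = a2 * eps * (Mdpi * (a3 * eps)) by ring.
  apply: ler_pM => //; apply: (le_trans bp); exact: ler_wpM2l.
have h3 : `|eps *: c'| <= Mdh * a3 * eps ^+ 2.
  rewrite normrZ ger0_norm//.
  have -> : Mdh * a3 * eps ^+ 2 = eps * (Mdh * (a3 * eps)) by ring.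
  by rewrite ler_wpM2l//; apply: (le_trans bh); exact: ler_wpM2l.
apply: (le_trans (ler_normB _ _)); apply: (le_trans (lerD (ler_normD _ _) (lexx _))).
by rewrite !mulrDl; exact: (lerD (lerD h1 h2) h3).
Qed.

End SlowVariable.

(** The sign s reduces estimates at positive and at negative times to forward ones on [[0, |t|]]. *)
Lemma interval_ray (R : realType) (J : set R) (t : R) : is_interval J -> J 0 -> J t ->
  exists s : R, [/\ `|s| = 1, t = s * `|t| + 0 &
    forall r, 0 <= r <= `|t| -> J (s * r + 0) /\ `|s * r + 0| <= `|t|].
Proof.
move=> iJ J0 Jt; have [t0|/ltW t0] := leP 0 t.
- exists 1; rewrite normr1 mul1r addr0 ger0_norm//; split=> // r /andP[r0 rt].
  by rewrite mul1r addr0 ger0_norm//; split=> //; apply: (iJ 0 t J0 Jt r); rewrite r0.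
- exists (-1); rewrite normrN1 mulN1r addr0 ler0_norm// opprK; split=> // r /andP[r0 rt].
  rewrite mulN1r addr0 normrN ger0_norm//; split=> //.
  by apply: (iJ t 0 Jt J0 (- r)); rewrite oppr_le0 r0 andbT lerNr.
Qed.

(** The speed bound is available only inside the ball of radius d. Up to a first exit time the curve
    travels at most [b * |t| < d], so there is no exit. *)
Lemma stay_close (R : realType) (V : normedModType R) (J : set R) (x dx : R -> V) (b d t : R) :
  is_interval J -> J 0 -> J t -> b * `|t| < d -> 0 < d -> 0 <= b ->
  (forall s, J s -> is_derive s (1 : R) x (dx s)) ->
  (forall s, J s -> `|x s - x 0| <= d -> `|dx s| <= b) ->
  `|x t - x 0| < d.
Proof.
move=> iJ J0 Jt btd d0 b0 dxP dxb; have [s [s1 tE st]] := interval_ray iJ J0 Jt.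
pose D r := x (s * r + 0).
have dD r : 0 <= r <= `|t| -> is_derive r (1 : R) D (s *: dx (s * r + 0)).
  by move=> /st[Jr _]; apply: is_derive_reparam; exact: dxP.
have D0 : D 0 = x 0 by rewrite /D mulr0 addr0.
have Dt : D `|t| = x t by rewrite /D -tE.
rewrite ltNge; apply/negP => dt.
have [|||t' [/andP[t'0 t't] t'd before]] :=
    first_hit (normr_ge0 t) (f := fun r => `|D r - x 0| - d).
- move=> r rt; apply: continuousB; last exact: cst_continuous.
  apply: (@continuous_comp _ _ _ (fun r => D r - x 0) (fun v => `|v|)).
    apply: continuousB; last exact: cst_continuous.
    exact: (is_derive_continuous (dD r rt)).
  exact: norm_continuous.
- by rewrite D0 subrr normr0 sub0r oppr_lt0.
- by rewrite subr_ge0 Dt.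
have sub r : 0 <= r <= t' -> 0 <= r <= `|t|.
  by move=> /andP[-> rt]; exact: le_trans t't.
have close r : 0 <= r <= t' -> `|D r - x 0| <= d.
  move=> /andP[r0]; rewrite le_eqVlt => /orP[/eqP ->|rt]; first by move: t'd; lra.
  by have := before r; rewrite r0 rt => /(_ isT); lra.
have Db r : 0 <= r <= t' -> `|s *: dx (s * r + 0)| <= b.
  move=> rt; rewrite normrZ s1 mul1r; apply: dxb; first by have [] := st r (sub r rt).
  exact: close.
have := mean_value_fwd (fun r rt => dD r (sub r rt)) Db (ltW t'0); rewrite D0 => Dd.
have : b * t' <= b * `|t| by rewrite ler_wpM2l.
by move: t'd Dd btd; lra.
Qed.

(** * Comparison of the slow variable with the averaged motion *)

Section Tracking.
Variables (R : realType) (V : normedModType R) (K : set V) (f : V -> V).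
Variables (d L Cu C2 C0 C : R).
Hypotheses (L_ge0 : 0 <= L) (Cu_ge0 : 0 <= Cu) (C2_ge0 : 0 <= C2) (C0_ge0 : 0 <= C0).
Hypothesis f_lipschitz : forall x xi, K xi -> `|x - xi| <= d ->
  `|f x - f xi| <= L * `|x - xi|.

(** The Gronwall bound for [u - xi] divided by eps: initial error [C0 + Cu], with 1 added for
    positivity, and inhomogeneity [L * Cu + C2], since f is evaluated at x and not at u. The leading
    Cu is the return from u to x. *)
Definition tracking_constant : R :=
  Cu + ((C0 + Cu + 1) + (C0 + Cu + 1) + (L * Cu + C2)) * expR ((L + 1) * C).

Lemma tracking_constant_gt0 : 0 < tracking_constant.
Proof.
rewrite /tracking_constant ltr_wpDl// mulr_gt0 ?expR_gt0//.
have B0 : 0 < C0 + Cu + 1 by rewrite ltr_wpDl// addr_ge0.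
by rewrite ltr_wpDr ?(addr_gt0 B0 B0)// ?addr_ge0 ?mulr_ge0.
Qed.

(** The Lipschitz and rate estimates hold only while x is within d of xi. As long as this is so,
    Gronwall's inequality yields the sharper bound [tracking_constant * eps < d], hence the distance
    d is never reached. The factor s carries the direction of time. *)
Lemma tracking_forward (eps s T : R) (x xi u du : R -> V) : `|s| <= 1 ->
  0 < eps -> tracking_constant * eps < d -> C0 * eps < d -> eps * T <= C ->
  (forall t, 0 <= t <= T -> {for t, continuous x}) ->
  (forall t, 0 <= t <= T ->
    K (xi t) /\ is_derive t (1 : R) xi ((s * eps) *: f (xi t))) ->
  (forall t, 0 <= t <= T -> `|x t - xi t| <= d ->
    [/\ is_derive t (1 : R) u (du t), `|du t - (s * eps) *: f (x t)| <= C2 * eps ^+ 2 &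
      `|u t - x t| <= Cu * eps]) ->
  `|x 0 - xi 0| <= C0 * eps ->
  forall t, 0 <= t <= T -> `|x t - xi t| <= tracking_constant * eps.
Proof.
move=> s1 e0 C1d C0d eT cx dxi slow init.
have e0' := ltW e0.
have key T' : 0 <= T' <= T -> (forall t, 0 <= t <= T' -> `|x t - xi t| <= d) ->
    `|x T' - xi T'| <= tracking_constant * eps.
  move=> /andP[T'0 T'T] xd.
  have sub t : 0 <= t <= T' -> 0 <= t <= T by move=> /andP[-> /le_trans]; apply.
  have dD t : 0 <= t <= T' ->
      is_derive t (1 : R) (fun t => u t - xi t) (du t - (s * eps) *: f (xi t)).
    move=> tT; have [du_ _ _] := slow t (sub t tT) (xd t tT).
    have [_ dxi_] := dxi t (sub t tT); exact: is_deriveB.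
  have D0 : `|u 0 - xi 0| <= (C0 + Cu + 1) * eps.
    have T00 : 0 <= (0 : R) <= T' by rewrite lexx.
    have [_ _ ux] := slow 0 (sub 0 T00) (xd 0 T00).
    rewrite -(subrKA (x 0)); apply: (le_trans (ler_normD _ _)).
    by apply: (le_trans (lerD ux init)); lra.
  have dDle t : 0 <= t <= T' -> `|du t - (s * eps) *: f (xi t)| <=
      eps * L * `|u t - xi t| + eps * ((L * Cu + C2) * eps).
    move=> tT; have [_ dux ux] := slow t (sub t tT) (xd t tT).
    have [Kxi _] := dxi t (sub t tT).
    rewrite -(subrKA ((s * eps) *: f (x t))) -scalerBr.
    apply: (le_trans (ler_normD _ _)); rewrite normrZ normrM (ger0_norm e0').
    have h1 : `|s| * eps * `|f (x t) - f (xi t)| <= eps * (L * `|x t - xi t|).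
      apply: ler_pM => //; first by rewrite mulr_ge0.
        by rewrite ler_piMl.
      exact: f_lipschitz Kxi (xd t tT).
    have h2 : `|x t - xi t| <= Cu * eps + `|u t - xi t|.
      rewrite -(subrKA (u t)); apply: (le_trans (ler_normD _ _)).
      by rewrite lerD2r distrC.
    have h3 : eps * (L * `|x t - xi t|) <= eps * (L * (Cu * eps + `|u t - xi t|)).
      by rewrite ler_wpM2l// ler_wpM2l.
    by apply: (le_trans (lerD dux (le_trans h1 h3))); lra.
  have a0 : 0 < (C0 + Cu + 1) * eps by rewrite mulr_gt0// ltr_wpDl// addr_ge0.
  have c0 : 0 <= (L * Cu + C2) * eps by rewrite mulr_ge0// addr_ge0// mulr_ge0.
  have T'T' : 0 <= T' <= T' by rewrite T'0 lexx.
  have := gronwall dD (mulr_ge0 e0' L_ge0) e0 c0 a0 D0 dDle T'T'.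
  have [_ _ ux] := slow T' (sub T' T'T') (xd T' T'T').
  move=> uD; rewrite -(subrKA (u T')); apply: (le_trans (ler_normD _ _)).
  rewrite distrC in ux; apply: (le_trans (lerD ux uD)).
  have expb : expR ((eps * L + eps) * T') <= expR ((L + 1) * C).
    rewrite ler_expR; have -> : (eps * L + eps) * T' = (L + 1) * (eps * T') by ring.
    rewrite ler_wpM2l ?addr_ge0//; apply: le_trans eT; exact: ler_wpM2l.
  have S0 : 0 <= (C0 + Cu + 1) * eps + (C0 + Cu + 1) * eps + (L * Cu + C2) * eps.
    by rewrite !addr_ge0// ltW.
  apply: (le_trans (lerD (lexx _) (ler_wpM2l S0 expb))).
  by rewrite le_eqVlt /tracking_constant; apply/orP; left; apply/eqP; ring.
have fcont t : 0 <= t <= T -> {for t, continuous (fun t => `|x t - xi t| - d)}.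
  move=> tT; apply: continuousB; last exact: cst_continuous.
  apply: (@continuous_comp _ _ _ (fun t => x t - xi t) (fun v => `|v|)).
    apply: continuousB; first exact: cx.
    exact: (is_derive_continuous (dxi t tT).2).
  exact: norm_continuous.
have small t : 0 <= t <= T -> `|x t - xi t| < d.
  move=> /andP[t0 tT]; rewrite ltNge; apply/negP => dt.
  have [|||t' [/andP[t'0 t't] t'd before]] := first_hit t0 (f := fun t => `|x t - xi t| - d).
  - by move=> t'' /andP[h1 h2]; apply: fcont; rewrite h1 (le_trans h2).
  - by rewrite subr_lt0; apply: le_lt_trans C0d.
  - by rewrite subr_ge0.
  have : `|x t' - xi t'| <= tracking_constant * eps.
    apply: key; first by rewrite (ltW t'0) (le_trans t't).
    move=> r /andP[r0]; rewrite le_eqVlt => /orP[/eqP ->|rt]; first by move: t'd; lra.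
    by have := before r; rewrite r0 rt => /(_ isT); lra.
  by move: t'd C1d; lra.
move=> t tT; apply: key => // r /andP[r0 rt]; apply/ltW/small.
by rewrite r0 (le_trans rt)//; case/andP: tT.
Qed.

Lemma tracking (eps : R) (J : set R) (x xi u du : R -> V) :
  is_interval J -> J 0 ->
  0 < eps -> tracking_constant * eps < d -> C0 * eps < d ->
  (forall t, J t -> `|t| <= C / eps -> {for t, continuous x}) ->
  (forall t, J t -> `|t| <= C / eps -> K (xi t) /\ is_derive t (1 : R) xi (eps *: f (xi t))) ->
  (forall t, J t -> `|t| <= C / eps -> `|x t - xi t| <= d ->
    [/\ is_derive t (1 : R) u (du t), `|du t - eps *: f (x t)| <= C2 * eps ^+ 2 &
      `|u t - x t| <= Cu * eps]) ->
  `|x 0 - xi 0| <= C0 * eps ->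
  forall t, J t -> `|t| <= C / eps -> `|x t - xi t| <= tracking_constant * eps.
Proof.
move=> iJ J0 e0 C1d C0d cx dxi slow init t Jt tC.
have [s [s1 tE st']] := interval_ray iJ J0 Jt.
have st r : 0 <= r <= `|t| -> J (s * r + 0) /\ `|s * r + 0| <= C / eps.
  by move=> /st'[Jr rt]; split=> //; exact: le_trans tC.
have := @tracking_forward eps s `|t| (fun r => x (s * r + 0)) (fun r => xi (s * r + 0))
  (fun r => u (s * r + 0)) (fun r => s *: du (s * r + 0)).
rewrite s1 => /(_ (lexx _) e0 C1d C0d); rewrite mulrC -ler_pdivlMr// => /(_ tC) H.
have tt : 0 <= `|t| <= `|t| by rewrite normr_ge0 lexx.
have {}H hA hB hC hD := H hA hB hC hD `|t| tt.
rewrite -tE in H; apply: H.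
- move=> r rt; have [Jr rC] := st r rt.
  apply: (@continuous_comp _ _ _ (fun r => s * r + 0) x); last exact: cx.
  apply: continuousD; last exact: cst_continuous.
  by apply: continuousM; [exact: cst_continuous|exact: cvg_id].
- move=> r rt; have [Jr rC] := st r rt; have [Kr dr] := dxi _ Jr rC; split=> //.
  by rewrite -scalerA; exact: is_derive_reparam.
- move=> r rt xd; have [Jr rC] := st r rt; have [du_ dux ux] := slow _ Jr rC xd; split=> //.
    exact: is_derive_reparam.
  by rewrite -scalerA -scalerBr normrZ s1 mul1r.
- by rewrite mulr0 add0r.
Qed.

End Tracking.

Lemma dist_set_le (R : realType) (n : nat) (z v : 'rV[R]_n) (A : set 'rV[R]_n) :
  A v -> dist_set z A <= `|z - v|.
Proof.
move=> Av; apply: ge_inf; last by exists v.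
by exists 0 => _ [u _ <-].
Qed.

(** * The averaged field on the section and the tracking property *)

Section Averaging.
Variables (R : realType) (m k n : nat) (Fi : nat -> 'rV[R]_n -> 'rV[R]_n).
Variables (U : set 'rV[R]_k) (tau : 'rV[R]_k -> R) (M : R -> set 'rV[R]_n).
Local Notation P := ('rV[R]_k * R)%type.
Local Notation O := (U `*` [set: R]).
Variable G0 : P -> 'rV[R]_n.
Variables (pi_ : P -> 'M[R]_(n, k)) (h : P -> 'rV[R]_k) (f1 : 'rV[R]_k -> 'rV[R]_k).
Local Notation F := (perturbed_field m Fi).
Local Notation w := (omega tau).
Hypothesis m_gt0 : (1 <= m)%N.
Hypothesis CF : forall i, (i <= m)%N -> Cr 2 setT (Fi i).
Hypothesis oU : open U.
Hypothesis emb0 : embedding 2 U G0.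
Hypothesis persistent : persistent_manifold 2 F U G0 tau M.
Hypothesis Cpi : Cr 1 O pi_.
Hypothesis Ch : Cr 1 O h.
Hypothesis Cf1 : Cr 1 U f1.
Hypothesis periodic : forall x s, U x ->
  pi_ (x, s + 2 * pi) = pi_ (x, s) /\ h (x, s + 2 * pi) = h (x, s).
Hypothesis pi_section : forall x s v r, U x -> 'd G0 (x, s) (v, r) *m pi_ (x, s) = v.
Hypothesis pi_transport : forall x s, U x ->
  'd pi_ (x, s) (0, w x) = - ('J (Fi 0) (G0 (x, s)) *m pi_ (x, s)).
Hypothesis h_transport : forall x s, U x ->
  'd h (x, s) (0, w x) = Fi 1 (G0 (x, s)) *m pi_ (x, s) - f1 x.
Hypothesis G0_flow : forall x s, U x -> 'd G0 (x, s) (0, w x) = Fi 0 (G0 (x, s)).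

Definition section_point (y : 'rV[R]_n) : 'rV[R]_k := xget 0 [set x | U x /\ y = G0 (x, 0)].

Lemma section_pointK x : U x -> section_point (G0 (x, 0)) = x.
Proof.
move=> Ux; have [Ux' E] := @xgetPex _ 0 [set x' | U x' /\ G0 (x, 0) = G0 (x', 0)]
  (ex_intro _ x (conj Ux erefl)).
by have [] := embedding_inj emb0 Ux Ux' E.
Qed.

Definition averaged_vector (y : 'rV[R]_n) : 'rV[R]_n :=
  'd G0 (section_point y, 0) (f1 (section_point y), 0).

Definition Fbar (y : 'rV[R]_n) (eps : R) : 'rV[R]_n := eps *: averaged_vector y.

Lemma averaged_vector_section x : U x -> averaged_vector (G0 (x, 0)) = 'd G0 (x, 0) (f1 x, 0).
Proof. by move=> Ux; rewrite /averaged_vector section_pointK. Qed.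

Lemma scale_pair (eps : R) (v : 'rV[R]_k) : eps *: ((v, 0) : P) = (eps *: v, 0).
Proof. by congr (_, _); rewrite [LHS]mulr0. Qed.

Lemma Fbar_section x eps : U x -> Fbar (G0 (x, 0)) eps = 'd G0 (x, 0) (eps *: f1 x, 0).
Proof.
by move=> Ux; rewrite /Fbar averaged_vector_section// -scale_pair linearZ.
Qed.

Lemma averaged_vector_Cr1 : Cr 1 U (fun x => averaged_vector (G0 (x, 0))).
Proof.
have C := Crb_mulmx (frame_rV R k) (b := true) oU Cf1 (section_frame_Cr1 oU (embedding_smooth emb0)).
apply: (Crb_eq (b := true) oU _ C) => x Ux.
by rewrite section_frame_mul dGE averaged_vector_section.
Qed.

Lemma Fbar_averaged : averaged_field m U G0 Fbar.
Proof.
have cstE (a : R) := Crb_scale (frame_rV R k) (b := true) oU (Crb_cst true a oU) averaged_vector_Cr1.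
(* The expansion is exact, so the remainder constant is 0 and the range of eps is arbitrary. *)
exists (fun j y => if j == 1%N then averaged_vector y else 0), 0, 1; split=> //; split.
- by move=> eps x _ Ux; exists (eps *: f1 x); rewrite Fbar_section.
- by move=> eps _; exact: cstE.
- move=> j _; case: eqP => _; first exact: averaged_vector_Cr1.
  exact: (Crb_cst true (0 : 'rV[R]_n) oU).
- move=> eps y _ _; rewrite mul0r normr_le0 subr_eq0 big_ltn// expr1 eqxx big1_seq ?addr0//.
  move=> j /andP[_]; rewrite mem_index_iota => /andP[j2 _].
  by case: eqP j2 => [->|_ _]; rewrite ?scaler0.
Qed.

Lemma section_curve eps (J : set R) y : open J ->
  integral_curve (Fbar^~ eps) (section G0 U) J y ->
  exists xi : R -> 'rV[R]_k, forall t, J t ->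
    [/\ U (xi t), y t = G0 (xi t, 0) & is_derive t (1 : R) xi (eps *: f1 (xi t))].
Proof.
move=> oJ yP.
have /choice[xi xiP] : forall t, exists x, J t -> U x /\ y t = G0 (x, 0).
  move=> t; have [Jt|nJt] := pselect (J t); last by exists 0.
  by have [[x Ux E] _] := yP t Jt; exists x.
exists xi => t Jt; have [Ux yE] := xiP t Jt; split=> //.
have [_ dy] := yP t Jt; rewrite yE Fbar_section// in dy.
pose q t : P := (xi t, 0).
have nq : \forall t' \near t, U (q t').1 /\ y t' = G0 (q t').
  by apply: filterS (open_nbhs_nbhs (conj oJ Jt)) => t' /xiP.
have [p [_ /is_derive_fst dp pq]] := embedding_lift emb0 nq dy.
have pxi : (fun t => (p t).1) = xi by apply/funext => t'; have [j ->] := pq t'.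
by rewrite pxi in dp.
Qed.

Lemma manifold_curve eps (J : set R) Ge z : M eps = Ge @` O ->
  integral_curve (F^~ eps) (M eps) J z ->
  exists q : R -> P, forall t, J t -> U (q t).1 /\ z t = Ge (q t).
Proof.
move=> ME zP.
have /choice[q qP] : forall t, exists p : P, J t -> U p.1 /\ z t = Ge p.
  move=> t; have [Jt|nJt] := pselect (J t); last by exists (0, 0).
  by have [+ _] := zP t Jt; rewrite ME => -[p [Up _] E]; exists p.
by exists q.
Qed.

Lemma f1_lipschitz (K : set 'rV[R]_k) d : compact (thicken K d) -> thicken K d `<=` U ->
  exists2 L : R, 0 < L & forall x xi, K xi -> `|x - xi| <= d ->
    `|f1 x - f1 xi| <= L * `|x - xi|.
Proof.
move=> cK KU; have [L L0 LP] := compact_diff_bound (frame_rV R k) Cf1 cK KU.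
exists L => // x xi Kxi xd; apply: segment_lipschitz => s /andP[s0 s1].
have Ks : thicken K d (s *: (x - xi) + xi).
  exists xi => //; rewrite addrK normrZ ger0_norm//.
  by apply: le_trans xd; rewrite ler_piMl.
by split; [exact/Cf1.1/KU|exact: LP].
Qed.

Lemma G0_lipschitz (K : set 'rV[R]_k) d : compact (thicken K d) -> thicken K d `<=` U ->
  exists2 L : R, 0 < L & forall x xi s, K xi -> `|x - xi| <= d ->
    `|G0 (x, s) - G0 (xi, s)| <= L * `|x - xi|.
Proof.
move=> cK KU; have per0 : 0 < 2 * pi :> R by rewrite mulr_gt0// pi_gt0.
have [L L0 LP] := periodic_diff_bound per0 oU (Cr2_Cr1 (embedding_smooth emb0))
  (fun x s => @embedding_periodic _ _ _ _ _ _ emb0 x s) cK KU.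
exists L => // x xi t Kxi xd; apply: segment_lipschitz => s /andP[s0 s1].
have E : s *: ((x, t) - (xi, t)) + (xi, t) = (s *: (x - xi) + xi, t).
  by congr (_, _); rewrite /= subrr [s *: 0]mulr0 add0r.
have Ks : thicken K d (s *: (x - xi) + xi).
  exists xi => //; rewrite addrK normrZ ger0_norm//.
  by apply: le_trans xd; rewrite ler_piMl.
have N : `|(x, t) - (xi, t)| <= `|x - xi|.
  by rewrite pair_normE/= subrr normr0 ge_max lexx normr_ge0.
rewrite E; split; first by apply: (embedding_smooth emb0).1; split=> //; exact: KU.
by apply: (le_trans (LP _ _ _ Ks)); rewrite ler_wpM2l// ltW.
Qed.

(** While the averaged motion stays over K, all constants can be taken over a compact thickening of
    K, which contains the slow coordinate of z as long as the two are within d. *)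
Lemma tracks_on_compact (K : set 'rV[R]_k) (C : R) : compact K -> K `<=` U -> 0 < C ->
  tracks F U G0 M Fbar C (fun eps J y =>
    forall t, J t -> `|t| <= C / eps -> section G0 K (y t)).
Proof.
move=> cK KU C_gt0 C0' C0'_gt0.
have per0 : 0 < 2 * pi :> R by rewrite mulr_gt0// pi_gt0.
have [d [d0 cK' K'U]] := compact_thicken cK oU KU.
set K' := thicken K d in cK' K'U.
have [eps0 [c [Ge [X [eps0_gt0 GeP Ge_close Ge_inv XP]]]]] := persistent.
have [cX [epsX [epsX_gt0 cXP]]] := XP K' cK' K'U.
have [B B0 BP] := periodic_bound per0 (Cr1_continuous (Cr2_Cr1 (embedding_smooth emb0)))
  (fun x s => @embedding_periodic _ _ _ _ _ _ emb0 x s) cK' K'U.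
have [Mpi Mpi0 MpiP] := periodic_bound per0 (Cr1_continuous Cpi)
  (fun x s Ux => (periodic s Ux).1) cK' K'U.
have [Mh Mh0 MhP] := periodic_bound per0 (Cr1_continuous Ch)
  (fun x s Ux => (periodic s Ux).2) cK' K'U.
have [Mdpi Mdpi0 MdpiP] := periodic_diff_bound per0 oU Cpi
  (fun x s Ux => (periodic s Ux).1) cK' K'U.
have [Mdh Mdh0 MdhP] := periodic_diff_bound per0 oU Ch
  (fun x s Ux => (periodic s Ux).2) cK' K'U.
have [Lf Lf0 LfP] := f1_lipschitz cK' K'U.
have [LG LG0 LGP] := G0_lipschitz cK' K'U.
have [N N0 NP] := embedding_inverse_lipschitz oU emb0 cK KU.
(* The radius contains the points of M_0 in question and z itself, since eps is at most 1. Absolute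
   values appear because c and cX come without a sign. *)
have [a1 a10 a1P] := perturbed_field_expansion (B + `|c|) m_gt0 CF (normr_ge0 c).
(* [Cu * eps] bounds the correction [u - x], C2 is the constant of [slow_rate], and C0 turns the
   initial distance in R^n into one of the x-coordinates. *)
pose Cu := n%:R * (`|c| * Mpi) + Mh.
pose C2 := n%:R * (a1 * Mpi) + n%:R * (`|c| * (Mdpi * `|cX|)) + Mdh * `|cX|.
pose C0 := N * (`|c| + C0').
pose T1 := tracking_constant Lf Cu C2 C0 C.
have Cu0 : 0 <= Cu by rewrite /Cu addr_ge0 ?(ltW Mh0)// !mulr_ge0// ltW.
have C20 : 0 <= C2.
  by rewrite /C2 !addr_ge0// !mulr_ge0// ?mulr_ge0// ltW.
have C00 : 0 < C0 by rewrite /C0 mulr_gt0// ltr_wpDl.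
have T10 : 0 < T1 by apply: tracking_constant_gt0; rewrite ?(ltW Lf0) ?(ltW C00).
(* The result adds the distance of z from M_0 to the slow error seen through G0. The bounds [d / T1]
   and [d / C0] keep x within d of xi, and [1 / C0] brings the initial point into the range of the
   inverse Lipschitz estimate. *)
exists (`|c| + LG * T1), (Num.min (Num.min eps0 epsX) (Num.min 1
  (Num.min (d / T1) (Num.min (d / C0) C0^-1)))).
split; first by rewrite !lt_min eps0_gt0 epsX_gt0 ltr01 !divr_gt0// invr_gt0 C00.
move=> eps J z y /andP[e0]; rewrite !lt_min.
move=> /andP[/andP[ee0 eeX] /and4P[e1]]; rewrite !ltr_pdivlMr// => eT1 eC0.
rewrite -[C0^-1]mul1r ltr_pdivlMr// => eC0'.
move=> oJ iJ J0 zP yP adm init t Jt tC.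
have e0' := ltW e0.
have range : 0 < eps < eps0 by rewrite e0.
have [embE ME] := GeP eps range.
have [q qP] := manifold_curve ME zP.
have [xi xiP] := section_curve oJ yP.
have nu_le t' : J t' -> `|z t' - G0 (q t')| <= `|c| * eps.
  move=> /qP[Uq ->]; apply: (le_trans (Ge_close _ _ range Uq)).
  by rewrite ler_wpM2r// ler_norm.
have Kxi t' : J t' -> `|t'| <= C / eps -> K (xi t').
  move=> Jt' t'C; have [x Kx xE] := adm t' Jt' t'C; have [Uxi yE _] := xiP t' Jt'.
  by have [<- _] := embedding_inj emb0 (KU _ Kx) Uxi (etrans xE yE).
pose x t' := (q t').1; pose u t' := slow G0 pi_ h eps (z t') (q t').
pose Z t' := F (z t') eps.
pose du t' := Z t' *m pi_ (q t') + (z t' - G0 (q t')) *m 'd pi_ (q t') (X eps (q t')) -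
  eps *: 'd h (q t') (X eps (q t')).
have slowP t' : J t' ->
    is_derive t' (1 : R) x (X eps (q t')).1 /\ is_derive t' (1 : R) u (du t').
  move=> Jt'; have [Uq zE] := qP t' Jt'; have [_ dz] := zP t' Jt'.
  have nq : \forall t'' \near t', U (q t'').1 /\ z t'' = Ge eps (q t'').
    by apply: filterS (open_nbhs_nbhs (conj oJ Jt')) => t'' /qP.
  have ZE : F (z t') eps = 'd (Ge eps) (q t') (X eps (q t')) by rewrite zE; exact: Ge_inv.
  exact: (slow_derive emb0 Cpi Ch periodic pi_section eps embE nq dz ZE).
have cx t' : J t' -> `|t'| <= C / eps -> {for t', continuous x}.
  by move=> Jt' _; exact: (is_derive_continuous (slowP t' Jt').1).
have dxi t' : J t' -> `|t'| <= C / eps ->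
    K (xi t') /\ is_derive t' (1 : R) xi (eps *: f1 (xi t')).
  by move=> Jt' t'C; have [_ _ dxi] := xiP t' Jt'; split=> //; exact: Kxi.
have rate t' : J t' -> `|t'| <= C / eps -> `|x t' - xi t'| <= d ->
    [/\ is_derive t' (1 : R) u (du t'), `|du t' - eps *: f1 (x t')| <= C2 * eps ^+ 2 &
      `|u t' - x t'| <= Cu * eps].
  move=> Jt' t'C xd; have [_ du_] := slowP t' Jt'; have [Uq zE] := qP t' Jt'.
  have K'q : K' (q t').1 by exists (xi t') => //; exact: Kxi.
  have qE : q t' = ((q t').1, (q t').2) by case: (q t').
  have Gq : `|G0 (q t')| <= B by rewrite qE; exact: BP.
  have zq : `|z t'| <= B + `|c|.
    rewrite -(subrK (G0 (q t')) (z t')) addrC; apply: (le_trans (ler_normD _ _)).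
    by rewrite lerD//; apply: (le_trans (nu_le t' Jt')); rewrite ler_piMr// ltW.
  have Gq' : `|G0 (q t')| <= B + `|c| by apply: (le_trans Gq); rewrite lerDl.
  have eps1 : 0 < eps <= 1 by rewrite e0 ltW.
  have Rb := a1P _ _ _ Gq' zq eps1 (nu_le t' Jt').
  have pib : `|pi_ (q t')| <= Mpi by rewrite qE; exact: MpiP.
  have hb : `|h (q t')| <= Mh by rewrite qE; exact: MhP.
  have rangeX : 0 < eps < epsX by rewrite e0.
  have Xb : `|X eps (q t') - (0, w (q t').1)| <= `|cX| * eps.
    by apply: (le_trans (cXP _ _ rangeX K'q)); rewrite ler_wpM2r// ler_norm.
  have ZE : Z t' = Fi 0%N (G0 (q t')) + (z t' - G0 (q t')) *m 'J (Fi 0%N) (G0 (q t')) +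
      eps *: Fi 1%N (G0 (q t')) + (F (z t') eps - Fi 0%N (G0 (q t')) -
      (z t' - G0 (q t')) *m 'J (Fi 0%N) (G0 (q t')) - eps *: Fi 1%N (G0 (q t'))).
    rewrite /Z; move: (F _ _) (Fi 0%N _) (_ *m _) (eps *: _) => v1 v2 v3 v4.
    by apply/rowP => i; rewrite !mxE; ring.
  have dpib v : `|'d pi_ (q t') v| <= Mdpi * `|v| by rewrite qE; exact: MdpiP.
  have dhb v : `|'d h (q t') v| <= Mdh * `|v| by rewrite qE; exact: MdhP.
  split; first exact: du_.
    exact: (slow_rate pi_section pi_transport h_transport G0_flow Uq e0' ZE pib dpib dhb
        (ltW Mdpi0) (ltW Mdh0) Rb (nu_le t' Jt') Xb).
  have -> : u t' - x t' = (z t' - G0 (q t')) *m pi_ (q t') - eps *: h (q t').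
    rewrite /u /slow -/(x t'); move: (_ *m _) (eps *: _) => v1 v2.
    by apply/rowP => i; rewrite !mxE; ring.
  apply: (le_trans (ler_normB _ _)); rewrite normrZ (ger0_norm e0') /Cu mulrDl lerD//.
    apply: (le_trans (mx_norm_mul _ _)); rewrite -!mulrA ler_wpM2l// mulrA.
    by rewrite [leRHS]mulrAC; apply: ler_pM => //; exact: nu_le.
  by rewrite [leRHS]mulrC ler_wpM2l.
have x0 : `|x 0 - xi 0| <= C0 * eps.
  have [Uq zE] := qP 0 J0; have [Uxi yE _] := xiP 0 J0.
  have Kxi0 : K (xi 0) by apply: Kxi => //; rewrite normr0 divr_ge0// ltW.
  have Gq : `|G0 (q 0) - G0 (xi 0, 0)| <= (`|c| + C0') * eps.
    rewrite -(subrKA (z 0)) -yE; apply: (le_trans (ler_normD _ _)).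
    by rewrite mulrDl lerD// distrC; exact: nu_le.
  have Gq1 : `|G0 (q 0) - G0 (xi 0, 0)| * N <= 1.
    apply: (@le_trans _ _ ((`|c| + C0') * eps * N)); first by rewrite ler_wpM2r// ltW.
    by apply: le_trans (ltW eC0'); rewrite /C0 le_eqVlt; apply/orP; left; apply/eqP; ring.
  apply: (le_trans (NP _ _ Kxi0 Uq Gq1)).
  by rewrite /C0 -mulrA ler_wpM2l// ltW.
have T1d : T1 * eps < d by rewrite mulrC.
have C0d : C0 * eps < d by rewrite mulrC.
have x_xi : `|x t - xi t| <= T1 * eps.
  exact: (tracking (ltW Lf0) Cu0 C20 (ltW C00) LfP iJ J0 e0 T1d C0d cx dxi rate x0 Jt tC).
have [Uxi yE _] := xiP t Jt; have [Uq zE] := qP t Jt.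
(* The comparison point on the averaged orbit takes the phase of z itself, so no phase error
   enters. *)
have orb : orbit_through U G0 (y t) (G0 (xi t, (q t).2)) by exists (xi t), (q t).2.
apply: (le_trans (dist_set_le _ orb)); rewrite -(subrKA (G0 (q t))).
apply: (le_trans (ler_normD _ _)); rewrite mulrDl lerD ?nu_le// -mulrA.
have xd : `|x t - xi t| <= d by apply: (le_trans x_xi); rewrite mulrC ltW.
have qE : q t = ((q t).1, (q t).2) by case: (q t).
rewrite {1}qE; apply: (le_trans (LGP _ _ _ (Kxi t Jt tC) xd)).
by rewrite ler_wpM2l// ltW.
Qed.

(** With B a bound of f1 on the thickening of K by d, the averaged motion has speed at most
    [eps * B]; up to time [d / (2 * B * eps)] it moves by at most [d / 2] and stays over the
    thickening, where [tracks_on_compact] applies. *)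
Lemma tracks_from_compact (K : set 'rV[R]_k) : compact K -> K `<=` U ->
  exists2 C : R, 0 < C & tracks F U G0 M Fbar C (fun _ _ y => section G0 K (y 0)).
Proof.
move=> cK KU; have [d [d0 cK' K'U]] := compact_thicken cK oU KU.
have [B B0 BP] := compact_bound cK' (fun x K'x => Cr1_continuous Cf1 (K'U x K'x)).
have C_gt0 : 0 < d / (2 * B) by rewrite divr_gt0// mulr_gt0.
exists (d / (2 * B)) => // C0 C0_gt0.
have [C1 [eps1 [eps1_gt0 HP]]] := tracks_on_compact cK' K'U C_gt0 C0_gt0.
exists C1, eps1; split=> // eps J z y er oJ iJ J0 zP yP [x0 Kx0 x0E].
apply: (HP eps J z y er oJ iJ J0 zP yP) => t Jt tC.
have e0 : 0 < eps by case/andP: er.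
have [xi xiP] := section_curve oJ yP.
have [Uxi yE _] := xiP t Jt; have [Uxi0 yE0 _] := xiP 0 J0.
exists (xi t) => //.
have [x0xi _] := embedding_inj emb0 (KU _ Kx0) Uxi0 (etrans x0E yE0); rewrite x0xi in Kx0.
exists (xi 0) => //; apply/ltW.
apply: (stay_close (dx := fun t => eps *: f1 (xi t)) (b := eps * B) iJ J0 Jt) => //.
- move: tC; rewrite ler_pdivlMr// => tC.
  have : B * (`|t| * eps) <= B * (d / (2 * B)) by rewrite ler_wpM2l// ltW.
  have -> : B * (d / (2 * B)) = d / 2 by field; rewrite gt_eqF.
  lra.
- by rewrite mulr_ge0// ltW.
- by move=> s /xiP[].
- move=> s Js sd; rewrite normrZ gtr0_norm//; apply: ler_wpM2l; first exact: ltW.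
  by apply: BP; exists (xi 0).
Qed.

End Averaging.

Theorem corollary4p4 (R : realType) (m k n : nat)
    (hm : (1 <= m)%N) (hk : (1 <= k)%N) (hkn : (k < n - 1)%N) :
  exists r : nat,
  forall (Fi : nat -> 'rV[R]_n -> 'rV[R]_n) (U : set 'rV[R]_k)
         (gamma0 : 'rV[R]_k -> R -> 'rV[R]_n) (tau : 'rV[R]_k -> R)
         (Phi : 'rV[R]_k -> R -> R -> 'M[R]_n) (M : R -> set 'rV[R]_n),
  let F := perturbed_field m Fi in
  let G0 := Gamma0 gamma0 tau in
  (forall i, (i <= m)%N -> Cr r setT (Fi i)) ->
  open U ->
  periodic_family r (Fi 0%N) U gamma0 tau ->
  embedding r U G0 ->
  transition_matrix (Fi 0%N) U gamma0 Phi ->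
  normally_hyperbolic U gamma0 tau Phi ->
  persistent_manifold r F U G0 tau M ->
  exists Fbar : 'rV[R]_n -> R -> 'rV[R]_n,
    averaged_field m U G0 Fbar /\
    forall K : set 'rV[R]_k, compact K -> K `<=` U ->
      (exists2 C : R, 0 < C &
         tracks F U G0 M Fbar C (fun _ _ y => section G0 K (y 0))) /\
      (forall C : R, 0 < C ->
         tracks F U G0 M Fbar C (fun eps J y =>
           forall t, J t -> `|t| <= C / eps -> section G0 K (y t))).
Proof.
(* Two derivatives make the Jacobian of the unperturbed field along the orbits and the differential
   of the embedding C^1, hence also pi, h and f1. *)
exists 2 => Fi U gamma0 tau Phi M F G0 CF oU fam emb tm nh pers.
have [pi_ [h [f1 [[Cpi Ch Cf1] [per sec tr_pi tr_h flow]]]]] :=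
  family_averaging_data fam (CF 0%N isT) (Cr2_Cr1 (CF 1%N hm)) oU emb tm nh.
exists (Fbar U G0 f1); split; first exact: Fbar_averaged.
move=> K cK KU; split.
  exact: (tracks_from_compact hm CF oU emb pers Cpi Ch Cf1 per sec tr_pi tr_h flow cK KU).
move=> C C0.
exact: (tracks_on_compact hm CF oU emb pers Cpi Ch Cf1 per sec tr_pi tr_h flow cK KU C0).
Qed.
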